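(* Let $\mathscr{F}$ be the Fourier operator on $L^2(\mathbb{R})$ and, for $\lambda\in\{1,-1,i,-i\}$, let $\mathcal{X}_\lambda=\{x\in L^2(\mathbb{R}):\mathscr{F}x=\lambda x\}$. For a function $\psi$ defined on the imaginary axis, consider the two representations $$\text{(A)}\quad x(t)=\frac{1}{2\pi}\int_{-\infty}^{\infty}\psi(i\eta)\,2^{\frac{i\eta}{2}}\,\Gamma\Big(\frac14+\frac{i\eta}{2}\Big)\,t^{-(\frac12+i\eta)}\,d\eta,\quad 0<t<\infty,$$ $$\text{(B)}\quad x(t)=\frac{1}{2\pi}\int_{-\infty}^{\infty}\psi(i\eta)\,2^{\frac{i\eta}{2}}\,\Gamma\Big(\frac34+\frac{i\eta}{2}\Big)\,t^{-(\frac12+i\eta)}\,d\eta,\quad 0<t<\infty,$$ and the two conditions $$\text{(a)}\quad \int_{-\infty}^{\infty}|\psi(i\eta)|^2\Big|\Gamma\Big(\frac14+i\frac{\eta}{2}\Big)\Big|^2d\eta<\infty,\qquad \text{(b)}\quad \int_{-\infty}^{\infty}|\psi(i\eta)|^2\Big|\Gamma\Big(\frac34+i\frac{\eta}{2}\Big)\Big|^2d\eta<\infty.$$ 1. If $x\in\mathcal{X}_1$, then on the positive half-axis $x$ is representable in the form (A), where $\psi$ is an even function on the imaginary axis satisfying (a). Conversely, if $\psi$ is an even function on the imaginary axis satisfying (a), and $x$ is defined by (A) on $(0,\infty)$ and extended to $\mathbb{R}$ as an even function, then $x\in\mathcal{X}_1$. 2. If $x\in\mathcal{X}_{-1}$,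 then on the positive half-axis $x$ is representable in the form (A), where $\psi$ is an odd function on the imaginary axis satisfying (a). Conversely, if $\psi$ is an odd function on the imaginary axis satisfying (a), and $x$ is defined by (A) on $(0,\infty)$ and extended to $\mathbb{R}$ as an even function, then $x\in\mathcal{X}_{-1}$. 3. If $x\in\mathcal{X}_{i}$, then on the positive half-axis $x$ is representable in the form (B), where $\psi$ is an even function on the imaginary axis satisfying (b). Conversely, if $\psi$ is an even function on the imaginary axis satisfying (b), and $x$ is defined by (B) on $(0,\infty)$ and extended to $\mathbb{R}$ as an odd function, then $x\in\mathcal{X}_{i}$. 4. If $x\in\mathcal{X}_{-i}$, then on the positive half-axis $x$ is representable in the form (B), where $\psi$ is an odd function on the imaginary axis satisfying (b). Conversely, if $\psi$ is an odd function on the imaginary axis satisfying (b), and $x$ is defined by (B) on $(0,\infty)$ and extended to $\mathbb{R}$ as an odd function, then $x\in\mathcal{X}_{-i}$. In each of the four cases the correspondence between $x(t)$ and $\psi(i\eta)$ is one-to-one. Moreover, the Parseval identity holds: $$\int_0^\infty|x(t)|^2dt=\frac{1}{2\pi}\int_{-\infty}^{\infty}|\psi(i\eta)|^2\Big|\Gamma\Big(\frac14+i\frac{\eta}{2}\Big)\Big|^2d\eta$$ in cases 1 and 2, and $$\int_0^\infty|x(t)|^2dt=\frac{1}{2\pi}\int_{-\infty}^{\infty}|\psi(i\eta)|^2\Big|\Gamma\Big(\frac34+i\frac{\eta}{2}\Big)\Big|^2d\eta$$ in cases 3 and 4.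
   Context: The Fourier operator $\mathscr{F}$ is the unitary operator on the complex Hilbert space $L^2(\mathbb{R})$ given by $(\mathscr{F}x)(t)=\frac{1}{\sqrt{2\pi}}\int_{-\infty}^{\infty}x(\xi)e^{it\xi}\,d\xi$ (extended by continuity to $L^2(\mathbb{R})$). $\Gamma$ is the Euler Gamma function. Functions are complex-valued, measurable, and identified when equal almost everywhere; $\psi$ is defined only on the imaginary axis $\{i\eta:\eta\in\mathbb{R}\}$, and even (odd) means $\psi(-i\eta)=\psi(i\eta)$ (respectively $\psi(-i\eta)=-\psi(i\eta)$). The integrals (A), (B) are inverse Mellin transforms $x(t)=\frac{1}{2\pi}\int_{-\infty}^{\infty}\varphi(\frac12+i\eta)\,t^{-(\frac12+i\eta)}\,d\eta$ of a function $\varphi(\frac12+i\eta)$ with $\int_{-\infty}^\infty|\varphi(\frac12+i\eta)|^2d\eta<\infty$. Such an integral is understood literally when $\varphi$ decays fast enough, and in general by $L^2$-approximation: the inverse Mellin transform is extended by continuity from a dense set using the Parseval identity $\int_0^\infty|x(t)|^2dt=\frac{1}{2\pi}\int_{-\infty}^\infty|\varphi(\frac12+i\eta)|^2d\eta$, giving a one-to-one correspondence between $\varphi\in L^2$ on the line $\mathrm{Re}\,\zeta=\frac12$ and $x\in L^2(0,\infty)$. *)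

(* Defs.v *)
From HB Require Import structures.
From mathcomp Require Import all_boot all_order all_algebra.
From mathcomp Require Import all_classical all_reals all_analysis.
From mathcomp Require Import complex.
Set Implicit Arguments.
Unset Strict Implicit.
Unset Printing Implicit Defensive.
Import Order.TTheory GRing.Theory Num.Theory.
Import numFieldNormedType.Exports.
Import ComplexField.Normc.
Local Notation Re := complex.Re.
Local Notation Im := complex.Im.
Local Open Scope classical_set_scope.
Local Open Scope ring_scope.

Definition cexp (R : realType) (z : R[i]) : R[i] :=
  (expR (Re z))%:C%C * (cos (Im z) +i* sin (Im z))%C.

(* Principal power of a positive real base; only used for [0 < a]. *)
Definition cpow (R : realType) (a : R) (z : R[i]) : R[i] :=
  cexp (z * (ln a)%:C%C).

Definition positive_axis (R : realType) : set R := `]0, +oo[%classic.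
Arguments positive_axis : clear implicits.

(* Functions are identified up to equality almost everywhere, so working with
   Borel representatives loses nothing. *)
Definition cmeasurable (R : realType) (D : set R) (f : R -> R[i]) : Prop :=
  measurable_fun D (fun t => Re (f t)) /\ measurable_fun D (fun t => Im (f t)).

(* The value is meaningful for functions in [L1 D]. *)
Definition cintegral (R : realType) (D : set R) (f : R -> R[i]) : R[i] :=
  (Rintegral lebesgue_measure D (fun t => Re (f t))
   +i* Rintegral lebesgue_measure D (fun t => Im (f t)))%C.

Definition L1 (R : realType) (D : set R) : set (R -> R[i]) :=
  [set f | cmeasurable D f /\
     (\int[lebesgue_measure]_(t in D) (normc (f t))%:E < +oo)%E].

Definition sqnorm2 (R : realType) (D : set R) (f : R -> R[i]) : \bar R :=
  (\int[lebesgue_measure]_(t in D) (normc (f t) ^+ 2)%:E)%E.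

Definition L2 (R : realType) (D : set R) : set (R -> R[i]) :=
  [set f | cmeasurable D f /\ (sqnorm2 D f < +oo)%E].

(* Euler's integral; it is only used on the half-plane [0 < Re z], where it
   converges absolutely. *)
Definition cGamma (R : realType) (z : R[i]) : R[i] :=
  cintegral (positive_axis R) (fun t => cpow t (z - 1) * (expR (- t))%:C%C).

(* Graph of the extension by continuity to [L2 D] of an operator [T] given by
   an integral formula on the dense subspace [L1 D `&` L2 D]:
   [L2_extension D E T f g] means that [g] is the image of [f] in [L2 E]. *)
Definition L2_extension (R : realType) (D E : set R)
    (T : (R -> R[i]) -> (R -> R[i])) (f g : R -> R[i]) : Prop :=
  [/\ L2 D f, L2 E g &
      exists f_ : nat -> R -> R[i],
        [/\ forall n, (L1 D `&` L2 D) (f_ n),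
            (fun n => sqnorm2 D (fun s => f_ n s - f s)) @ \oo --> (0 : \bar R)
          & (fun n => sqnorm2 E (fun t => T (f_ n) t - g t)) @ \oo
              --> (0 : \bar R)]].

Definition fourier_integral (R : realType) (x : R -> R[i]) (t : R) : R[i] :=
  ((Num.sqrt (2 * pi))^-1)%:C%C *
  cintegral setT (fun xi => x xi * cexp (0 +i* (t * xi))%C).

(* [fourier x y] : the Fourier operator maps the class of [x] to that of [y]. *)
Definition fourier (R : realType) (x y : R -> R[i]) : Prop :=
  L2_extension setT setT (@fourier_integral R) x y.

Definition fourier_eigenspace (R : realType) (lambda : R[i]) :
    set (R -> R[i]) :=
  [set x | fourier x (fun t => lambda * x t)].

(* Here and below a function on a vertical line of the complex plane is given
   through the ordinate: [phi eta] stands for [phi(1/2 + i eta)], and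
   [psi eta] for [psi(i eta)]. *)
Definition inverse_mellin_integral (R : realType) (phi : R -> R[i]) (t : R) :
    R[i] :=
  ((2 * pi)^-1)%:C%C *
  cintegral setT (fun eta => phi eta * cpow t (- (2^-1 +i* eta)%C)).

Definition inverse_mellin (R : realType) (phi x : R -> R[i]) : Prop :=
  L2_extension setT (positive_axis R) (@inverse_mellin_integral R) phi x.

(* [represented a psi x] : on the positive half-axis,
     x(t) = 1/(2 pi) \int psi(i eta) 2^(i eta/2) Gamma(a + i eta/2)
                          t^(-(1/2 + i eta)) d eta. *)
Definition represented (R : realType) (a : R) (psi x : R -> R[i]) : Prop :=
  inverse_mellin (fun eta => psi eta * cpow 2 (0 +i* (eta / 2))%C
                             * cGamma (a +i* (eta / 2))%C) x.

Definition weighted_sqnorm2 (R : realType) (a : R) (psi : R -> R[i]) : \bar R :=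
  (\int[lebesgue_measure]_(eta in setT)
     (normc (psi eta) ^+ 2 * normc (cGamma (a +i* (eta / 2))%C) ^+ 2)%:E)%E.

Definition weighted_L2 (R : realType) (a : R) : set (R -> R[i]) :=
  [set psi | cmeasurable setT psi /\ (weighted_sqnorm2 a psi < +oo)%E].

(* Parity is a property of classes of functions modulo a.e. equality. *)
Definition even_fun (R : realType) : set (R -> R[i]) :=
  [set psi | ae_eq lebesgue_measure setT (fun eta => psi (- eta)) psi].

Definition odd_fun (R : realType) : set (R -> R[i]) :=
  [set psi | ae_eq lebesgue_measure setT (fun eta => psi (- eta))
               (fun eta => - psi eta)].
Arguments even_fun : clear implicits.
Arguments odd_fun : clear implicits.

Definition even_extension (R : realType) (x : R -> R[i]) (t : R) : R[i] :=
  x `|t|.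

Definition odd_extension (R : realType) (x : R -> R[i]) (t : R) : R[i] :=
  (Num.sg t)%:C%C * x `|t|.

Definition one_to_one (R : realType) (X Psi : set (R -> R[i]))
    (rep : (R -> R[i]) -> (R -> R[i]) -> Prop) : Prop :=
  [/\ forall x, X x -> exists2 psi, Psi psi & rep psi x,
      forall psi, Psi psi -> exists2 x, X x & rep psi x,
      forall x psi1 psi2, X x -> Psi psi1 -> Psi psi2 ->
        rep psi1 x -> rep psi2 x -> ae_eq lebesgue_measure setT psi1 psi2
    & forall psi x1 x2, Psi psi -> X x1 -> X x2 ->
        rep psi x1 -> rep psi x2 -> ae_eq lebesgue_measure setT x1 x2].

(* Main.v *)
(* The substitution t = exp(-u) turns the inverse Mellin transform on the line
   Re = 1/2 into the Fourier operator, so that by Plancherel every x in L2(0,oo)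
   is the inverse Mellin transform of a unique phi in L2(R). The Gaussians
   exp(-e^(2b) t^2/2) (for even x), or t times these (for odd x), are permuted by
   the Fourier operator, which sends the parameter b to -b up to a scalar, while
   their Mellin transforms are m(-eta) exp(i b eta) up to a scalar, with
   m(eta) = 2^(i eta/2) Gamma(al + i eta/2) and al = 1/4 or 3/4. Pairing x and
   y = F x with all of them gives, phi and phi' being the Mellin transforms of x
   and y, the relation phi'(eta) m(-eta) = c phi(-eta) m(eta) with c = 1 or i.
   Since m has no zero, psi = phi / m is defined, and y = lambda x amounts to
   lambda psi(eta) = c psi(-eta), which is the asserted parity of psi. *)
Require Import Defs.
From HB Require Import structures.
From mathcomp Require Import all_boot all_order all_algebra.
From mathcomp Require Import all_classical all_reals all_analysis.
From mathcomp Require Import measurable_realfun.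
From mathcomp Require Import complex ring lra.
Set Implicit Arguments.
Unset Strict Implicit.
Unset Printing Implicit Defensive.
Import Order.TTheory GRing.Theory Num.Theory.
Import numFieldNormedType.Exports.
Import ComplexField.Normc.
Local Notation Re := complex.Re.
Local Notation Im := complex.Im.
Local Open Scope classical_set_scope.
Local Open Scope ring_scope.
Local Notation mu := lebesgue_measure.
Local Notation Int f := (Rintegral mu setT f).
Local Notation Itg f := (mu.-integrable setT (EFin \o f)).
Local Notation cInt f := (cintegral setT f).
Local Notation N2 f := (Int (fun t => normc (f t) ^+ 2)).

(** * Real integrals *)

(** [fourier] and [inverse_mellin] are graphs of closures, and an element of L2 has no pointwise
    transform. Hence most arguments run by duality: [weak_fourier] describes an image through its
    pairings with test functions in L1 and L2, which spares the handling of approximating sequences.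
    Plancherel rests on the explicit transform of Gaussians: damping by them yields a contraction,
    and totality of their translates yields inversion, whence surjectivity and equality of norms.
    The dilated Gaussians of the overview separate functions because the pairing with the member of
    parameter b is, up to a nonzero factor, the Fourier transform at b of an integrable function;
    injectivity of the Fourier operator takes the place of a density argument. Applying F twice is a
    reflection, so an eigenfunction has parity lambda^2, which decides between al = 1/4 and al =
    3/4; writing lambda = c tau with tau = 1 or -1 treats the four cases together. That Gamma has no
    zero on the lines used is derived from its functional equation and a positivity estimate far to
    the right. *)

Section RealIntegral.
Context {R : realType}.
Implicit Types f g : R -> R.

Lemma aeS (P Q : R -> Prop) : (forall x, P x -> Q x) ->
  (\forall x \ae @mu R, P x) -> \forall x \ae @mu R, Q x.
Proof.
by move=> PQ; apply: filterS => //; exact: (ae_filter_ringOfSetsType mu).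
Qed.

Lemma aeI (P Q : R -> Prop) : (\forall x \ae @mu R, P x) ->
  (\forall x \ae @mu R, Q x) -> \forall x \ae @mu R, P x /\ Q x.
Proof.
move=> aP aQ; apply: filterI => //; exact: (ae_filter_ringOfSetsType mu).
Qed.

Lemma itg_measurable f : Itg f -> measurable_fun setT f.
Proof. by move/measurable_int/measurable_EFinP. Qed.

Lemma itgP f : measurable_fun setT f ->
  (\int[mu]_x (`|f x|)%:E < +oo)%E -> Itg f.
Proof.
by move=> mf fi; apply/integrableP; split => //; exact/measurable_EFinP.
Qed.

Lemma itg_lty f : Itg f -> (\int[mu]_x (`|f x|)%:E < +oo)%E.
Proof. by move/integrableP => []. Qed.

Lemma itgD f g : Itg f -> Itg g -> Itg (fun x => f x + g x).
Proof. by move=> fi gi; have := integrableD measurableT fi gi. Qed.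

Lemma itgB f g : Itg f -> Itg g -> Itg (fun x => f x - g x).
Proof. by move=> fi gi; have := integrableB measurableT fi gi. Qed.

Lemma itgZ (c : R) f : Itg f -> Itg (fun x => c * f x).
Proof. by move=> fi; have := integrableZl measurableT c fi. Qed.

Lemma itg_norm f : Itg f -> Itg (fun x => `|f x|).
Proof. exact: integrable_norm. Qed.

Lemma itg_le f g : measurable_fun setT f -> (forall x, `|f x| <= g x) ->
  Itg g -> Itg f.
Proof.
move=> mf fg gi; apply: (le_integrable measurableT _ _ gi).
  exact/measurable_EFinP.
by move=> x _ /=; rewrite lee_fin (le_trans (fg x))// ler_norm.
Qed.

Lemma itg_bounded f g (M : R) : measurable_fun setT f ->
  (forall x, `|f x| <= M) -> Itg g -> Itg (fun x => f x * g x).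
Proof.
move=> mf fM gi; have mg := itg_measurable gi.
apply: (@itg_le _ (fun x => M * `|g x|)).
- exact: measurable_funM.
- by move=> x; rewrite normrM ler_wpM2r.
- by apply: itgZ; exact: itg_norm.
Qed.

Lemma intD f g : Itg f -> Itg g -> Int (fun x => f x + g x) = Int f + Int g.
Proof. exact: RintegralD. Qed.

Lemma intB f g : Itg f -> Itg g -> Int (fun x => f x - g x) = Int f - Int g.
Proof. exact: RintegralB. Qed.

Lemma intZ (c : R) f : Itg f -> Int (fun x => c * f x) = c * Int f.
Proof. exact: RintegralZl. Qed.

Lemma intN f : Itg f -> Int (fun x => - f x) = - Int f.
Proof.
by move=> fi; rewrite -mulN1r -intZ//; congr Rintegral; apply/funext => x; ring.
Qed.

Lemma int_le f g : Itg f -> Itg g -> (forall x, f x <= g x) -> Int f <= Int g.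
Proof. by move=> fi gi fg; apply: le_Rintegral. Qed.

Lemma norm_int_le f g : Itg g -> measurable_fun setT f ->
  (forall x, `|f x| <= g x) -> `|Int f| <= Int g.
Proof.
move=> gi mf fg; have fi := itg_le mf fg gi.
apply: le_trans (le_normr_Rintegral measurableT fi) _.
by apply: int_le => //; exact: itg_norm.
Qed.

Lemma EFin_int f : Itg f -> (Int f)%:E = (\int[mu]_x (f x)%:E)%E.
Proof. by move=> fi; rewrite /Rintegral fineK//; exact: integrable_fin_num. Qed.

Lemma int_ae_eq f g : measurable_fun setT f -> measurable_fun setT g ->
  ae_eq mu setT f g -> Int f = Int g.
Proof.
move=> mf mg fg; congr fine; apply: ae_eq_integral => //.
- exact/measurable_EFinP.
- exact/measurable_EFinP.
- by apply: filterS fg => x /= + _ => /(_ I) ->.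
Qed.

Lemma itg_ae_eq f g : measurable_fun setT f -> measurable_fun setT g ->
  ae_eq mu setT f g -> Itg f -> Itg g.
Proof.
move=> mf mg fg fi; apply: itgP => //.
rewrite -(@ge0_ae_eq_integral _ _ _ mu setT (fun x => (`|f x|)%:E))//.
- exact: itg_lty.
- by apply/measurable_EFinP; exact: measurableT_comp.
- by apply/measurable_EFinP; exact: measurableT_comp.
- by apply: filterS fg => x /= + _ => /(_ I) ->.
Qed.

Lemma int_dominated_cvg (f_ : nat -> R -> R) f g :
  (forall n, measurable_fun setT (f_ n)) -> measurable_fun setT f -> Itg g ->
  (\forall x \ae mu, f_ ^~ x @ \oo --> f x) ->
  (forall n x, `|f_ n x| <= g x) ->
  (fun n => Int (f_ n)) @ \oo --> Int f.
Proof.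
move=> mf_ mf gi f_f f_g.
have h1 n : measurable_fun setT (EFin \o f_ n) by exact/measurable_EFinP.
have h2 : measurable_fun setT (EFin \o f) by exact/measurable_EFinP.
have h3 : \forall x \ae mu, setT x -> (fun n => (f_ n x)%:E) @ \oo --> (f x)%:E.
  by apply: aeS f_f => x h _; apply: cvg_EFin; [exact: nearW|exact: h].
have h4 : \forall x \ae mu, forall n, setT x -> (`|(f_ n x)%:E| <= (g x)%:E)%E.
  by apply: aeW => x n _; rewrite lee_fin.
have [//|//|//|//|//|fi _ h] := @dominated_convergence _ _ R mu setT measurableT
  (fun n => EFin \o f_ n) (EFin \o f) (EFin \o g).
rewrite -(EFin_int fi) in h.
exact: fine_cvg h.
Qed.

End RealIntegral.

(** * Fubini for real-valued iterated integrals *)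

Section Fubini.
Context {R : realType}.
Variable f : R * R -> R.
Hypothesis mf : measurable_fun setT f.
Hypothesis fi : (\int[@lebesgue_measure R]_x \int[@lebesgue_measure R]_y
  (`|f (x, y)|)%:E < +oo)%E.

Let imf : (@lebesgue_measure R \x @lebesgue_measure R)%E.-integrable setT
  (EFin \o f).
Proof. by apply/integrable12ltyP => //; exact/measurable_EFinP. Qed.

(** Sections of an integrable function are integrable only almost everywhere; elsewhere [fine] may
    return its default value 0. *)
Let ae1 : \forall x \ae @mu R,
  (Int (fun y => f (x, y)))%:E = (\int[mu]_y (f (x, y))%:E)%E.
Proof.
apply: aeS (ae_integrable1 imf) => x xi.
by rewrite /Rintegral fineK//; exact: integrable_fin_num xi.
Qed.

Let ae2 : \forall y \ae @mu R,
  (Int (fun x => f (x, y)))%:E = (\int[mu]_x (f (x, y))%:E)%E.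
Proof.
apply: aeS (ae_integrable2 imf) => x xi.
by rewrite /Rintegral fineK//; exact: integrable_fin_num xi.
Qed.

Lemma measurable_int1 : measurable_fun setT (fun x => Int (fun y => f (x, y))).
Proof.
apply: measurableT_comp => //.
exact: (measurable_fubini_F imf).
Qed.

Lemma measurable_int2 : measurable_fun setT (fun y => Int (fun x => f (x, y))).
Proof.
apply: measurableT_comp => //.
exact: (measurable_fubini_G imf).
Qed.

Lemma itg_int1 : Itg (fun x => Int (fun y => f (x, y))).
Proof.
have h := integrable_fubini_F imf.
apply/integrableP; split; first by apply/measurable_EFinP; exact: measurable_int1.
case/integrableP : h => _; apply: le_lt_trans.
rewrite le_eqVlt; apply/orP; left; apply/eqP.
apply: ge0_ae_eq_integral => //.
- apply: measurableT_comp => //.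
  by apply/measurable_EFinP; exact: measurable_int1.
- apply: measurableT_comp => //; exact: (measurable_fubini_F imf).
- apply: aeS ae1 => x e _. by congr (`|_|)%E; exact: e.
Qed.

Lemma int_fubini :
  Int (fun x => Int (fun y => f (x, y))) = Int (fun y => Int (fun x => f (x, y))).
Proof.
rewrite /Rintegral; congr fine.
transitivity (\int[@lebesgue_measure R]_x \int[@lebesgue_measure R]_y
  (EFin \o f) (x, y))%E.
  apply: ae_eq_integral => //.
  - apply/measurable_EFinP; exact: measurable_int1.
  - exact: (measurable_fubini_F imf).
  - by apply: aeS ae1 => x /= + _.
rewrite Fubini//; apply: ae_eq_integral => //.
- exact: (measurable_fubini_G imf).
- apply/measurable_EFinP; exact: measurable_int2.
- by apply: aeS ae2 => x /= + _.
Qed.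

End Fubini.

(** The hypothesis bounds one order of integration; Tonelli transfers it to the other order, and
    exchanging the coordinates reduces to [itg_int1]. *)
Lemma itg_int2 {R : realType} (f : R * R -> R) : measurable_fun setT f ->
  (\int[@lebesgue_measure R]_x \int[@lebesgue_measure R]_y
    (`|f (x, y)|)%:E < +oo)%E ->
  Itg (fun y => Int (fun x => f (x, y))).
Proof.
move=> mf fi.
have ms : measurable_fun setT (fun p : R * R => f (p.2, p.1)).
  have mswap : measurable_fun (setT : set (R * R)) (fun p : R * R => (p.2, p.1)).
    by apply: measurable_fun_pair.
  exact: (measurableT_comp mf mswap).
apply: (itg_int1 ms).
rewrite -(@fubini_tonelli _ _ _ _ R (@lebesgue_measure R) (@lebesgue_measure R)
  (fun p : R * R => (`|f p|)%:E))//.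
by apply/measurable_EFinP; exact: measurableT_comp.
Qed.

(** * Complex numbers and complex integrals *)

Section ComplexBasics.
Context {R : realType}.
Implicit Types z w : R[i].

Lemma complexP z w : Re z = Re w -> Im z = Im w -> z = w.
Proof. by case: z w => [a b] [c d] /= -> ->. Qed.

Lemma cReD z w : Re (z + w) = Re z + Re w. Proof. by case: z; case: w. Qed.
Lemma cImD z w : Im (z + w) = Im z + Im w. Proof. by case: z; case: w. Qed.
Lemma cReN z : Re (- z) = - Re z. Proof. by case: z. Qed.
Lemma cImN z : Im (- z) = - Im z. Proof. by case: z. Qed.
Lemma cReM z w : Re (z * w) = Re z * Re w - Im z * Im w.
Proof. by case: z; case: w. Qed.
Lemma cImM z w : Im (z * w) = Re z * Im w + Im z * Re w.
Proof. by case: z; case: w. Qed.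
Lemma cReC (a : R) : Re a%:C%C = a. Proof. by []. Qed.
Lemma cImC (a : R) : Im a%:C%C = 0. Proof. by []. Qed.
Lemma cReJ z : Re (conjc z) = Re z. Proof. by case: z. Qed.
Lemma cImJ z : Im (conjc z) = - Im z. Proof. by case: z. Qed.

Definition ReImDM := (cReD, cImD, cReN, cImN, cReM, cImM, cReJ, cImJ).
Definition ReImE := (ReImDM, cReC, cImC).

Lemma sqr_normc z : normc z ^+ 2 = Re z ^+ 2 + Im z ^+ 2.
Proof. by case: z => a b /=; rewrite sqr_sqrtr// addr_ge0// sqr_ge0. Qed.

Lemma normc_ge0 z : 0 <= normc z.
Proof. by case: z => a b /=; rewrite sqrtr_ge0. Qed.

Lemma normRe_le z : `|Re z| <= normc z.
Proof.
rewrite -(@ler_pXn2r _ 2)// ?nnegrE ?normc_ge0// sqr_normc real_normK ?num_real//.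
by rewrite lerDl sqr_ge0.
Qed.

Lemma normIm_le z : `|Im z| <= normc z.
Proof.
rewrite -(@ler_pXn2r _ 2)// ?nnegrE ?normc_ge0// sqr_normc real_normK ?num_real//.
by rewrite lerDr sqr_ge0.
Qed.

Lemma normc_le_ReIm z : normc z <= `|Re z| + `|Im z|.
Proof.
rewrite -(@ler_pXn2r _ 2)// ?nnegrE ?normc_ge0 ?addr_ge0// sqr_normc.
rewrite -(real_normK (num_real (Re z))) -(real_normK (num_real (Im z))).
by rewrite sqrrD lerD2r lerDl mulrn_wge0// mulr_ge0.
Qed.

Lemma normc_triangle z w : normc (z + w) <= normc z + normc w.
Proof. exact: le_normcD. Qed.

Lemma normcR (a : R) : normc a%:C%C = `|a|.
Proof. by rewrite /= expr0n/= addr0 sqrtr_sqr. Qed.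

Lemma normcJ z : normc (conjc z) = normc z.
Proof. by case: z => a b /=; rewrite sqrrN. Qed.

Lemma mul_conjc z : z * conjc z = (normc z ^+ 2)%:C%C.
Proof. by apply: complexP; rewrite !ReImE ?sqr_normc; ring. Qed.

Lemma normc_eq0 z : (normc z == 0) = (z == 0).
Proof.
by apply/eqP/eqP => [/eq0_normc//|->]; exact: normc0.
Qed.

(** Parallelogram law with the term |z - w|^2 dropped. *)
Lemma sqr_normcD_le z w :
  normc (z + w) ^+ 2 <= 2 * normc z ^+ 2 + 2 * normc w ^+ 2.
Proof.
rewrite !sqr_normc !ReImE.
have := sqr_ge0 (Re z - Re w); have := sqr_ge0 (Im z - Im w); nra.
Qed.

Lemma normcM_le z w : normc (z * w) <= (normc z ^+ 2 + normc w ^+ 2) / 2.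
Proof.
rewrite normcM; have := sqr_ge0 (normc z - normc w); nra.
Qed.

Lemma real_complexM (a b : R) : (a%:C * b%:C)%C = (a * b)%:C%C.
Proof. by rewrite rmorphM. Qed.

Lemma conjcM z w : conjc (z * w) = conjc z * conjc w.
Proof. by rewrite rmorphM. Qed.

Definition cis (x : R) : R[i] := (cos x +i* sin x)%C.

Lemma cexp_imaginary (x : R) : cexp (0 +i* x)%C = cis x.
Proof. by rewrite /cexp /= expR0 mul1r. Qed.

Lemma cisD (x y : R) : cis (x + y) = cis x * cis y.
Proof.
by apply: complexP; rewrite !ReImE /= ?cosD ?sinD//; ring.
Qed.

Lemma cis0 : cis 0 = 1.
Proof. by rewrite /cis cos0 sin0. Qed.

Lemma cisN (x : R) : cis (- x) = conjc (cis x).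
Proof. by rewrite /cis cosN sinN. Qed.

Lemma normc_cis (x : R) : normc (cis x) = 1.
Proof. by rewrite /= cos2Dsin2 sqrtr1. Qed.

Lemma cexpM_real (z : R[i]) (a : R) :
  cexp (z * a%:C%C) = (expR (Re z * a))%:C%C * cis (Im z * a).
Proof. by rewrite /cexp !ReImE mulr0 subr0 mulr0 add0r. Qed.

End ComplexBasics.

(** * Measurability of complex-valued functions *)

Section ComplexMeasurable.
Context {R : realType} {d} {T : measurableType d}.
Implicit Types f g : T -> R[i].

(** The domain is an arbitrary measurable type, so that functions on [R * R] are covered for Fubini;
    on [R] this is [cmeasurable setT]. *)
Definition cmeas f := measurable_fun setT (fun t => Re (f t)) /\
  measurable_fun setT (fun t => Im (f t)).

Lemma cmeasD f g : cmeas f -> cmeas g -> cmeas (fun t => f t + g t).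
Proof.
move=> [f1 f2] [g1 g2]; split.
- by under eq_fun do rewrite cReD; exact: measurable_funD.
- by under eq_fun do rewrite cImD; exact: measurable_funD.
Qed.

Lemma cmeasN f : cmeas f -> cmeas (fun t => - f t).
Proof.
move=> [f1 f2]; split.
- by under eq_fun do rewrite cReN; exact: measurableT_comp.
- by under eq_fun do rewrite cImN; exact: measurableT_comp.
Qed.

Lemma cmeasB f g : cmeas f -> cmeas g -> cmeas (fun t => f t - g t).
Proof. by move=> mf mg; apply: cmeasD => //; exact: cmeasN. Qed.

Lemma cmeasM f g : cmeas f -> cmeas g -> cmeas (fun t => f t * g t).
Proof.
move=> [f1 f2] [g1 g2]; split.
- by under eq_fun do rewrite cReM; apply: measurable_funB; exact: measurable_funM.
- by under eq_fun do rewrite cImM; apply: measurable_funD; exact: measurable_funM.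
Qed.

Lemma cmeasJ f : cmeas f -> cmeas (fun t => conjc (f t)).
Proof.
move=> [f1 f2]; split.
- by under eq_fun do rewrite cReJ.
- by under eq_fun do rewrite cImJ; exact: measurableT_comp.
Qed.

Lemma cmeas_cst (z : R[i]) : cmeas (fun=> z).
Proof. by split; exact: measurable_cst. Qed.

Lemma cmeasR (h : T -> R) : measurable_fun setT h -> cmeas (fun t => (h t)%:C%C).
Proof. by move=> mh; split => //=; exact: measurable_cst. Qed.

Lemma cmeas_cis (h : T -> R) : measurable_fun setT h -> cmeas (fun t => cis (h t)).
Proof.
move=> mh; split => /=.
- apply: (measurableT_comp _ mh).
  by apply: continuous_measurable_fun; exact: continuous_cos.
- apply: (measurableT_comp _ mh).
  by apply: continuous_measurable_fun; exact: continuous_sin.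
Qed.

Lemma measurable_normc f : cmeas f -> measurable_fun setT (fun t => normc (f t)).
Proof.
move=> [f1 f2].
rewrite (_ : (fun t => _) = (fun t => Num.sqrt (Re (f t) ^+ 2 + Im (f t) ^+ 2))).
  have ms : measurable_fun setT (@Num.sqrt R).
    by apply: continuous_measurable_fun; exact: sqrt_continuous.
  apply: (measurableT_comp ms).
  by apply: measurable_funD; exact: measurable_funX.
by apply/funext => t; case: (f t).
Qed.

Lemma measurable_normc2 f : cmeas f ->
  measurable_fun setT (fun t => normc (f t) ^+ 2).
Proof. by move=> mf; apply: measurable_funX; exact: measurable_normc. Qed.

End ComplexMeasurable.

Lemma cmeas_comp {R : realType} {d d'} {T : measurableType d}
    {T' : measurableType d'} (f : T -> R[i]) (h : T' -> T) :
  measurable_fun setT h -> cmeas f -> cmeas (fun t => f (h t)).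
Proof.
move=> mh [f1 f2]; split.
- exact: measurableT_comp f1 mh.
- exact: measurableT_comp f2 mh.
Qed.

(** * Complex integrals and absolute integrability *)

Section ComplexIntegral.
Context {R : realType}.
Implicit Types f g : R -> R[i].

Lemma L1P f : L1 setT f <-> Itg (fun t => Re (f t)) /\ Itg (fun t => Im (f t)).
Proof.
split=> [[[f1 f2] fi]|[f1 f2]].
  have ni : Itg (fun t => normc (f t)).
    apply: itgP; first exact: (@measurable_normc _ _ _ f).
    apply: le_lt_trans fi; apply: ge0_le_integral => //.
    - apply/measurable_EFinP; apply: measurableT_comp => //.
      exact: (@measurable_normc _ _ _ f).
    - by apply/measurable_EFinP; exact: (@measurable_normc _ _ _ f).
    - by move=> x _; rewrite lee_fin ger0_norm ?normc_ge0.
  split.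
  - by apply: (itg_le f1 _ ni) => x; exact: normRe_le.
  - by apply: (itg_le f2 _ ni) => x; exact: normIm_le.
have mf : cmeas f by split; exact: itg_measurable.
split => //.
have : Itg (fun t => normc (f t)).
  apply: (itg_le _ _ (itgD (itg_norm f1) (itg_norm f2))).
  - exact: measurable_normc.
  - by move=> x /=; rewrite ger0_norm ?normc_ge0//; exact: normc_le_ReIm.
move/itg_lty; apply: le_lt_trans; apply: ge0_le_integral => //.
- by move=> x _; rewrite lee_fin normc_ge0.
- by apply/measurable_EFinP; exact: measurable_normc.
- apply/measurable_EFinP; apply: measurableT_comp => //.
  exact: measurable_normc.
- by move=> x _; rewrite lee_fin ler_norm.
Qed.

Lemma L1_cmeas f : L1 setT f -> cmeas f.
Proof. by case. Qed.

Lemma L1_itg f : L1 setT f -> Itg (fun t => normc (f t)).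
Proof.
move=> [mf fi]; apply: itgP; first exact: (@measurable_normc _ _ _ f).
under eq_integral => x _ do rewrite ger0_norm ?normc_ge0 //.
exact: fi.
Qed.

Lemma itg_L1 f g : cmeas f -> Itg (fun t => normc (f t)) -> L1 setT f.
Proof.
move=> mf /itg_lty fi; split => //.
by under eq_integral do rewrite -(ger0_norm (normc_ge0 _)).
Qed.

Lemma L1_le f (h : R -> R) : cmeas f -> (forall t, normc (f t) <= h t) ->
  Itg h -> L1 setT f.
Proof.
move=> mf fh hi; apply: itg_L1 => //; apply: itg_le hi.
- exact: measurable_normc.
- by move=> x; rewrite ger0_norm ?normc_ge0.
Qed.

Lemma L1D f g : L1 setT f -> L1 setT g -> L1 setT (fun t => f t + g t).
Proof.
move=> /L1P[f1 f2] /L1P[g1 g2]; apply/L1P; split.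
- by under eq_fun do rewrite cReD; exact: itgD.
- by under eq_fun do rewrite cImD; exact: itgD.
Qed.

Lemma L1M_bounded f g (M : R) : cmeas g -> (forall t, normc (g t) <= M) ->
  L1 setT f -> L1 setT (fun t => g t * f t).
Proof.
move=> mg gM fi; apply: (@L1_le _ (fun t => M * normc (f t))).
- by apply: cmeasM => //; exact: L1_cmeas.
- by move=> t; rewrite normcM ler_wpM2r// normc_ge0.
- by apply: itgZ; exact: L1_itg.
Qed.

Lemma L1Z (c : R[i]) f : L1 setT f -> L1 setT (fun t => c * f t).
Proof.
by move=> fi; apply: (@L1M_bounded f (fun=> c) (normc c)) => //; exact: cmeas_cst.
Qed.

Lemma L1N f : L1 setT f -> L1 setT (fun t => - f t).
Proof.
move=> /(L1Z (-1)).
by rewrite (_ : (fun t => -1 * f t) = (fun t => - f t))//; apply/funext => t; rewrite mulN1r.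
Qed.

Lemma L1B f g : L1 setT f -> L1 setT g -> L1 setT (fun t => f t - g t).
Proof. by move=> fi gi; apply: L1D => //; exact: L1N. Qed.

Lemma L1J f : L1 setT f -> L1 setT (fun t => conjc (f t)).
Proof.
move=> fi; apply: L1_le (L1_itg fi).
- by apply: cmeasJ; exact: L1_cmeas.
- by move=> t; rewrite normcJ.
Qed.

Lemma L1R (h : R -> R) : Itg h -> L1 setT (fun t => (h t)%:C%C).
Proof.
move=> hi; apply: L1_le (itg_norm hi).
- by apply: cmeasR; exact: itg_measurable.
- by move=> t; rewrite normcR.
Qed.

Lemma ReInt f : Re (cInt f) = Int (fun t => Re (f t)). Proof. by []. Qed.
Lemma ImInt f : Im (cInt f) = Int (fun t => Im (f t)). Proof. by []. Qed.

Lemma cIntD f g : L1 setT f -> L1 setT g ->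
  cInt (fun t => f t + g t) = cInt f + cInt g.
Proof.
move=> /L1P[f1 f2] /L1P[g1 g2]; apply: complexP; rewrite ?ReImDM !(ReInt, ImInt).
- by rewrite -intD//; under eq_fun do rewrite cReD.
- by rewrite -intD//; under eq_fun do rewrite cImD.
Qed.

Lemma cIntZ (c : R[i]) f : L1 setT f -> cInt (fun t => c * f t) = c * cInt f.
Proof.
move=> /L1P[f1 f2]; apply: complexP; rewrite ?ReImDM !(ReInt, ImInt).
- rewrite -!intZ// -intB; [|exact: itgZ|exact: itgZ].
  by under eq_fun do rewrite cReM.
- rewrite -!intZ// -intD; [|exact: itgZ|exact: itgZ].
  by under eq_fun do rewrite cImM.
Qed.

Lemma cIntN f : L1 setT f -> cInt (fun t => - f t) = - cInt f.
Proof.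
move=> fi; rewrite -mulN1r -cIntZ//; congr cintegral.
by apply/funext => t; rewrite mulN1r.
Qed.

Lemma cIntB f g : L1 setT f -> L1 setT g ->
  cInt (fun t => f t - g t) = cInt f - cInt g.
Proof. by move=> fi gi; rewrite cIntD ?cIntN//; exact: L1N. Qed.

Lemma cIntJ f : L1 setT f -> cInt (fun t => conjc (f t)) = conjc (cInt f).
Proof.
move=> /L1P[f1 f2]; apply: complexP; rewrite ?ReImDM !(ReInt, ImInt).
- by under eq_fun do rewrite cReJ.
- by rewrite -intN//; under eq_fun do rewrite cImJ.
Qed.

Lemma cIntR (h : R -> R) : cInt (fun t => (h t)%:C%C) = (Int h)%:C%C.
Proof.
apply: complexP; first by [].
by rewrite ImInt/= /Rintegral integral0.
Qed.

(** Multiplying by the conjugate of the integral I makes it real: |I|^2 is the integral of Re (conj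
    I f), at most |I| times the integral of |f|; then divide by |I|. *)
Lemma normc_cInt_le f : L1 setT f -> normc (cInt f) <= Int (fun t => normc (f t)).
Proof.
move=> fi; have ni := L1_itg fi.
have [->|z0] := eqVneq (cInt f) 0.
  by rewrite normc0; apply: Rintegral_ge0 => x _; exact: normc_ge0.
have p0 : 0 < normc (cInt f) by rewrite lt_neqAle normc_ge0 eq_sym normc_eq0 z0.
rewrite -(ler_pM2l p0) -expr2.
have -> : normc (cInt f) ^+ 2 = Re (conjc (cInt f) * cInt f).
  by rewrite mulrC mul_conjc.
rewrite -cIntZ// ReInt -intZ//.
apply: int_le.
- by have /L1P[] := L1Z (conjc (cInt f)) fi.
- exact: itgZ.
- move=> t; apply: le_trans (ler_norm _) _; apply: le_trans (normRe_le _) _.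
  by rewrite normcM normcJ.
Qed.

Lemma cInt_ae_eq f g : cmeas f -> cmeas g -> ae_eq mu setT f g ->
  cInt f = cInt g.
Proof.
move=> [f1 f2] [g1 g2] fg; apply: complexP; rewrite !(ReInt, ImInt).
- by apply: int_ae_eq => //; apply: aeS fg => t /= + _ => /(_ I) ->.
- by apply: int_ae_eq => //; apply: aeS fg => t /= + _ => /(_ I) ->.
Qed.

Section fubini.
Variable f : R * R -> R[i].
Hypothesis mf : cmeas f.
Hypothesis fi : (\int[@lebesgue_measure R]_x \int[@lebesgue_measure R]_y
  (normc (f (x, y)))%:E < +oo)%E.

Let part_lty (h : R * R -> R) : measurable_fun setT h ->
  (forall p, `|h p| <= normc (f p)) ->
  (\int[@lebesgue_measure R]_x \int[@lebesgue_measure R]_y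
  (`|h (x, y)|)%:E < +oo)%E.
Proof.
move=> mh hf; apply: le_lt_trans fi.
have m1 : measurable_fun setT (fun p : R * R => (`|h p|)%:E).
  by apply/measurable_EFinP; exact: measurableT_comp.
have m2 : measurable_fun setT (fun p : R * R => (normc (f p))%:E).
  by apply/measurable_EFinP; exact: measurable_normc.
apply: ge0_le_integral => //.
- by move=> x _; apply: integral_ge0.
- exact: (@measurable_fun_fubini_tonelli_F _ _ _ _ R (@lebesgue_measure R)
    (fun p : R * R => (`|h p|)%:E)).
- apply: (@measurable_fun_fubini_tonelli_F _ _ _ _ R (@lebesgue_measure R)
    (fun p : R * R => (normc (f p))%:E)) => //.
  by move=> p; rewrite lee_fin normc_ge0.
- move=> x _; apply: ge0_le_integral => //.
  + exact: (measurable_fun_pair2 x m1).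
  + exact: (measurable_fun_pair2 x m2).
  + by move=> y _; rewrite lee_fin.
Qed.

Lemma cInt_fubini :
  cInt (fun x => cInt (fun y => f (x, y))) =
  cInt (fun y => cInt (fun x => f (x, y))).
Proof.
case: mf => m1 m2; apply: complexP; rewrite !(ReInt, ImInt).
- by apply: (int_fubini m1 (part_lty m1 _)) => p; exact: normRe_le.
- by apply: (int_fubini m2 (part_lty m2 _)) => p; exact: normIm_le.
Qed.

End fubini.

End ComplexIntegral.

(** * Square-integrable functions and the Fourier integral *)

Section SquareIntegrable.
Context {R : realType}.
Implicit Types f g : R -> R[i].

Lemma L2P f : L2 setT f <-> cmeas f /\ Itg (fun t => normc (f t) ^+ 2).
Proof.
have e : forall x : R, `|normc (f x) ^+ 2| = normc (f x) ^+ 2.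
  by move=> x; rewrite ger0_norm ?sqr_ge0.
split=> [[mf fi]|[mf /itg_lty fi]]; split => //.
- apply: itgP; first exact: (@measurable_normc2 _ _ _ f).
  by under eq_integral do rewrite e; exact: fi.
- by rewrite /sqnorm2; under eq_integral do rewrite -e; exact: fi.
Qed.

Lemma L2_cmeas f : L2 setT f -> cmeas f. Proof. by case. Qed.

Lemma L2_itg f : L2 setT f -> Itg (fun t => normc (f t) ^+ 2).
Proof. by move/L2P => []. Qed.

Lemma L2_sqnorm2 f : L2 setT f -> sqnorm2 setT f = (N2 f)%:E.
Proof. by move/L2_itg => fi; rewrite EFin_int. Qed.

Lemma N2_ge0 f : 0 <= N2 f.
Proof. by apply: Rintegral_ge0 => x _; exact: sqr_ge0. Qed.

Lemma L2_le f (h : R -> R) : cmeas f -> (forall t, normc (f t) ^+ 2 <= h t) ->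
  Itg h -> L2 setT f.
Proof.
move=> mf fh hi; apply/L2P; split => //; apply: itg_le hi.
- exact: measurable_normc2.
- by move=> x; rewrite ger0_norm ?sqr_ge0.
Qed.

Lemma L2D f g : L2 setT f -> L2 setT g -> L2 setT (fun t => f t + g t).
Proof.
move=> fi gi; apply: (L2_le _ (fun t => sqr_normcD_le (f t) (g t))).
- by apply: cmeasD; exact: L2_cmeas.
- by apply: itgD; apply: itgZ; exact: L2_itg.
Qed.

Lemma L2M_bounded f g (M : R) : cmeas g -> (forall t, normc (g t) <= M) ->
  L2 setT f -> L2 setT (fun t => g t * f t).
Proof.
move=> mg gM fi; apply: (@L2_le _ (fun t => M ^+ 2 * normc (f t) ^+ 2)).
- by apply: cmeasM => //; exact: L2_cmeas.
- move=> t; rewrite normcM exprMn ler_wpM2r ?sqr_ge0//.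
  by rewrite ler_pXn2r ?nnegrE ?normc_ge0// (le_trans (normc_ge0 _) (gM t)).
- by apply: itgZ; exact: L2_itg.
Qed.

Lemma L2Z (c : R[i]) f : L2 setT f -> L2 setT (fun t => c * f t).
Proof.
by move=> fi; apply: (@L2M_bounded f (fun=> c) (normc c)) => //; exact: cmeas_cst.
Qed.

Lemma L2N f : L2 setT f -> L2 setT (fun t => - f t).
Proof.
move=> /(L2Z (-1)).
by rewrite (_ : (fun t => -1 * f t) = (fun t => - f t))//; apply/funext => t; rewrite mulN1r.
Qed.

Lemma L2B f g : L2 setT f -> L2 setT g -> L2 setT (fun t => f t - g t).
Proof. by move=> fi gi; apply: L2D => //; exact: L2N. Qed.

Lemma L2J f : L2 setT f -> L2 setT (fun t => conjc (f t)).
Proof.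
move=> fi; apply: L2_le (L2_itg fi).
- by apply: cmeasJ; exact: L2_cmeas.
- by move=> t; rewrite normcJ.
Qed.

Lemma L2M f g : L2 setT f -> L2 setT g -> L1 setT (fun t => f t * g t).
Proof.
move=> fi gi; apply: (L1_le _ (fun t => normcM_le (f t) (g t))).
- by apply: cmeasM; exact: L2_cmeas.
- under eq_fun do rewrite mulrC.
  by apply: itgZ; apply: itgD; exact: L2_itg.
Qed.

Lemma normc_cIntM_le f g : L2 setT f -> L2 setT g ->
  normc (cInt (fun t => f t * g t)) <= (N2 f + N2 g) / 2.
Proof.
move=> fi gi; apply: le_trans (normc_cInt_le (L2M fi gi)) _.
rewrite mulrC -intD; [|exact: L2_itg|exact: L2_itg].
rewrite -intZ; last by apply: itgD; exact: L2_itg.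
apply: int_le.
- by apply: L1_itg; exact: L2M.
- by apply: itgZ; apply: itgD; exact: L2_itg.
- by move=> t; rewrite [2^-1 * _]mulrC; exact: normcM_le.
Qed.

Lemma N2Z (c : R[i]) f : L2 setT f ->
  N2 (fun t => c * f t) = normc c ^+ 2 * N2 f.
Proof.
move=> fi; rewrite -intZ; last exact: L2_itg.
by congr Rintegral; apply/funext => t; rewrite normcM exprMn.
Qed.

Lemma N2D_le f g : L2 setT f -> L2 setT g ->
  N2 (fun t => f t + g t) <= 2 * N2 f + 2 * N2 g.
Proof.
move=> fi gi; have fi2 := L2_itg fi; have gi2 := L2_itg gi.
rewrite -!intZ// -intD; [|exact: itgZ|exact: itgZ].
apply: int_le => //.
- by apply: L2_itg; exact: L2D.
- by apply: itgD; exact: itgZ.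
- by move=> t; exact: sqr_normcD_le.
Qed.

Lemma N2_eq0 f : L2 setT f -> N2 f = 0 -> ae_eq mu setT f (fun=> 0).
Proof.
move=> fi f0; have mf := L2_cmeas fi.
have mf2 : measurable_fun setT (fun t => (normc (f t) ^+ 2)%:E).
  by apply/measurable_EFinP; exact: measurable_normc2.
have [+ _] := @ae_eq_integral_abs _ _ R mu setT measurableT _ mf2.
have -> : (\int[mu]_x `|(normc (f x) ^+ 2)%:E| = 0)%E.
  under eq_integral => x _ do rewrite gee0_abs ?lee_fin ?sqr_ge0//.
  by rewrite -EFin_int ?f0//; exact: L2_itg.
move=> /(_ erefl); apply: aeS => t /(_ I) /= [] /eqP e _.
by apply/eqP; rewrite -normc_eq0 -sqrf_eq0.
Qed.

Lemma L2_ae_eq f g : cmeas g -> ae_eq mu setT f g -> L2 setT f -> L2 setT g.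
Proof.
move=> mg fg fi; apply/L2P; split => //.
have := L2_itg fi; apply: itg_ae_eq.
- by apply: measurable_normc2; exact: L2_cmeas.
- exact: measurable_normc2.
- by apply: aeS fg => t /= + _ => /(_ I) ->.
Qed.

Lemma N2_ae_eq f g : cmeas f -> cmeas g -> ae_eq mu setT f g -> N2 f = N2 g.
Proof.
move=> mf mg fg; apply: int_ae_eq; [exact: measurable_normc2..|].
by apply: aeS fg => t /= + _ => /(_ I) ->.
Qed.

End SquareIntegrable.

(** * The Fourier integral on L1 *)

Section FourierL1.
Context {R : realType}.
Implicit Types f g : R -> R[i].
Notation F := (@fourier_integral R).

Definition fourier_factor : R[i] := ((Num.sqrt (2 * pi))^-1)%:C%C.

Lemma fourierE f t : F f t = fourier_factor * cInt (fun xi => f xi * cis (t * xi)).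
Proof.
rewrite /fourier_integral; congr (_ * cintegral _ _).
by apply/funext => xi; rewrite cexp_imaginary.
Qed.

Lemma measurable_scale (t : R) : measurable_fun setT (fun xi : R => t * xi).
Proof. exact: measurable_funM. Qed.

Lemma L1_cis f t : L1 setT f -> L1 setT (fun xi => f xi * cis (t * xi)).
Proof.
move=> fi; under eq_fun do rewrite mulrC.
apply: (@L1M_bounded _ _ _ 1) => //.
- by apply: cmeas_cis; exact: measurable_scale.
- by move=> xi; rewrite normc_cis.
Qed.

Let continuous_Int (f1 f2 : R -> R) : Itg f1 -> Itg f2 ->
  continuous (fun t : R => Int (fun xi => f1 xi * cos (t * xi) + f2 xi * sin (t * xi))).
Proof.
move=> i1 i2 t.
have mcos t' : measurable_fun setT (fun xi : R => cos (t' * xi)).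
  apply: (measurableT_comp _ (measurable_scale t')).
  by apply: continuous_measurable_fun; exact: continuous_cos.
have msin t' : measurable_fun setT (fun xi : R => sin (t' * xi)).
  apply: (measurableT_comp _ (measurable_scale t')).
  by apply: continuous_measurable_fun; exact: continuous_sin.
have b t' xi : `|f1 xi * cos (t' * xi) + f2 xi * sin (t' * xi)| <=
    `|f1 xi| + `|f2 xi|.
  rewrite (le_trans (ler_normD _ _))// !normrM lerD// ler_piMr//.
  - by rewrite ler_norml cos_geN1 cos_le1.
  - by rewrite ler_norml sin_geN1 sin_le1.
have ib := itgD (itg_norm i1) (itg_norm i2).
apply: (@continuity_under_integral R _ _ mu
  (fun t xi => f1 xi * cos (t * xi) + f2 xi * sin (t * xi)) setT measurableT
  (t - 1) (t + 1) _ _ (fun xi => `|f1 xi| + `|f2 xi|) ib).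
- move=> t' _; apply: (itg_le _ (b t') ib).
  by apply: measurable_funD; apply: measurable_funM => //; exact: itg_measurable.
- apply: aeW => xi _ t' _; apply: cvgD; apply: cvgM; try exact: cvg_cst.
  + by apply: continuous_comp; [exact: mulrr_continuous|exact: continuous_cos].
  + by apply: continuous_comp; [exact: mulrr_continuous|exact: continuous_sin].
- by move=> t' _; apply: aeW => xi _; exact: b.
- by rewrite inE/= in_itv/=; apply/andP; split; lra.
Qed.

(** Measurability comes from continuity in [t]: the real and imaginary parts are both of the form
    treated in [continuous_Int]. *)
Lemma fourier_cmeas f : L1 setT f -> cmeas (F f).
Proof.
move=> fi; rewrite (funext (fourierE f)); apply: cmeasM; first exact: cmeas_cst.
have /L1P[f1 f2] := fi; split.
- under eq_fun do rewrite ReInt.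
  rewrite (_ : (fun t => _) = fun t => Int (fun xi => Re (f xi) * cos (t * xi)
      + (-1 * Im (f xi)) * sin (t * xi))).
    by apply: continuous_measurable_fun; apply: continuous_Int => //; exact: (itgZ (-1) f2).
  by apply/funext => t; congr Rintegral; apply/funext => xi; rewrite cReM /=; ring.
- under eq_fun do rewrite ImInt.
  rewrite (_ : (fun t => _) = fun t => Int (fun xi => Im (f xi) * cos (t * xi)
      + Re (f xi) * sin (t * xi))).
    by apply: continuous_measurable_fun; exact: continuous_Int.
  by apply/funext => t; congr Rintegral; apply/funext => xi; rewrite cImM /=; ring.
Qed.

Lemma fourier_bounded f t : L1 setT f ->
  normc (F f t) <= normc fourier_factor * Int (fun xi => normc (f xi)).
Proof.
move=> fi; rewrite fourierE normcM ler_wpM2l ?normc_ge0//.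
apply: le_trans (normc_cInt_le (L1_cis _ fi)) _.
apply: int_le; [exact/L1_itg/L1_cis|exact: L1_itg|].
by move=> xi; rewrite normcM normc_cis mulr1.
Qed.

Lemma L1_fourierM f g : L1 setT f -> L1 setT g -> L1 setT (fun t => F f t * g t).
Proof.
move=> fi gi; apply: L1M_bounded gi; first exact: fourier_cmeas.
by move=> t; exact: fourier_bounded.
Qed.

(** The kernel [cis (x * y)] is symmetric and of modulus 1, so Fubini applies to
    [f y * g x * cis (x * y)] and exchanges the roles of [f] and [g]. *)
Lemma fourier_multiplication f g : L1 setT f -> L1 setT g ->
  cInt (fun t => F f t * g t) = cInt (fun t => f t * F g t).
Proof.
move=> fi gi.
pose H (p : R * R) := f p.2 * g p.1 * cis (p.1 * p.2).
have mH : cmeas H.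
  apply: cmeasM; first apply: cmeasM.
  - by apply: (cmeas_comp (h := snd)) => //; exact: L1_cmeas.
  - by apply: (cmeas_comp (h := fst)) => //; exact: L1_cmeas.
  - by apply: cmeas_cis; exact: measurable_funM.
have iH : (\int[@lebesgue_measure R]_x \int[@lebesgue_measure R]_y
    (normc (H (x, y)))%:E < +oo)%E.
  have e x : (\int[@lebesgue_measure R]_y (normc (H (x, y)))%:E =
      (Int (fun y => normc (f y)) * normc (g x))%:E)%E.
    under eq_integral do
      rewrite !normcM normc_cis mulr1 mulrC.
    rewrite -(@EFin_int _ (fun y => normc (g x) * normc (f y))).
    - by rewrite (intZ _ (L1_itg fi)) mulrC.
    - exact: (itgZ _ (L1_itg fi)).
  under eq_integral do rewrite e.
  by rewrite -(EFin_int (itgZ (Int (fun y => normc (f y))) (L1_itg gi))) ltry.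
have := cInt_fubini mH iH.
have -> : (fun x => cInt (fun y => H (x, y))) =
    (fun x => cInt (fun y => f y * cis (x * y)) * g x).
  apply/funext => x; rewrite mulrC -cIntZ; last exact: L1_cis.
  by congr cintegral; apply/funext => y; rewrite /H /=; ring.
have -> : (fun y => cInt (fun x => H (x, y))) =
    (fun y => f y * cInt (fun x => g x * cis (y * x))).
  apply/funext => y; rewrite -cIntZ; last exact: L1_cis.
  by congr cintegral; apply/funext => x; rewrite /H /= [y * x]mulrC; ring.
move=> e.
have e1 : (fun t => F f t * g t) = (fun t => fourier_factor *
    (cInt (fun y => f y * cis (t * y)) * g t)).
  by apply/funext => t; rewrite fourierE mulrA.
have e2 : (fun t => f t * F g t) = (fun t => fourier_factor *
    (f t * cInt (fun y => g y * cis (t * y)))).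
  by apply/funext => t; rewrite fourierE; ring.
have k0 : fourier_factor != 0.
  rewrite -normc_eq0 normcR normr_eq0 invr_eq0 sqrtr_eq0 -ltNge.
  by rewrite mulr_gt0// pi_gt0.
(* Dividing by the factor recovers the integrability of the products without it, which [cIntZ] asks
   for. *)
have kK h : (fun t => fourier_factor^-1 * (fourier_factor * h t)) = h :> (R -> R[i]).
  by apply/funext => t; rewrite mulrA mulVf// mul1r.
rewrite e1 e2 !cIntZ ?e//.
- have := L1_fourierM gi fi; under eq_fun do rewrite mulrC.
  by rewrite e2 => /(L1Z fourier_factor^-1); rewrite kK.
- by have := L1_fourierM fi gi; rewrite e1 => /(L1Z fourier_factor^-1); rewrite kK.
Qed.

End FourierL1.

(** * Changes of variable *)

Section Density.
Local Open Scope ereal_scope.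
Context {R : realType}.
Variable w : R -> R.
Hypothesis mw : measurable_fun setT w.
Hypothesis w0 : forall x, (0 <= w x)%R.

(** The proofs about [w] are arguments so that the measure structure declared below can be inferred
    from the term itself. *)
Definition density_measure of measurable_fun setT w & (forall x, (0 <= w x)%R) :=
  fun A : set (measurableTypeR R) => \int[@lebesgue_measure R]_(x in A) (w x)%:E.

Local Notation nu := (density_measure mw w0).

Let nu_set0 : nu set0 = 0.
Proof. by rewrite /density_measure integral_set0. Qed.

Let nu_ge0 A : 0 <= nu A.
Proof. by apply: integral_ge0 => x _; rewrite lee_fin. Qed.

Let nu_sigma_additive : semi_sigma_additive nu.
Proof.
move=> /= A mA tA mbigcupA; rewrite /density_measure/= ge0_integral_bigcup//=.
- by apply: is_cvg_ereal_nneg_natsum_cond => n _ _; exact: nu_ge0.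
- exact/measurable_EFinP/measurable_funTS.
- by move=> x _; rewrite lee_fin.
Qed.

HB.instance Definition _ := isMeasure.Build _ _ _ nu
  nu_set0 nu_ge0 nu_sigma_additive.

Import HBNNSimple.

(** Both sides agree on indicators, hence on the simple functions [f_ n] increasing to [f], hence on
    [f] by monotone convergence. *)
Lemma ge0_integral_density (f : R -> \bar R) : measurable_fun setT f ->
  (forall x, 0 <= f x) -> \int[nu]_x f x = \int[@lebesgue_measure R]_x (f x * (w x)%:E).
Proof.
move=> mf f0; pose f_ := nnsfun_approx measurableT mf.
have mf_ n : measurable_fun setT (f_ n) := measurable_funPT (f_ n).
have mi n k : measurable (f_ n @^-1` [set k]).
  by rewrite -(setTI (_ @^-1` _)); exact: mf_.
have nd_ x m n : (m <= n)%N -> (f_ m x <= f_ n x)%R.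
  by move=> mn; have /lefP := nd_nnsfun_approx measurableT mf mn; exact.
have mki n k : measurable_fun setT
    (fun x : R => (k * \1_(f_ n @^-1` [set k]) x)%:E).
  apply/measurable_EFinP; by apply: measurable_funM .
have cvf x : EFin \o f_ ^~ x @ \oo --> f x.
  by apply: cvg_nnsfun_approx => // *; exact: f0.
transitivity (limn (fun n => \int[nu]_x (f_ n x)%:E)).
  rewrite -monotone_convergence//.
  - by apply: eq_integral => y _; apply/esym/cvg_lim => //; exact: cvf.
  - by move=> n; apply/measurable_EFinP; exact: mf_.
  - by move=> n y _; rewrite lee_fin.
  - by move=> y _ m n mn; rewrite lee_fin; exact: nd_.
have -> : (fun n => \int[nu]_x (f_ n x)%:E) =
    (fun n => \int[@lebesgue_measure R]_x ((f_ n x)%:E * (w x)%:E)).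
  apply/funext => n.
  transitivity (\sum_(k \in range (f_ n)) \int[nu]_x (k * \1_(f_ n @^-1` [set k]) x)%:E).
    under eq_integral do rewrite fimfunE -fsumEFin//.
    rewrite ge0_integral_fsum//.
    - by move=> y; exact: mki.
    - by move=> y x _; rewrite nnfun_muleindic_ge0.
  transitivity (\sum_(k \in range (f_ n)) \int[@lebesgue_measure R]_x
      ((k * \1_(f_ n @^-1` [set k]) x)%:E * (w x)%:E)).
    apply: eq_fsbigr => k _.
    have [k0|k0] := ltP k 0%R.
      rewrite preimage_nnfun0//.
      under eq_integral do rewrite indic0 mulr0.
      under [RHS]eq_integral do rewrite indic0 mulr0 mul0e.
      by rewrite !integral0.
    transitivity (k%:E * \int[@lebesgue_measure R]_(x in f_ n @^-1` [set k]) (w x)%:E).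
      under eq_integral do rewrite EFinM.
      rewrite ge0_integralZl_EFin//; last first.
        by apply/measurable_EFinP; apply: measurable_indic; exact: mi.
      rewrite integral_indic; [by rewrite setIT|by []|exact: mi].
    rewrite integral_mkcond -ge0_integralZl_EFin//.
    - apply: eq_integral => x _; rewrite patchE indicE.
      by case: ifPn => h; rewrite ?h ?(negbTE h)/= ?mulr1 ?mulr0 ?mule0 ?mul0e.
    - by move=> x _; rewrite erestrict_ge0// => y _; rewrite lee_fin.
    - apply: (measurable_restrictT (EFin \o w) (mi n k)).1.
      by apply: measurable_funTS; apply/measurable_EFinP.
  rewrite -ge0_integral_fsum//.
  - apply: eq_integral => x _; rewrite -ge0_mule_fsuml.
      by rewrite fsumEFin// -fimfunE.
    by move=> k; rewrite nnfun_muleindic_ge0.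
  - move=> k; apply: emeasurable_funM; last exact/measurable_EFinP.
    exact: mki.
  - by move=> k x _; rewrite mule_ge0 ?lee_fin ?nnfun_muleindic_ge0//; exact: nnfun_muleindic_ge0.
rewrite -monotone_convergence//.
- apply: eq_integral => x _; apply/cvg_lim => //.
  by apply: cvgeZr => //; exact: cvf.
- move=> n; apply: emeasurable_funM; last exact/measurable_EFinP.
  by apply/measurable_EFinP; exact: mf_.
- by move=> n x _; rewrite mule_ge0// lee_fin.
- move=> x _ m n mn; rewrite lee_wpmul2r ?lee_fin//.
  exact: nd_.
Qed.

End Density.

(** * Affine substitution and passage to signed integrands *)

Section Substitution.
Context {R : realType}.

Section affine.
Variables (c t : R).
Hypothesis c0 : 0 < c.

Let phi (v : measurableTypeR R) : measurableTypeR R := c * (v : R) + t.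

Let mphi : measurable_fun setT phi.
Proof.
have h : measurable_fun (setT : set R) (fun v : R => c * v + t).
  by apply: measurable_funD => //; exact: measurable_funM.
exact: h.
Qed.

Let cnng : {nonneg R} := NngNum (ltW c0).

(** Lebesgue measure is determined by half-open intervals; the preimage of []a, b]] has length (b -
    a) / c, which the scaling by [c] compensates. *)
Let affine_measure (A : set R) : measurable A ->
  pushforward (mscale cnng lebesgue_measure) phi A =
    lebesgue_measure A.
Proof.
move=> mA; apply/esym/lebesgue_measure_unique => //= _ [[a b]] _ <-.
rewrite /mscale /pushforward/=.
have -> : phi @^-1` `]a, b]%classic = `](a - t) / c, (b - t) / c]%classic.
  apply/seteqP; split => x /=; rewrite !in_itv/= /phi => /andP[h1 h2]; apply/andP; split.
  - by rewrite ltr_pdivrMr// mulrC; lra.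
  - by rewrite ler_pdivlMr// mulrC; lra.
  - by move: h1; rewrite ltr_pdivrMr// mulrC; lra.
  - by move: h2; rewrite ler_pdivlMr// mulrC; lra.
rewrite !lebesgue_measure_itv/= !lte_fin ltr_pM2r ?invr_gt0//.
have -> : (a - t < b - t) = (a < b) by apply/idP/idP; lra.
case: ifPn => _; last by rewrite mule0.
rewrite -!EFinB -EFinM; congr EFin; field.
by rewrite gt_eqF.
Qed.

Lemma ge0_integral_affine (f : R -> R) : measurable_fun setT f ->
  (forall x, 0 <= f x) ->
  (\int[@lebesgue_measure R]_x (f x)%:E =
   \int[@lebesgue_measure R]_x (f (c * x + t)%R * c)%:E)%E.
Proof.
move=> mf f0.
have mEf : measurable_fun setT (EFin \o f) by exact/measurable_EFinP.
transitivity (\int[mscale cnng (@lebesgue_measure R)]_x (f (phi x))%:E)%E.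
  rewrite -[setT in RHS](preimage_setT phi).
  rewrite -(@ge0_integral_pushforward _ _ _ _ _ phi mphi
    (mscale cnng (@lebesgue_measure R)) setT (EFin \o f))//.
    by apply: eq_measure_integral => A mA _; apply/esym/affine_measure.
  by move=> x _; rewrite lee_fin.
have mfphi : measurable_fun setT (fun x => (f (phi x))%:E).
  by apply/measurable_EFinP; apply: (measurableT_comp mf).
rewrite ge0_integral_mscale//; last by move=> x _; rewrite lee_fin.
under [RHS]eq_integral do rewrite mulrC EFinM.
rewrite ge0_integralZl_EFin ?ltW//.
by move=> x _; rewrite lee_fin.
Qed.

End affine.

(** Positive and negative parts commute with multiplication by the nonnegative weight [w], so a
    substitution rule for nonnegative functions extends to signed ones. *)
Lemma integral_signed (D : set R) (phi w f : R -> R) : measurable D ->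
  (forall x, 0 <= w x) -> measurable_fun D f ->
  (forall g : R -> R, measurable_fun D g -> (forall x, 0 <= g x) ->
   (\int[@lebesgue_measure R]_(x in D) (g x)%:E =
    \int[@lebesgue_measure R]_x (g (phi x)%R * w x)%:E)%E) ->
  (\int[@lebesgue_measure R]_(x in D) (f x)%:E =
   \int[@lebesgue_measure R]_x (f (phi x)%R * w x)%:E)%E.
Proof.
move=> mD w0 mf H; rewrite integralE [RHS]integralE.
have e1 : ((fun x => (f x)%:E)^\+)%E = (fun x => (f^\+ x)%:E)%R.
  exact: (funerpos f).
have e2 : ((fun x => (f x)%:E)^\-)%E = (fun x => (f^\- x)%:E)%R.
  exact: (funerneg f).
rewrite e1 e2 !H; last 4 first.
- exact: measurable_funrneg.
- by move=> x; rewrite /funrneg le_max lexx orbT.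
- exact: measurable_funrpos.
- by move=> x; rewrite /funrpos le_max lexx orbT.
congr (_ - _)%E; apply: eq_integral => x _.
- rewrite funeposE /funrpos -EFin_max; congr EFin.
  by rewrite maxr_pMl// mul0r.
- rewrite funenegE /funrneg -EFinN -EFin_max; congr EFin.
  by rewrite maxr_pMl// mul0r mulNr.
Qed.

End Substitution.

(** * The substitution t = exp v from the line to the positive axis *)

Section ExpSubstitution.
Context {R : realType}.

Let phi (v : measurableTypeR R) : measurableTypeR R := expR (v : R).

Let mphi : measurable_fun setT phi.
Proof. exact: (@measurable_expR R). Qed.

Let nu := density_measure (@measurable_expR R) (@expR_ge0 R).

Let nupush : {measure set (measurableTypeR R) -> \bar R} :=
  measure_function_pushforward__canonical__measure_function_Measure nu mphi.

Let mNy : measurable (`]-oo, 0%R]%classic : set (measurableTypeR R)).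
Proof. exact: (@measurable_itv R). Qed.

Let integral_expR_oc (a b : R) : a < b ->
  (\int[@lebesgue_measure R]_(x in `]a, b]) (expR x)%:E = (expR b - expR a)%:E)%E.
Proof.
move=> ab; rewrite integral_itv_obnd_cbnd; last first.
  by apply/measurable_EFinP; apply: measurable_funTS; exact: measurable_expR.
rewrite (@continuous_FTC2 _ expR expR)//.
- by apply: continuous_subspaceT => x; exact: continuous_expR.
- split.
  + by move=> x _; exact: derivable_expR.
  + by apply: cvg_at_right_filter; exact: continuous_expR.
  + by apply: cvg_at_left_filter; exact: continuous_expR.
- by move=> x _; rewrite derive1E derive_val.
Qed.

(** Reflection turns the half-line into one reaching +oo, where the primitive - exp (- x) tends to
    0. *)
Let integral_expR_Ny (b : R) :
  (\int[@lebesgue_measure R]_(x in `]-oo, b]) (expR x)%:E = (expR b)%:E)%E.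
Proof.
have dF (x : R) : is_derive x (1 : R) (fun x : R => - expR (- x) : R) (expR (- x)).
  have := is_deriveN (is_derive1_comp (is_derive_expR (- x)) (is_deriveN (is_derive_id x 1))).
  by rewrite mulrN1 opprK.
rewrite -[b in LHS]opprK ge0_integration_by_substitutionNy.
- rewrite (@ge0_continuous_FTC2y _ _ (fun x => - expR (- x)) _ 0).
  + by rewrite -EFinB sub0r !opprK.
  + by move=> x _; exact: expR_ge0.
  + apply: continuous_subspaceT => x.
    by apply: continuous_comp; [exact: opp_continuous|exact: continuous_expR].
  + by rewrite -oppr0; apply: cvgN; exact: cvgr_expR.
  + by move=> x _; have [] := dF x.
  + apply: cvg_at_right_filter; apply: cvgN.
    by apply: continuous_comp; [exact: opp_continuous|exact: continuous_expR].
  + by move=> x _; rewrite derive1E; have [_ ->] := dF x.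
- by apply: continuous_subspaceT => x; exact: continuous_expR.
- by move=> x _; exact: expR_ge0.
Qed.

(** The image [nupush] of exp x dx charges only the positive axis, while the uniqueness of Lebesgue
    measure concerns the whole line; the missing half-line is added back. *)
Let kappa := measure_add nupush (mrestr lebesgue_measure mNy).

Let kappa_addE A : kappa A =
  (nu (phi @^-1` A) + lebesgue_measure (A `&` `]-oo, 0%R]%classic))%E.
Proof. exact: (measure_addE nupush (mrestr lebesgue_measure mNy)). Qed.

Let kappaE (A : set (measurableTypeR R)) : measurable A ->
  lebesgue_measure A = kappa A.
Proof.
apply: lebesgue_measure_unique => _ [[a b]] _ <-.
rewrite -[RHS]/(kappa _) kappa_addE /nu /density_measure.
have [ba|ab] := leP b a.
  have -> : `]a, b]%classic = set0 :> set R by rewrite set_itv_ge// bnd_simp -leNgt.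
  by rewrite preimage_set0 integral_set0 set0I !measure0 adde0.
have [b0|b0] := leP b 0.
  have -> : phi @^-1` `]a, b]%classic = set0.
    apply/seteqP; split => // x /=; rewrite in_itv/= => /andP[_].
    by rewrite leNgt (le_lt_trans b0 (expR_gt0 _)).
  rewrite integral_set0 add0e; congr lebesgue_measure.
  apply/seteqP; split => [x|x []//]; split => //.
  by move: H; rewrite /= !in_itv/= => /andP[_ /le_trans]; apply.
have [a0|a0] := ltP 0 a.
  have -> : phi @^-1` `]a, b]%classic = `]ln a, ln b]%classic.
    apply/seteqP; split => x /=; rewrite !in_itv/= => /andP[h1 h2]; apply/andP; split.
    - by rewrite -ltr_expR lnK.
    - by rewrite -ler_expR lnK.
    - by rewrite -ltr_expR lnK in h1.
    - by rewrite -ler_expR lnK in h2.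
  have -> : `]a, b]%classic `&` `]-oo, 0]%classic = set0 :> set R.
    apply/seteqP; split => // x /= []; rewrite !in_itv/= => /andP[ax _] x0.
    by have := lt_le_trans ax x0; rewrite ltNge (ltW a0).
  rewrite integral_expR_oc ?ltr_ln// !lnK// measure0 adde0.
  by rewrite lebesgue_measure_itv/= lte_fin ab EFinB.
(* Remaining case a <= 0 < b: the interval is cut at 0, its positive part pulls back to a half-line
   of mass b, and the rest has length - a. *)
have -> : phi @^-1` `]a, b]%classic = `]-oo, ln b]%classic.
  apply/seteqP; split => x /=; rewrite !in_itv/=.
  - by move=> /andP[_ xb]; rewrite -ler_expR lnK.
  - move=> xb; rewrite (le_lt_trans a0 (expR_gt0 _))/=.
    by rewrite -ler_expR lnK in xb.
have -> : `]a, b]%classic `&` `]-oo, 0]%classic = `]a, 0]%classic :> set R.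
  apply/seteqP; split => x /=; rewrite !in_itv/=.
  - by move=> [/andP[-> _] ->].
  - by move=> /andP[ax x0]; split => //; rewrite ax (le_trans x0 (ltW b0)).
rewrite integral_expR_Ny lnK// lebesgue_measure_itv/= lte_fin ab.
rewrite lebesgue_measure_itv/= lte_fin; case: ltP => a0'.
  by rewrite -!EFinB -EFinD; congr EFin; ring.
have -> : a = 0 by apply/eqP; rewrite eq_le a0 a0'.
by rewrite sube0 adde0.
Qed.

Lemma ge0_integral_expR (f : R -> R) : measurable_fun (positive_axis R) f ->
  (forall x, 0 <= f x) ->
  (\int[@lebesgue_measure R]_(x in positive_axis R) (f x)%:E =
   \int[@lebesgue_measure R]_x (f (expR x)%R * expR x)%:E)%E.
Proof.
move=> mf f0.
have mD : measurable (positive_axis R) by exact: measurable_itv.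
(* [f] is measurable on the positive axis only, so it is extended by 0 before the image measure is
   used. *)
pose g := f \_ (positive_axis R).
have mg : measurable_fun setT g by apply: (measurable_restrictT f mD).1.
have g0 x : 0 <= g x by rewrite /g patchE; case: ifP.
transitivity (\int[@lebesgue_measure R]_(x in positive_axis R) (g x)%:E)%E.
  by apply: eq_integral => x xD; rewrite /g patchE xD.
have gpos x : 0 < x -> g x = f x.
  by move=> x0; rewrite /g patchE mem_set// /positive_axis /= in_itv/= x0.
transitivity (\int[nupush]_(x in positive_axis R) (g x)%:E)%E.
  apply: eq_measure_integral => A mA AD.
  transitivity (kappa A); first exact: kappaE.
  rewrite kappa_addE.
  have -> : A `&` `]-oo, 0]%classic = set0 :> set R.
    apply/seteqP; split => // x [/AD]; rewrite /positive_axis /= !in_itv/= andbT.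
    by move=> x0; rewrite leNgt x0.
  by rewrite measure0 adde0.
have mEg : measurable_fun setT (EFin \o g) by exact/measurable_EFinP.
rewrite ge0_integral_pushforward//; last 2 first.
- exact: measurable_funTS.
- by move=> x _; rewrite lee_fin.
have -> : phi @^-1` (positive_axis R) = setT.
  by apply/seteqP; split => // x _; rewrite /positive_axis /= in_itv/= expR_gt0.
rewrite (@ge0_integral_density _ _ _ _ (fun x => (g (expR x))%:E)).
- by apply: eq_integral => x _; rewrite gpos ?expR_gt0// EFinM.
- apply/measurable_EFinP; apply: (measurableT_comp mg); exact: measurable_expR.
- by move=> x; rewrite lee_fin.
Qed.

Lemma integral_expR (f : R -> R) : measurable_fun (positive_axis R) f ->
  (\int[@lebesgue_measure R]_(x in positive_axis R) (f x)%:E =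
   \int[@lebesgue_measure R]_x (f (expR x)%R * expR x)%:E)%E.
Proof.
move=> mf; apply: (@integral_signed R _ expR expR) => //.
- exact: measurable_itv.
- by move=> g mg g0; exact: ge0_integral_expR.
Qed.

End ExpSubstitution.

(** * Substitution in real integrals, and integrals of derivatives *)

Section SubstitutionCorollaries.
Context {R : realType}.
Implicit Types f : R -> R.

Lemma measurable_affine (c t : R) : measurable_fun setT (fun x : R => c * x + t).
Proof. by apply: measurable_funD => //; exact: measurable_funM. Qed.

Lemma integral_affine (c t : R) f : 0 < c -> measurable_fun setT f ->
  (\int[@lebesgue_measure R]_x (f x)%:E =
   \int[@lebesgue_measure R]_x (f (c * x + t)%R * c)%:E)%E.
Proof.
move=> c0 mf.
apply: (@integral_signed R _ (fun x => c * x + t) (fun=> c)) => //.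
- by move=> x; exact: ltW.
- by move=> g mg g0; exact: ge0_integral_affine.
Qed.

Lemma Int_affine (c t : R) f : 0 < c -> measurable_fun setT f ->
  Int f = Int (fun x => f (c * x + t) * c).
Proof. by move=> c0 mf; congr fine; exact: integral_affine. Qed.

Lemma itg_affine (c t : R) f : 0 < c -> Itg f -> Itg (fun x => f (c * x + t)).
Proof.
move=> c0 fi; have mf := itg_measurable fi.
have mfc : measurable_fun setT (fun x => f (c * x + t)).
  exact: (measurableT_comp mf (measurable_affine c t)).
rewrite (_ : (fun x => _) = (fun x => c^-1 * (f (c * x + t) * c))); last first.
  by apply/funext => x; rewrite [RHS]mulrC mulfK// gt_eqF.
apply: itgZ; apply: itgP; first exact: measurable_funM.
have := itg_lty fi.
rewrite (@integral_affine c t (fun x => `|f x|))//; last exact: measurableT_comp.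
by under eq_integral do rewrite -{2}(gtr0_norm c0) -normrM.
Qed.

Lemma integral_reflect f : measurable_fun setT f ->
  (\int[@lebesgue_measure R]_x (f x)%:E =
   \int[@lebesgue_measure R]_x (f (- x)%R)%:E)%E.
Proof.
have mN : measurable_fun setT (-%R : measurableTypeR R -> measurableTypeR R).
  have h : measurable_fun (setT : set R) (-%R) by [].

  exact: h.
move=> mf; under [RHS]eq_integral do rewrite -[f _]mulr1.
apply: (@integral_signed R _ (fun x => - x) (fun=> 1)) => // g mg g0.
under [RHS]eq_integral do rewrite mulr1.
rewrite -[setT in RHS](preimage_setT (-%R : measurableTypeR R -> measurableTypeR R)).
rewrite -(@ge0_integral_pushforward _ _ _ _ _ _ mN (@lebesgue_measure R)
  setT (EFin \o g))//.
- by apply: eq_measure_integral => A mA _; apply/esym; exact: lebesgue_measureN.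
- exact/measurable_EFinP.
- by move=> x _; rewrite lee_fin.
Qed.

Lemma Int_reflect f : measurable_fun setT f -> Int f = Int (fun x => f (- x)).
Proof. by move=> mf; congr fine; exact: integral_reflect. Qed.

Lemma measurable_reflect f : measurable_fun setT f ->
  measurable_fun setT (fun x : R => f (- x)).
Proof. by move=> mf; apply: (measurableT_comp mf). Qed.

Lemma itg_reflect f : Itg f -> Itg (fun x => f (- x)).
Proof.
move=> fi; have mf := itg_measurable fi.
apply: itgP; first exact: measurable_reflect.
rewrite -(@integral_reflect (fun x => `|f x|)).
- exact: itg_lty.
- exact: measurableT_comp.
Qed.

Lemma Int_odd_eq0 f : measurable_fun setT f -> Itg f ->
  (forall x, f (- x) = - f x) -> Int f = 0.
Proof.
move=> mf fi fN; have := Int_reflect mf.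
rewrite (_ : (fun x => f (- x)) = (fun x => - f x)); last exact/funext.
by rewrite intN//; lra.
Qed.

Lemma is_deriveM_real (f g : R -> R) (x df dg : R) : is_derive x (1 : R) f df ->
  is_derive x (1 : R) g dg ->
  is_derive x (1 : R) (fun x => f x * g x) (f x * dg + g x * df).
Proof. by move=> hf hg; have := is_deriveM hf hg. Qed.

Lemma is_derive_expR_comp (g : R -> R) (x dg : R) : is_derive x (1 : R) g dg ->
  is_derive x (1 : R) (fun x => expR (g x)) (expR (g x) * dg).
Proof. by move=> hg; have := is_derive1_comp (is_derive_expR (g x)) hg. Qed.

Lemma is_derive_cos_comp (g : R -> R) (x dg : R) : is_derive x (1 : R) g dg ->
  is_derive x (1 : R) (fun x => cos (g x)) (- sin (g x) * dg).
Proof. by move=> hg; have := is_derive1_comp (is_derive_cos (g x)) hg. Qed.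

Lemma is_derive_sin_comp (g : R -> R) (x dg : R) : is_derive x (1 : R) g dg ->
  is_derive x (1 : R) (fun x => sin (g x)) (cos (g x) * dg).
Proof. by move=> hg; have := is_derive1_comp (is_derive_sin (g x)) hg. Qed.

Lemma is_derive_scale (c x : R) : is_derive x (1 : R) (fun x => c * x) c.
Proof.
have := is_deriveM_real (is_derive_cst c x 1) (is_derive_id x (1 : R)).
by rewrite mulr1 mulr0 addr0.
Qed.

Lemma is_derive_scale_sqr (c x : R) :
  is_derive x (1 : R) (fun x => c * x ^+ 2) (c * (2 * x)).
Proof.
have h := is_deriveM_real (is_derive_id x (1 : R)) (is_derive_id x (1 : R)).
have := is_deriveM_real (is_derive_cst c x 1) h.
by rewrite mulr0 addr0 (_ : x * 1 + x * 1 = 2 * x)//; ring.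
Qed.

Lemma is_derive_continuous (f f' : R -> R) :
  (forall x, is_derive x (1 : R) f (f' x)) -> continuous f.
Proof.
by move=> df x; apply: differentiable_continuous; apply/derivable1_diffP; have [] := df x.
Qed.

(** Integration by parts without boundary terms: the integral over [-(n+1), n+1] is a difference of
    two values of [F], which tends to 0 by the decay bound, and dominated convergence reaches the
    whole line. *)
Lemma Int_derivative_eq0 (F f : R -> R) (C : R) :
  (forall x, is_derive x (1 : R) F (f x)) -> continuous f -> Itg f ->
  (forall x, `|F x| <= C / (1 + `|x|)) -> Int f = 0.
Proof.
move=> dF cf fi FC; have mf := itg_measurable fi.
have cF := is_derive_continuous dF.
pose f_ n := f \_ `[- n.+1%:R, n.+1%:R].
have mI n : measurable (`[- n.+1%:R, n.+1%:R]%classic : set R) by exact: measurable_itv.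
have Intf_ n : Int (f_ n) = F n.+1%:R - F (- n.+1%:R).
  rewrite /f_ -Rintegral_mkcond /Rintegral (@continuous_FTC2 _ f F)//.
  - by have := ltr0Sn R n; lra.
  - exact: continuous_subspaceT.
  - split.
    + by move=> x _; have [] := dF x.
    + by apply: cvg_at_right_filter; exact: cF.
    + by apply: cvg_at_left_filter; exact: cF.
  - by move=> x _; rewrite derive1E; have [_ ->] := dF x.
have lim1 : (fun n => Int (f_ n)) @ \oo --> Int f.
  apply: (@int_dominated_cvg _ _ _ (fun x => `|f x|)).
  - by move=> n; apply: (measurable_restrictT f (mI n)).1; exact: measurable_funTS.
  - by [].
  - exact: itg_norm.
  - apply: aeW => x; apply: cvg_near_cst.
    near=> n; rewrite /f_ patchE mem_set//= in_itv/= -ler_norml.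
    rewrite ltW// (lt_le_trans (truncnS_gt _))// ler_nat.
    near: n; exact: nbhs_infty_ge.
  - by move=> n x; rewrite /f_ patchE; case: ifP => //; rewrite normr0.
have lim2 : (fun n => Int (f_ n)) @ \oo --> (0 : R).
  rewrite (funext Intf_); apply: norm_cvg0.
  have C0 : (fun n => 2 * C * harmonic n) @ \oo --> (0 : R).
    by rewrite -[0](mulr0 (2 * C)); apply: cvgM; [exact: cvg_cst|exact: cvg_harmonic].
  apply: (squeeze_cvgr _ (cvg_cst 0) C0); apply: nearW => n.
  rewrite normr_ge0/= (le_trans (ler_normB _ _))//.
  have h x : `|x| = n.+1%:R -> `|F x| <= C * harmonic n.
    move=> xn; apply: le_trans (FC x) _; rewrite xn /harmonic.
    have C0' : 0 <= C.
      by have := FC 0; rewrite normr0 addr0 divr1; exact: le_trans.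
    rewrite ler_wpM2l// lef_pV2 ?posrE//; lra.
  have h1 : `|F n.+1%:R| <= C * harmonic n by apply: h; rewrite ger0_norm.
  have h2 : `|F (- n.+1%:R)| <= C * harmonic n by apply: h; rewrite normrN ger0_norm.
  by rewrite -mulrA mulr_natl mulr2n lerD.
exact: cvg_unique lim1 lim2.
Unshelve. all: by end_near. Qed.

End SubstitutionCorollaries.

(** * Gaussians *)

Section Gaussian.
Context {R : realType}.
Notation F := (@fourier_integral R).

Definition gauss (a x : R) : R := expR (- (a / 2) * x ^+ 2).

Lemma gauss_ge0 a x : 0 <= gauss a x. Proof. exact: expR_ge0. Qed.

Lemma gauss_even a x : gauss a (- x) = gauss a x.
Proof. by rewrite /gauss sqrrN. Qed.

Lemma is_derive_gauss a x :
  is_derive x (1 : R) (gauss a) (gauss a x * (- a * x)).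
Proof.
have := is_derive_expR_comp (is_derive_scale_sqr (- (a / 2)) x).
by rewrite (_ : - (a / 2) * (2 * x) = - a * x)//; field.
Qed.

Lemma continuous_gauss a : continuous (gauss a).
Proof. exact: is_derive_continuous (is_derive_gauss a). Qed.

Lemma measurable_gauss a : measurable_fun setT (gauss a).
Proof. by apply: continuous_measurable_fun; exact: continuous_gauss. Qed.

Lemma gaussM a b x : gauss a x * gauss b x = gauss (a + b) x.
Proof. by rewrite /gauss -expRD; congr expR; field. Qed.

Lemma gauss_le1 a x : 0 <= a -> gauss a x <= 1.
Proof.
move=> a0; rewrite /gauss -expR0 ler_expR mulNr oppr_le0.
by rewrite mulr_ge0 ?sqr_ge0// divr_ge0.
Qed.

(** From exp y >= 1 + y with y = a x^2 / 2, since (1 + 2 / a) (1 + y) = 1 + x^2 + 2 / a + y. *)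
Lemma gauss_decay a x : 0 < a -> (1 + x ^+ 2) * gauss a x <= 1 + 2 / a.
Proof.
move=> a0.
have h : 1 + x ^+ 2 <= (1 + 2 / a) * expR (a / 2 * x ^+ 2).
  apply: le_trans (_ : (1 + 2 / a) * (1 + a / 2 * x ^+ 2) <= _); last first.
    by rewrite ler_wpM2l ?expR_ge1Dx// addr_ge0// divr_ge0// ltW.
  have -> : (1 + 2 / a) * (1 + a / 2 * x ^+ 2) =
      1 + x ^+ 2 + 2 / a + a / 2 * x ^+ 2 by field; rewrite gt_eqF.
  have : 0 <= 2 / a by rewrite divr_ge0// ltW.
  have : 0 <= a / 2 * x ^+ 2 by rewrite mulr_ge0 ?sqr_ge0// divr_ge0// ltW.
  by lra.
by rewrite /gauss mulNr expRN ler_pdivrMr ?expR_gt0.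
Qed.

Lemma norm_le_1Dsqr (x : R) : `|x| <= 1 + x ^+ 2.
Proof.
by rewrite ler_norml; apply/andP; split;
  have := sqr_ge0 (x - 1); have := sqr_ge0 (x + 1); nra.
Qed.

(** As 1 + |x| <= 2 (1 + x^2), the constant is twice that of [gauss_decay]; the shape of the bound
    is the one required by [Int_derivative_eq0]. *)
Lemma gauss_decay1 a x : 0 < a -> gauss a x <= (2 + 4 / a) / (1 + `|x|).
Proof.
move=> a0; rewrite ler_pdivlMr ?ltr_pwDl// mulrC.
have g0 := gauss_ge0 a x; have gd := gauss_decay x a0; have nx := norm_le_1Dsqr x.
apply: (@le_trans _ _ (2 * ((1 + x ^+ 2) * gauss a x))).
  rewrite mulrA ler_wpM2r//.
  by have := sqr_ge0 x; lra.
by rewrite (_ : 4 / a = 2 * (2 / a)); [lra|field; rewrite gt_eqF].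
Qed.

Lemma itg_gauss a : 0 < a -> Itg (gauss a).
Proof.
move=> a0; have s0 : 0 < Num.sqrt (a / 2) by rewrite sqrtr_gt0 divr_gt0.
have := itg_affine 0 s0 integrableT_gauss.
rewrite (_ : (fun x => _) = gauss a)//; apply/funext => x.
by rewrite /gauss_fun addr0 exprMn sqr_sqrtr ?ltW ?divr_gt0// /gauss mulNr.
Qed.

Lemma Int_gauss a : 0 < a -> Int (gauss a) = Num.sqrt (2 * pi) / Num.sqrt a.
Proof.
move=> a0; have s0 : 0 < Num.sqrt (a / 2) by rewrite sqrtr_gt0 divr_gt0.
have := Int_affine 0 s0 (@measurable_gauss_fun R).
rewrite {1}/Rintegral integralT_gauss/=.
rewrite (_ : (fun x => _) = (fun x => Num.sqrt (a / 2) * gauss a x)); last first.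
  apply/funext => x.
  by rewrite /gauss_fun addr0 exprMn sqr_sqrtr ?ltW ?divr_gt0// /gauss mulNr mulrC.
rewrite intZ; last exact: itg_gauss.
move=> e; have e2 : Num.sqrt a = Num.sqrt 2 * Num.sqrt (a / 2).
  by rewrite -sqrtrM//; congr Num.sqrt; field.
rewrite e2 sqrtrM// e; field.
by rewrite !gt_eqF// sqrtr_gt0.
Qed.

(** The Gaussian is split into two factors of parameter a / 2, one of which absorbs [x]. *)
Lemma itg_xgauss a : 0 < a -> Itg (fun x => x * gauss a x).
Proof.
move=> a0; have a20 : 0 < a / 2 by rewrite divr_gt0.
apply: (itg_le _ _ (itgZ (1 + 2 / (a / 2)) (itg_gauss a20))).
- by apply: measurable_funM => //; exact: measurable_gauss.
- move=> x; rewrite [a in leLHS]splitr -gaussM mulrA normrM.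
  rewrite [X in _ * X]ger0_norm ?gauss_ge0// ler_wpM2r ?gauss_ge0//.
  apply: le_trans (gauss_decay x a20).
  by rewrite normrM [X in _ * X]ger0_norm ?gauss_ge0// ler_wpM2r ?gauss_ge0// norm_le_1Dsqr.
Qed.

Let measurable_cosM t : measurable_fun setT (fun x : R => cos (t * x)).
Proof.
apply: (measurableT_comp _ (measurable_scale t)).
by apply: continuous_measurable_fun; exact: continuous_cos.
Qed.

Let measurable_sinM t : measurable_fun setT (fun x : R => sin (t * x)).
Proof.
apply: (measurableT_comp _ (measurable_scale t)).
by apply: continuous_measurable_fun; exact: continuous_sin.
Qed.

Let norm_cos_le1 (x : R) : `|cos x| <= 1.
Proof. by rewrite ler_norml cos_geN1 cos_le1. Qed.

Let norm_sin_le1 (x : R) : `|sin x| <= 1.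
Proof. by rewrite ler_norml sin_geN1 sin_le1. Qed.

Lemma itgM_cos (f : R -> R) t : Itg f -> Itg (fun x => f x * cos (t * x)).
Proof.
move=> fi; under eq_fun do rewrite mulrC.
exact: (itg_bounded (measurable_cosM t) (fun x => norm_cos_le1 (t * x)) fi).
Qed.

Lemma itgM_sin (f : R -> R) t : Itg f -> Itg (fun x => f x * sin (t * x)).
Proof.
move=> fi; under eq_fun do rewrite mulrC.
exact: (itg_bounded (measurable_sinM t) (fun x => norm_sin_le1 (t * x)) fi).
Qed.

Let G a t := Int (fun x => gauss a x * cos (t * x)).
Let H a t := Int (fun x => x * gauss a x * sin (t * x)).

(** Integration by parts: the derivative of [gauss a x * sin (t * x)] has integral 0. *)
Let HG (a t : R) : 0 < a -> a * H a t = t * G a t.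
Proof.
move=> a0.
have ig := itg_gauss a0; have ix := itg_xgauss a0.
have d x : is_derive x (1 : R) (fun x => gauss a x * sin (t * x))
   (t * (gauss a x * cos (t * x)) - a * (x * gauss a x * sin (t * x))).
  have := is_deriveM_real (is_derive_gauss a x) (is_derive_sin_comp (is_derive_scale t x)).
  by congr is_derive; ring.
have := Int_derivative_eq0 d _ _ (C := 2 + 4 / a).
rewrite intB ?intZ//; [|exact: itgM_sin|exact: itgM_cos
  |by apply: itgZ; exact: itgM_cos|by apply: itgZ; exact: itgM_sin].
rewrite -/(G a t) -/(H a t) => e; apply/esym/eqP; rewrite -subr_eq0; apply/eqP.
apply: e.
- have cg : continuous (gauss a) := @continuous_gauss a.
  have cc := is_derive_continuous (fun x => is_derive_cos_comp (is_derive_scale t x)).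
  have cs := is_derive_continuous (fun x => is_derive_sin_comp (is_derive_scale t x)).
  move=> x; apply: cvgB; apply: cvgM; try exact: cvg_cst.
  + by apply: cvgM; [exact: cg|exact: cc].
  + by apply: cvgM; [apply: cvgM; [exact: cvg_id|exact: cg]|exact: cs].
- by apply: itgB; apply: itgZ; [exact: itgM_cos|exact: itgM_sin].
- move=> x; apply: le_trans (gauss_decay1 x a0).
  by rewrite normrM ger0_norm ?gauss_ge0// ler_piMr// gauss_ge0.
Qed.

(** Differentiation under the integral sign, dominated by |x gauss a x| uniformly in the
    frequency. *)
Let dG (a t : R) : 0 < a -> is_derive t (1 : R) (G a) (- H a t).
Proof.
move=> a0; have ig := itg_gauss a0; have ix := itg_xgauss a0.
pose f (t x : R) : R := gauss a x * cos (t * x).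
have d1 (x s : R) : is_derive s (1 : R) (f ^~ x) (- (x * gauss a x * sin (s * x))).
  have h : is_derive s (1 : R) (fun s => s * x) x.
    by under eq_fun do rewrite mulrC; exact: is_derive_scale.
  have := is_deriveM_real (is_derive_cst (gauss a x) s (1 : R)) (is_derive_cos_comp h).
  by congr is_derive; rewrite /= ?mulr0 ?addr0; ring.
have I : `]t - 1, t + 1[%classic t by rewrite /= in_itv/=; apply/andP; split; lra.
have D1 (s : R) : `]t - 1, t + 1[%classic s -> Itg (f s).
  by move=> _; exact: itgM_cos.
have D2 (s x : R) : `]t - 1, t + 1[%classic s -> setT x -> derivable (f ^~ x) s 1.
  by move=> _ _; have [] := d1 x s.
have D3 (x : R) : 0 <= `|x * gauss a x| by [].
have D4 : Itg (fun x => `|x * gauss a x|) by exact: itg_norm.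
have pE s x : partial1of2 f s x = - (x * gauss a x * sin (s * x)).
  by rewrite /partial1of2 derive1E; have [_ ->] := d1 x s.
have D5 (s x : R) : `]t - 1, t + 1[%classic s -> setT x ->
    `|partial1of2 f s x| <= `|x * gauss a x|.
  by move=> _ _; rewrite pE normrN normrM ler_piMr.
have [] := (@derivable_under_integral R _ _ mu f setT measurableT t (t - 1) (t + 1)
  I D1 D2 _ D3 D4 D5,
  @differentiation_under_integral R _ _ mu f setT measurableT t (t - 1) (t + 1)
  I D1 D2 _ D3 D4 D5) => e1 e2.
split; first exact: e1.
rewrite -derive1E e2 /H -intN; last exact: itgM_sin.
by congr Rintegral; apply/funext => x; rewrite pE.
Qed.

(** By [dG] and [HG], G' = - H = - (t / a) G, so exp (t^2 / (2 a)) G, written with [gauss (- a^-1)],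
    is constant and equals the Gaussian integral G 0. *)
Lemma Int_gauss_cos a t : 0 < a ->
  Int (fun x => gauss a x * cos (t * x)) =
  Num.sqrt (2 * pi) / Num.sqrt a * gauss a^-1 t.
Proof.
move=> a0; rewrite -/(G a t).
have d s : is_derive s (1 : R) (fun s => gauss (- a^-1) s * G a s) 0.
  have := is_deriveM_real (is_derive_gauss (- a^-1) s) (dG s a0).
  have -> : H a s = a^-1 * (s * G a s).
    by rewrite -HG// mulrA mulVf ?mul1r// gt_eqF.
  by congr is_derive; rewrite opprK; ring.
have := is_derive_0_is_cst t 0 d.
rewrite {2}/gauss expr0n/= mulr0 expR0 mul1r.
have -> : G a 0 = Num.sqrt (2 * pi) / Num.sqrt a.
  rewrite -Int_gauss//; congr Rintegral; apply/funext => x.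
  by rewrite mul0r cos0 mulr1.
move=> <-; rewrite mulrAC gaussM addNr /gauss mul0r oppr0 mul0r expR0 mul1r//.
Qed.

Lemma Int_xgauss_sin a t : 0 < a ->
  Int (fun x => x * gauss a x * sin (t * x)) =
  t / a * (Num.sqrt (2 * pi) / Num.sqrt a * gauss a^-1 t).
Proof.
move=> a0; rewrite -Int_gauss_cos// -/(G a t) -/(H a t).
have := HG t a0 => e; rewrite [t / a]mulrC -mulrA -e mulrA mulVf ?mul1r//.
by rewrite gt_eqF.
Qed.

End Gaussian.

(** * Fourier transforms of Gaussians; reflection, conjugation and damping *)

Section FourierGaussian.
Context {R : realType}.
Notation F := (@fourier_integral R).
Implicit Types f g : R -> R[i].

Lemma sqrt2pi_gt0 : 0 < Num.sqrt (2 * pi) :> R.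
Proof. by rewrite sqrtr_gt0 mulr_gt0// pi_gt0. Qed.

Lemma L1_gauss_cis (a s : R) : 0 < a ->
  L1 setT (fun x => (gauss a x)%:C%C * cis (s * x)).
Proof. by move=> a0; apply: L1_cis; apply: L1R; exact: itg_gauss. Qed.

Lemma L2_gauss_cis (a s : R) : 0 < a ->
  L2 setT (fun x => (gauss a x)%:C%C * cis (s * x)).
Proof.
move=> a0; have mg := L1_cmeas (L1_gauss_cis s a0).
apply: (@L2_le _ _ (gauss (a + a)) mg).
  move=> x; rewrite normcM normc_cis mulr1 normcR expr2 ger0_norm ?gauss_ge0//.
  by rewrite gaussM.
by apply: itg_gauss; rewrite addr_gt0.
Qed.

(** The two phases merge into the frequency s + t, and the sine part vanishes because its integrand
    is odd. *)
Lemma fourier_gauss (a s t : R) : 0 < a ->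
  F (fun x => (gauss a x)%:C%C * cis (s * x)) t =
  ((Num.sqrt a)^-1 * gauss a^-1 (s + t))%:C%C.
Proof.
move=> a0; rewrite fourierE /fourier_factor.
have -> : cInt (fun xi => (gauss a xi)%:C%C * cis (s * xi) * cis (t * xi)) =
   (Num.sqrt (2 * pi) / Num.sqrt a * gauss a^-1 (s + t))%:C%C.
  apply: complexP; rewrite !(ReInt, ImInt, cReC, cImC).
  - rewrite -Int_gauss_cos//; congr Rintegral; apply/funext => x.
    by rewrite -mulrA -cisD -mulrDl !ReImE /= mul0r subr0.
  - rewrite (_ : (fun x => _) = (fun x => gauss a x * sin ((s + t) * x))); last first.
      apply/funext => x.
      by rewrite -mulrA -cisD -mulrDl !ReImE /= mul0r addr0.
    have i := itgM_sin (s + t) (itg_gauss a0).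
    apply: Int_odd_eq0 => //; first exact: itg_measurable.
    by move=> x; rewrite gauss_even mulrN sinN mulrN.
rewrite real_complexM; congr (_ %:C)%C; field.
by rewrite !gt_eqF ?sqrt2pi_gt0 ?sqrtr_gt0.
Qed.

Lemma fourier_xgauss (a t : R) : 0 < a ->
  F (fun x => (x * gauss a x)%:C%C) t =
  'i%C * ((t / a) / Num.sqrt a * gauss a^-1 t)%:C%C.
Proof.
move=> a0; rewrite fourierE /fourier_factor.
have -> : cInt (fun xi => (xi * gauss a xi)%:C%C * cis (t * xi)) =
   'i%C * (t / a * (Num.sqrt (2 * pi) / Num.sqrt a * gauss a^-1 t))%:C%C.
  apply: complexP; rewrite ?ReImDM !(ReInt, ImInt, cReC, cImC).
  - rewrite /= mul0r mulr0 subr0.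
    rewrite (_ : (fun x => _) = (fun x => x * gauss a x * cos (t * x))); last first.
      by apply/funext => x; rewrite ?ReImE /= mul0r subr0.
    have i := itgM_cos t (itg_xgauss a0).
    apply: Int_odd_eq0 => //; first exact: itg_measurable.
    by move=> x; rewrite gauss_even mulrN cosN !mulNr.
  - rewrite /= mulr0 add0r mul1r -Int_xgauss_sin//; congr Rintegral; apply/funext => x.
    by rewrite ?ReImE /= mul0r addr0.
rewrite mulrCA real_complexM; congr (_ * _ %:C)%C; field.
by rewrite !gt_eqF ?sqrt2pi_gt0 ?sqrtr_gt0.
Qed.

Lemma cInt_reflect f : cmeas f -> cInt f = cInt (fun t => f (- t)).
Proof.
by move=> [m1 m2]; apply: complexP; rewrite !(ReInt, ImInt) Int_reflect.
Qed.

Lemma cmeas_reflect f : cmeas f -> cmeas (fun t : R => f (- t)).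
Proof. by move=> mf; apply: cmeas_comp. Qed.

Lemma L1_reflect f : L1 setT f -> L1 setT (fun t => f (- t)).
Proof.
by move=> /L1P[f1 f2]; apply/L1P; split; [exact: (itg_reflect f1)|exact: (itg_reflect f2)].
Qed.

Lemma L2_reflect f : L2 setT f -> L2 setT (fun t => f (- t)).
Proof.
move=> /L2P[mf fi]; apply/L2P; split; first exact: cmeas_reflect.
exact: (itg_reflect fi).
Qed.

Lemma N2_reflect f : L2 setT f -> N2 (fun t => f (- t)) = N2 f.
Proof.
by move=> /L2P[mf fi]; rewrite [RHS]Int_reflect//; exact: measurable_normc2.
Qed.

Lemma fourier_reflect f t : L1 setT f -> F (fun x => f (- x)) t = F f (- t).
Proof.
move=> fi; rewrite !fourierE; congr (_ * _).
rewrite [RHS]cInt_reflect; last by apply: L1_cmeas; exact: L1_cis.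
by congr cintegral; apply/funext => x; rewrite mulrNN.
Qed.

Lemma fourierJ f t : L1 setT f -> F (fun x => conjc (f x)) t = conjc (F f (- t)).
Proof.
move=> fi; rewrite !fourierE conjcM -cIntJ; last exact: L1_cis.
congr (_ * _); first by rewrite /fourier_factor conjc_real.
congr cintegral; apply/funext => x.
by rewrite conjcM mulNr cisN conjcK.
Qed.

(** As n grows the damping factors increase to [gauss 0 = 1], so monotone convergence carries the
    uniform bound to [h]. *)
Lemma itg_damped (h : R -> R) (C : R) : measurable_fun setT h ->
  (forall x, 0 <= h x) ->
  (forall n : nat, Itg (fun x => h x * gauss n.+1%:R^-1 x)) ->
  (forall n : nat, Int (fun x => h x * gauss n.+1%:R^-1 x) <= C) ->
  Itg h /\ Int h <= C.
Proof.
move=> mh h0 hi hC.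
pose g n x := (h x * gauss n.+1%:R^-1 x)%:E.
have mg n : measurable_fun setT (g n).
  by apply/measurable_EFinP; exact: itg_measurable.
have g0 n x : setT x -> (0 <= g n x)%E.
  by move=> _; rewrite lee_fin mulr_ge0// gauss_ge0.
have nd x : setT x -> {homo g ^~ x : n m / (n <= m)%N >-> (n <= m)%E}.
  move=> _ n m nm; rewrite lee_fin ler_wpM2l// /gauss ler_expR.
  by rewrite !mulNr lerN2 ler_wpM2r ?sqr_ge0// ler_wpM2r// lef_pV2 ?posrE// ler_nat.
have lg x : g ^~ x @ \oo --> (h x)%:E.
  apply: cvg_EFin; first exact: nearW.
  have g1 : gauss 0 x = 1 by rewrite /gauss mul0r oppr0 mul0r expR0.
  rewrite -[h x in X in _ --> X]mulr1 -g1; apply: cvgM; first exact: cvg_cst.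
  apply: continuous_cvg; first exact: continuous_expR.
  apply: cvgM; last exact: cvg_cst.
  apply: cvgN; apply: cvgM; last exact: cvg_cst.
  exact: cvg_harmonic.
have cv := @cvg_monotone_convergence _ _ _ mu setT measurableT _ mg g0 nd.
have le : (\int[@lebesgue_measure R]_x (h x)%:E <= C%:E)%E.
  have -> : (\int[@lebesgue_measure R]_x (h x)%:E =
      limn (fun n => \int[@lebesgue_measure R]_x g n x))%E.
    rewrite (cvg_lim _ cv)//; apply: eq_integral => x _.
    by apply/esym/cvg_lim => //; exact: lg.
  apply: lime_le; first by apply/cvg_ex; eexists; exact: cv.
  by apply: nearW => n; rewrite -EFin_int// lee_fin.
have hI : Itg h.
  apply: itgP => //; apply: le_lt_trans (ltry C).
  by under eq_integral do rewrite ger0_norm//.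
by split => //; rewrite -lee_fin EFin_int.
Qed.

End FourierGaussian.

(** * Plancherel and inversion *)

Section FourierContraction.
Context {R : realType}.
Notation F := (@fourier_integral R).
Implicit Types f g : R -> R[i].

Section damped.
Variables (f : R -> R[i]) (e : R).
Hypotheses (e0 : 0 < e) (f1 : L1 setT f) (f2 : L2 setT f).

(* The heat kernel, normalised so that its integral is 1. *)
Let K (u : R) : R := (Num.sqrt (2 * pi))^-1 * ((Num.sqrt e)^-1 * gauss e^-1 u).

Let ei0 : 0 < e^-1. Proof. by rewrite invr_gt0. Qed.

Let K_ge0 u : 0 <= K u.
Proof. by rewrite !mulr_ge0 ?gauss_ge0 ?invr_ge0 ?sqrtr_ge0. Qed.

Let measurable_K : measurable_fun setT K.
Proof. by do 2 apply: measurable_funM => //; exact: measurable_gauss. Qed.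

Let itgK : Itg K.
Proof. by do 2 apply: itgZ; exact: itg_gauss. Qed.

Let itgKt t : Itg (fun s => K (t + s)).
Proof.
have := itg_affine t ltr01 itgK.
by under eq_fun do rewrite mul1r addrC.
Qed.

Let IntK t : Int (fun s => K (t + s)) = 1.
Proof.
have := Int_affine t ltr01 measurable_K.
under [in X in _ = X -> _]eq_fun do rewrite mul1r mulr1 addrC.
move=> <-; rewrite intZ; last by apply: itgZ; exact: itg_gauss.
rewrite intZ; last exact: itg_gauss.
rewrite Int_gauss// sqrtrV ?ltW//; field.
by rewrite !gt_eqF ?sqrt2pi_gt0 ?sqrtr_gt0.
Qed.

(** Its transform is the conjugate of [F f], so that [F f * F fr] is |F f|^2. *)
Let fr t := conjc (f (- t)).

Let fr1 : L1 setT fr. Proof. exact: (L1_reflect (L1J f1)). Qed.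

Let fr2 : L2 setT fr. Proof. exact: (L2_reflect (L2J f2)). Qed.

Let Ffr t : F fr t = conjc (F f t).
Proof.
by rewrite /fr (@fourier_reflect _ (fun t => conjc (f t)))// ?fourierJ ?opprK//; exact: L1J.
Qed.

Let N2fr : N2 fr = N2 f.
Proof.
rewrite /fr -(@N2_reflect _ f)//; congr Rintegral.
by apply/funext => t; rewrite normcJ.
Qed.

Let g t := (gauss e t)%:C%C * F fr t.

Let g1 : L1 setT g.
Proof.
rewrite /g; under eq_fun do rewrite mulrC.
by apply: L1_fourierM => //; apply: L1R; exact: itg_gauss.
Qed.

(** The multiplication formula moves F from [fr] onto a Gaussian times a character, whose explicit
    transform is the translated kernel. *)
Let Fg t : F g t = cInt (fun s => (K (t + s))%:C%C * fr s).
Proof.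
rewrite fourierE.
have -> : (fun xi => g xi * cis (t * xi)) =
    (fun xi => F fr xi * ((gauss e xi)%:C%C * cis (t * xi))).
  by apply/funext => xi; rewrite /g; ring.
have i := L1_gauss_cis t e0.
rewrite fourier_multiplication// -cIntZ; last first.
  by under eq_fun do rewrite mulrC; exact: L1_fourierM.
congr cintegral; apply/funext => s; rewrite fourier_gauss//.
by rewrite /K -real_complexM /fourier_factor; ring.
Qed.

(** One of the two terms of the AM-GM bound for [K (t + s) * |f t| * |fr s|]; as the kernel has
    integral 1 in each variable, the double integral of [h] is [N2 f]. *)
Let h (p : R * R) := K (p.2 + p.1) * normc (fr p.1) ^+ 2.

Let h_ge0 p : 0 <= h p.
Proof. by apply: mulr_ge0; [exact: K_ge0|exact: sqr_ge0]. Qed.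

Let mh : measurable_fun setT h.
Proof.
apply: measurable_funM.
- apply: (measurableT_comp measurable_K).
  exact: measurable_funD.
- apply: (@measurableT_comp _ _ _ _ _ _ (fun s => normc (fr s) ^+ 2)) => //.
  by apply: measurable_normc2; exact: L2_cmeas.
Qed.

Let hs s : (\int[@lebesgue_measure R]_t (`|h (s, t)|)%:E)%E = (normc (fr s) ^+ 2)%:E.
Proof.
have i : Itg (fun t => normc (fr s) ^+ 2 * K (s + t)) by apply: itgZ.
transitivity (\int[@lebesgue_measure R]_t (normc (fr s) ^+ 2 * K (s + t))%:E)%E.
  apply: eq_integral => t _; rewrite ger0_norm ?h_ge0//.
  by rewrite /h/= mulrC addrC.
by have := EFin_int i; rewrite intZ// IntK mulr1 => ->.
Qed.

Let hlty : (\int[@lebesgue_measure R]_s \int[@lebesgue_measure R]_t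
  (`|h (s, t)|)%:E < +oo)%E.
Proof.
under eq_integral do rewrite hs.
by rewrite -(EFin_int (L2_itg fr2)) ltry.
Qed.

Let Phi t := Int (fun s => h (s, t)).

Let itgPhi : Itg Phi. Proof. exact: itg_int2 mh hlty. Qed.

Let IntPhi : Int Phi = N2 f.
Proof.
rewrite /Phi -(int_fubini mh hlty) -N2fr; congr Rintegral; apply/funext => s.
have i : Itg (fun t => normc (fr s) ^+ 2 * K (s + t)) by apply: itgZ.
rewrite -[RHS]mulr1 -(IntK s) -intZ//; congr Rintegral; apply/funext => t.
by rewrite /h/= mulrC addrC.
Qed.

Lemma fourier_damped_itg : Itg (fun t => normc (F f t) ^+ 2 * gauss e t).
Proof.
under eq_fun do rewrite mulrC.
apply: (@itg_le _ _ (fun t =>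
  (normc fourier_factor * Int (fun xi => normc (f xi))) ^+ 2 * gauss e t)).
- apply: measurable_funM; first exact: measurable_gauss.
  by apply: measurable_normc2; exact: fourier_cmeas.
- move=> t; rewrite ger0_norm; last first.
    by apply: mulr_ge0; [exact: gauss_ge0|exact: sqr_ge0].
  rewrite mulrC ler_wpM2r ?gauss_ge0// ler_pXn2r ?nnegrE ?normc_ge0//.
  + exact: fourier_bounded.
  + by rewrite mulr_ge0 ?normc_ge0// Rintegral_ge0// => x _; exact: normc_ge0.
- by apply: itgZ; exact: itg_gauss.
Qed.

Lemma fourier_damped_le : Int (fun t => normc (F f t) ^+ 2 * gauss e t) <= N2 f.
Proof.
(* The damped integral is the pairing of [F f] with [g], which the multiplication formula turns into
   that of [f] with [F g]. *)
have step1 : (Int (fun t => normc (F f t) ^+ 2 * gauss e t))%:C%C =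
    cInt (fun t => f t * F g t).
  rewrite -fourier_multiplication// -cIntR; congr cintegral; apply/funext => t.
  by rewrite /g Ffr mulrCA mul_conjc real_complexM mulrC.
have iFg : L1 setT (fun t => f t * F g t).
  by under eq_fun do rewrite mulrC; exact: L1_fourierM.
rewrite -[leLHS](@cReC R) step1 ReInt.
have fi2 := L2_itg f2.
(* [N2 f] is written as the mean of itself and of [Int Phi], to match the two AM-GM terms pointwise
   in t. *)
rewrite (_ : N2 f = Int (fun t => 2^-1 * (normc (f t) ^+ 2 + Phi t))); last first.
  by rewrite intZ ?intD ?IntPhi//; [field|exact: itgD].
have iKf t : L1 setT (fun s => (K (t + s))%:C%C * fr s).
  apply: (@L1M_bounded _ _ _ ((Num.sqrt (2 * pi))^-1 * (Num.sqrt e)^-1)) => //.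
  - by apply: cmeasR; exact: itg_measurable.
  - move=> s; rewrite normcR ger0_norm// /K mulrA ler_piMr ?gauss_le1 ?ltW//.
    by rewrite mulr_gt0// invr_gt0 ?sqrt2pi_gt0// sqrtr_gt0.
have iNKf t : Itg (fun s => K (t + s) * normc (fr s)).
  have := L1_itg (iKf t).
  by under eq_fun do rewrite normcM normcR ger0_norm//.
have K_le s : `|K s| <= (Num.sqrt (2 * pi))^-1 * (Num.sqrt e)^-1.
  rewrite ger0_norm// /K mulrA ler_piMr ?gauss_le1 ?ltW//.
  by rewrite mulr_gt0// invr_gt0 ?sqrt2pi_gt0// sqrtr_gt0.
have ih t : Itg (fun s => h (s, t)).
  apply: (itg_bounded _ _ (L2_itg fr2)) => [|s]; last exact: K_le.
  exact: itg_measurable (itgKt t).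
apply: int_le.
- by have /L1P[] := iFg.
- by apply: itgZ; exact: itgD.
- move=> t; apply: le_trans (ler_norm _) _; apply: le_trans (normRe_le _) _.
  rewrite normcM Fg.
  apply: (@le_trans _ _ (normc (f t) * Int (fun s => K (t + s) * normc (fr s)))).
    rewrite ler_wpM2l ?normc_ge0//; apply: le_trans (normc_cInt_le (iKf t)) _.
    by under eq_Rintegral do rewrite normcM normcR ger0_norm//.
  (* Since [K (t + s)] integrates to 1 in s, |f t|^2 can be brought under the integral, leaving a
     pointwise comparison in s. *)
  have -> : 2^-1 * (normc (f t) ^+ 2 + Phi t) =
      Int (fun s => 2^-1 * (normc (f t) ^+ 2 * K (t + s) + h (s, t))).
    rewrite intZ; last by apply: itgD => //; exact: itgZ.
    rewrite intD; [|exact: itgZ|exact: ih].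
    by rewrite intZ// IntK mulr1.
  rewrite -intZ//; apply: int_le.
  + exact: itgZ.
  + by apply: itgZ; apply: itgD => //; exact: itgZ.
  + move=> s; rewrite /h/=; have := K_ge0 (t + s).
    have := sqr_ge0 (normc (f t) - normc (fr s)).
    move: (normc _) (normc _) (K _) => a b k; nra.
Qed.

End damped.

(* Damping by the Gaussian [gauss e] turns [|F f|^2] into the pairing of [f]
   with its convolution by [K], which AM-GM bounds by [N2 f]; then [e -> 0]. *)
Lemma fourier_contraction f : L1 setT f -> L2 setT f ->
  L2 setT (F f) /\ N2 (F f) <= N2 f.
Proof.
move=> f1 f2; have mF := fourier_cmeas f1.
have [] := @itg_damped R (fun t => normc (F f t) ^+ 2) (N2 f).
- exact: measurable_normc2.
- by move=> x; exact: sqr_ge0.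
- by move=> n; apply: fourier_damped_itg.
- by move=> n; apply: fourier_damped_le.
- by move=> i le; split => //; apply/L2P.
Qed.

End FourierContraction.

(** * Completeness of L2 *)

Section RieszFischer.
Context {R : realType}.

(** The sequence [h n = 2 C / 2^n] decreases by exactly the step bound, so [a - h] increases and
    [a + h] decreases; the latter is bounded below, hence converges, and [h] tends to 0. *)
Lemma is_cvg_of_half_steps (a : nat -> R) (C : R) :
  (forall n, `|a n.+1 - a n| <= C / 2 ^+ n) -> cvgn a.
Proof.
move=> aC.
have C0 : 0 <= C by have := aC 0%N; rewrite expr0 divr1; exact: le_trans.
pose h n : R := 2 * C / 2 ^+ n.
have hS n : h n.+1 = h n - C / 2 ^+ n.
  by rewrite /h exprS; field; rewrite expf_neq0.
have h0 : h @ \oo --> (0 : R).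
  have -> : h = geometric (2 * C) 2^-1 by apply/funext => n; rewrite /h /geometric/= exprVn.
  by apply: cvg_geometric; rewrite ger0_norm ?invr_ge0// invf_lt1// ltr1n.
have nd : nondecreasing_seq (fun n => a n - h n).
  apply/nondecreasing_seqP => n; rewrite hS.
  by have := aC n; rewrite ler_norml => /andP[]; lra.
have ni : nonincreasing_seq (fun n => a n + h n).
  apply/nonincreasing_seqP => n; rewrite hS.
  by have := aC n; rewrite ler_norml => /andP[]; lra.
have hge0 n : 0 <= h n by rewrite divr_ge0 ?exprn_ge0// mulr_ge0.
have cb : cvgn (fun n => a n + h n).
  apply: nonincreasing_is_cvgn => //; exists (a 0%N - h 0%N) => _ [n _ <-].
  apply: le_trans (nd 0%N n (leq0n n)) _.
  by have := hge0 n; lra.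
have -> : a = (fun n => (a n + h n) - h n) by apply/funext => n; rewrite addrK.
by apply: is_cvgB => //; apply/cvg_ex; eexists; exact: h0.
Qed.

Implicit Types u : nat -> R -> R[i].

(** The limit superior is measurable whether or not the sequence converges, and is its limit where
    it does. *)
Let elim_seq (f : nat -> R -> R) (x : R) : R := fine (limn_esup (fun n => (f n x)%:E)).

Let measurable_elim_seq f : (forall n, measurable_fun setT (f n)) ->
  measurable_fun setT (elim_seq f).
Proof.
move=> mf; apply: measurableT_comp => //.
apply: (@measurable_fun_limn_esup _ _ _ _ (fun n x => (f n x)%:E)) => n.
exact/measurable_EFinP.
Qed.

Let cvg_elim_seq f x : cvgn (fun n => f n x) ->
  (fun n => f n x) @ \oo --> elim_seq f x.
Proof.
move=> cf.
have : (fun n => (f n x)%:E) @ \oo --> (limn (fun n => f n x))%:E.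
  by apply: cvg_EFin; [exact: nearW|exact: cf].
by rewrite /elim_seq => /cvg_limn_einf_sup[_ ->].
Qed.

(** Fast mean-square convergence forces summable increments at almost every point, hence a pointwise
    limit; Fatou then turns the Cauchy bounds into bounds on the distance to that limit. *)
Lemma riesz_fischer u : (forall n, L2 setT (u n)) ->
  (forall n m, (n <= m)%N -> N2 (fun t => u m t - u n t) <= 8^-1 ^+ n) ->
  exists v, L2 setT v /\ forall n, N2 (fun t => v t - u n t) <= 8^-1 ^+ n.
Proof.
move=> u2 uC.
pose v x : R[i] := (elim_seq (fun n x => Re (u n x)) x +i* elim_seq (fun n x => Im (u n x)) x)%C.
have mv : cmeas v.
  split; apply: measurable_elim_seq => n.
  - by have [] := L2_cmeas (u2 n).
  - by have [] := L2_cmeas (u2 n).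
pose d n x := normc (u n.+1 x - u n x) ^+ 2.
have id_ n : Itg (d n) by apply: L2_itg; exact: L2B.
have d0 n x : 0 <= d n x by exact: sqr_ge0.
(* The weight 4^n against the rate 8^-n leaves the convergent series of 2^-n; where the sum S is
   finite, each increment is at most sqrt S / 2^n. *)
pose s n x := (4 ^+ n * d n x)%:E.
have is_ n : Itg (fun x => 4 ^+ n * d n x) by exact: itgZ.
have s0 n x : (0 <= s n x)%E by rewrite lee_fin; apply: mulr_ge0; [exact: exprn_ge0|exact: d0].
have ms n : measurable_fun setT (s n).
  by apply/measurable_EFinP; exact: itg_measurable.
have sum_lty : (\sum_(0 <= n <oo) \int[@lebesgue_measure R]_x s n x < +oo)%E.
  have sle n : (\int[@lebesgue_measure R]_x s n x <= (geometric 1 2^-1 n)%:E)%E.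
    rewrite -(EFin_int (is_ n)) lee_fin intZ// /geometric/= mul1r.
    apply: le_trans (_ : 4 ^+ n * 8^-1 ^+ n <= _).
      by rewrite ler_wpM2l ?exprn_ge0//; exact: uC.
    by rewrite -exprMn lerXn2r// ?nnegrE; lra.
  apply: (@le_lt_trans _ _ (\sum_(0 <= n <oo) (geometric 1 2^-1 n)%:E)%E).
    by apply: lee_nneseries => [n _ _|n _]; [apply: integral_ge0|exact: sle].
  have /cvg_geometric_series : `|2^-1| < 1 :> R by rewrite ger0_norm ?invr_ge0//; lra.
  move=> /(_ 1) hg.
  have hE : (EFin \o series (geometric (1 : R) 2^-1)) @ \oo --> (1 / (1 - 2^-1) : R)%:E.
    by apply: cvg_EFin; [exact: nearW|exact: hg].
  rewrite (_ : (\sum_(0 <= n <oo) _)%E = (1 / (1 - 2^-1) : R)%:E) ?ltry//.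
  rewrite -(cvg_lim _ hE)//; congr (limn _); apply/funext => n.
  by rewrite /= sumEFin.
have isum : mu.-integrable setT (fun x : R => \sum_(0 <= n <oo) s n x)%E.
  apply/integrableP; split.
    exact: (@ge0_emeasurable_sum _ _ R setT s predT (fun n x _ _ => s0 n x) (fun n _ => ms n)).
  under eq_integral do rewrite gee0_abs ?nneseries_ge0//.
  by rewrite integral_nneseries.
have aecvg : \forall x \ae @mu R, (fun n => Re (u n x)) @ \oo --> Re (v x) /\
    (fun n => Im (u n x)) @ \oo --> Im (v x).
  apply: aeS (integrable_ae measurableT isum) => x /(_ I).
  set S := (X in X \is a fin_num) => Sfin.
  have dS n : 4 ^+ n * d n x <= fine S.
    rewrite -lee_fin fineK//.
    have := @nneseries_lim_ge R (fun n => s n x) xpredT 0%N n.+1 (fun n _ _ => s0 n x).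
    apply: le_trans; rewrite big_nat_recr//= leeDr//.
    by apply: sume_ge0 => k _; exact: s0.
  have S0 : 0 <= fine S by rewrite fine_ge0// nneseries_ge0.
  have step n : normc (u n.+1 x - u n x) <= Num.sqrt (fine S) / 2 ^+ n.
    rewrite -(@ler_pXn2r _ 2)// ?nnegrE ?normc_ge0 ?divr_ge0 ?exprn_ge0 ?sqrtr_ge0//.
    rewrite expr_div_n sqr_sqrtr// exprAC -natrX ler_pdivlMr ?exprn_gt0//.
    by rewrite mulrC; exact: dS.
  split; apply: cvg_elim_seq; apply: (@is_cvg_of_half_steps _ (Num.sqrt (fine S))) => n.
  - apply: le_trans (step n).
    by rewrite -cReN -cReD; exact: normRe_le.
  - apply: le_trans (step n).
    by rewrite -cImN -cImD; exact: normIm_le.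
(* Fatou along m for the functions |u (n + m) - u n|^2, all of integral at most 8^-n. *)
have bound n : (\int[@lebesgue_measure R]_x (normc (v x - u n x) ^+ 2)%:E <=
    (8^-1 ^+ n)%:E)%E.
  pose g m x := (normc (u (n + m)%N x - u n x) ^+ 2)%:E.
  have mg m : measurable_fun setT (g m).
    by apply/measurable_EFinP; apply: measurable_normc2; apply: L2_cmeas; exact: L2B.
  have g0 m x : setT x -> (0 <= g m x)%E by rewrite lee_fin sqr_ge0.
  have mvu : measurable_fun setT (fun x => (normc (v x - u n x) ^+ 2)%:E).
    apply/measurable_EFinP; apply: measurable_normc2; apply: cmeasB => //.
    exact: L2_cmeas.
  have -> : (\int[@lebesgue_measure R]_x (normc (v x - u n x) ^+ 2)%:E =
      \int[@lebesgue_measure R]_x limn_einf (g ^~ x))%E.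
    apply: ae_eq_integral => //.
    - apply: measurableT_comp => //.
      apply: (@measurable_fun_limn_esup _ _ _ _ (fun n x => - g n x)%E) => m.
      exact: measurableT_comp.
    - apply: aeS aecvg => x [cR cI] _.
      apply/esym; suff /cvg_limn_einf_sup[-> _] : g ^~ x @ \oo -->
        (normc (v x - u n x) ^+ 2)%:E by [].
      apply: cvg_EFin; first exact: nearW.
      rewrite /comp/=; under eq_fun do rewrite sqr_normc cReD cReN cImD cImN.
      rewrite sqr_normc cReD cReN cImD cImN.
      have cR' : (fun m => Re (u (n + m)%N x)) @ \oo --> Re (v x).
        by have := cR; rewrite -(cvg_shiftn n); under eq_fun do rewrite addnC.
      have cI' : (fun m => Im (u (n + m)%N x)) @ \oo --> Im (v x).
        by have := cI; rewrite -(cvg_shiftn n); under eq_fun do rewrite addnC.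
      by apply: cvgD; apply: cvgM; apply: cvgB => //; exact: cvg_cst.
  apply: le_trans (fatou mu measurableT mg g0) _.
  rewrite limn_einf_lim.
  apply: lime_le; first exact: is_cvg_einfs.
  apply: nearW => m; apply: le_trans (ereal_inf_lbound _) _.
    by exists m => //=.
  rewrite /g -EFin_int; last by apply: L2_itg; exact: L2B.
  by rewrite lee_fin; apply: uC; rewrite leq_addr.
have vu n : L2 setT (fun t => v t - u n t).
  apply/L2P; have m := cmeasB mv (L2_cmeas (u2 n)); split => //.
  apply: itgP; first exact: measurable_normc2.
  apply: le_lt_trans (ltry (8^-1 ^+ n)); apply: le_trans (bound n).
  by under eq_integral do rewrite ger0_norm ?sqr_ge0//.
exists v; split.
  have := L2D (vu 0%N) (u2 0%N).
  by under eq_fun do rewrite subrK.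
by move=> n; rewrite -lee_fin EFin_int//; exact: (L2_itg (vu n)).
Qed.

End RieszFischer.

(** * Truncation to bounded intervals and the Cauchy-Schwarz inequality *)

Section Truncation.
Context {R : realType}.
Implicit Types f g x y : R -> R[i].

Definition trunc (n : nat) (x : R -> R[i]) (t : R) : R[i] :=
  (\1_(`[- n%:R, n%:R]%classic : set R) t)%:C%C * x t.

Let indic01 (n : nat) (t : R) : \1_(`[- n%:R, n%:R]%classic : set R) t = 0 :> R \/
  \1_(`[- n%:R, n%:R]%classic : set R) t = 1 :> R.
Proof. by rewrite indicE; case: (_ \in _); [right|left]. Qed.

Let normc_indic (n : nat) (t : R) :
  normc ((\1_(`[- n%:R, n%:R]%classic : set R) t)%:C%C) <= 1 :> R.
Proof. by rewrite normcR; case: (indic01 n t) => ->; rewrite ?normr0 ?normr1. Qed.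

Lemma L2_trunc n x : L2 setT x -> L2 setT (trunc n x).
Proof.
move=> x2; apply: (@L2M_bounded _ _ _ 1) => //.
by apply: cmeasR; apply: measurable_indic.
Qed.

Lemma L1_trunc n x : L2 setT x -> L1 setT (trunc n x).
Proof.
move=> x2; apply: L2M => //.
have mi : measurable_fun setT (\1_(`[- n%:R, n%:R]%classic : set R) : R -> R).
  exact: measurable_indic.
apply: (@L2_le _ _ (\1_(`[- n%:R, n%:R]%classic : set R))).
- exact: cmeasR.
- by move=> t; rewrite normcR; case: (indic01 n t) => ->; rewrite ?normr0 ?normr1 ?expr0n ?expr1n.
- exact: integrable_indic_itv.
Qed.

Lemma truncJ n x t : trunc n (fun t => conjc (x t)) t = conjc (trunc n x t).
Proof. by rewrite /trunc conjcM conjc_real. Qed.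

(** Pairing with the truncated conjugate, an admissible test function, extracts the norm of the
    truncation. *)
Lemma trunc_conjM n x t : x t * trunc n (fun t => conjc (x t)) t =
  (normc (trunc n x t) ^+ 2)%:C%C.
Proof.
rewrite truncJ -mul_conjc /trunc conjcM conjc_real.
case: (indic01 n t) => ->; first by rewrite !mul0r mulr0.
by rewrite !mul1r.
Qed.

Let near_trunc x t : \forall n \near \oo, trunc n x t = x t.
Proof.
near=> n; rewrite /trunc indicE mem_set ?mul1r//=.
rewrite in_itv/= -ler_norml ltW// (lt_le_trans (truncnS_gt _))// ler_nat.
by near: n; exact: nbhs_infty_ge.
Unshelve. all: by end_near. Qed.

Lemma cvg_N2_trunc x : L2 setT x -> (fun n => N2 (trunc n x)) @ \oo --> N2 x.
Proof.
move=> x2; apply: (@int_dominated_cvg R (fun n t => normc (trunc n x t) ^+ 2)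
  _ (fun t => normc (x t) ^+ 2)).
- by move=> n; apply: measurable_normc2; apply: L2_cmeas; exact: L2_trunc.
- by apply: measurable_normc2; exact: L2_cmeas.
- exact: L2_itg.
- apply: aeW => t; apply: cvg_near_cst; apply: filterS (near_trunc x t) => n.
  by move=> ->.
- move=> n t; rewrite ger0_norm ?sqr_ge0// /trunc normcM exprMn ler_piMl ?sqr_ge0//.
  by rewrite exprn_ile1// normc_ge0.
Qed.

Lemma cvg_N2_truncB x : L2 setT x ->
  (fun n => N2 (fun t => trunc n x t - x t)) @ \oo --> (0 : R).
Proof.
move=> x2; have -> : (0 : R) = Int (fun=> 0) by rewrite /Rintegral integral0.
apply: (@int_dominated_cvg R (fun n t => normc (trunc n x t - x t) ^+ 2)
  _ (fun t => normc (x t) ^+ 2)).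
- by move=> n; apply: measurable_normc2; apply: L2_cmeas; apply: L2B => //; exact: L2_trunc.
- by [].
- exact: L2_itg.
- apply: aeW => t; apply: cvg_near_cst; apply: filterS (near_trunc x t) => n.
  by move=> ->; rewrite subrr normc0 expr0n.
- move=> n t; rewrite ger0_norm ?sqr_ge0// /trunc.
  case: (indic01 n t) => ->; first by rewrite mul0r add0r normcN.
  by rewrite mul1r subrr normc0 expr0n sqr_ge0.
Qed.

(** The AM-GM bound is applied to s f and g, and the scale s is optimised. *)
Lemma cauchy_schwarz f g : L2 setT f -> L2 setT g ->
  normc (cInt (fun t => f t * g t)) ^+ 2 <= N2 f * N2 g.
Proof.
move=> f2 g2; set P := normc _; set A := N2 f; set B := N2 g.
have P0 : 0 <= P by exact: normc_ge0.
have A0 : 0 <= A by exact: N2_ge0.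
have B0 : 0 <= B by exact: N2_ge0.
have key s : 0 < s -> 2 * (s * P) <= s ^+ 2 * A + B.
  move=> s0; have := normc_cIntM_le (L2Z s%:C%C f2) g2.
  rewrite N2Z// normcR real_normK ?num_real//.
  have -> : cInt (fun t => s%:C%C * f t * g t) = s%:C%C * cInt (fun t => f t * g t).
    by rewrite -(cIntZ _ (L2M f2 g2)); congr cintegral; apply/funext => t; rewrite mulrA.
  rewrite normcM normcR gtr0_norm// -/P -/A -/B.
  by lra.
have [->|Pn0] := eqVneq P 0; first by rewrite expr0n mulr_ge0.
have Ppos : 0 < P by rewrite lt_neqAle eq_sym Pn0.
have [A00|An0] := eqVneq A 0.
  (* If A = 0, then 2 s P <= B for every s > 0, which fails at this s. *)
  have s0 : 0 < (B + 1) / P by rewrite divr_gt0// ltr_pwDr.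
  have := key _ s0; rewrite A00 mulr0 divfK//.
  by lra.
have Apos : 0 < A by rewrite lt_neqAle eq_sym An0.
(* The minimiser of s^2 A - 2 s P. *)
have s0 : 0 < P / A by rewrite divr_gt0.
have := key _ s0.
have -> : 2 * (P / A * P) = 2 * P ^+ 2 / A by field.
have -> : (P / A) ^+ 2 * A = P ^+ 2 / A by field.
rewrite -[B](@mulfK _ A)// -mulrDl ler_pM2r ?invr_gt0//.
by rewrite (mulfK An0) [A * B]mulrC; lra.
Qed.

Lemma cvg_cIntM0 (u : nat -> R -> R[i]) g : (forall n, L2 setT (u n)) ->
  L2 setT g -> (fun n => N2 (u n)) @ \oo --> (0 : R) ->
  (fun n => normc (cInt (fun t => u n t * g t))) @ \oo --> (0 : R).
Proof.
move=> u2 g2 u0.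
have h0 : (fun n => Num.sqrt (N2 (u n) * N2 g)) @ \oo --> (0 : R).
  rewrite -(@sqrtr0 R); apply: continuous_cvg; first exact: sqrt_continuous.
  by rewrite -[X in _ --> X](mul0r (N2 g)); apply: cvgM => //; exact: cvg_cst.
apply: (squeeze_cvgr _ (cvg_cst 0) h0); apply: nearW => n.
rewrite normc_ge0/= -[leLHS]ger0_norm ?normc_ge0// -sqrtr_sqr.
by rewrite ler_wsqrtr// cauchy_schwarz.
Qed.

End Truncation.

(** * The Fourier operator on L2 and its dual description *)

Section FourierL2.
Context {R : realType}.
Notation F := (@fourier_integral R).
Implicit Types f g x y z : R -> R[i].

Lemma cvg_seq_ge (u : nat -> R) (l a : R) : u @ \oo --> l ->
  (forall n, a <= u n) -> a <= l.
Proof.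
move=> ul au; rewrite -(cvg_lim (@Rhausdorff R) ul); apply: limr_ge.
- by apply/cvg_ex; eexists; exact: ul.
- by apply: nearW.
Qed.

Lemma cvg_seq_le (u : nat -> R) (l a : R) : u @ \oo --> l ->
  (forall n, u n <= a) -> l <= a.
Proof.
move=> ul ua; rewrite -(cvg_lim (@Rhausdorff R) ul); apply: limr_le.
- by apply/cvg_ex; eexists; exact: ul.
- by apply: nearW.
Qed.

Lemma fourierB f g t : L1 setT f -> L1 setT g ->
  F (fun s => f s - g s) t = F f t - F g t.
Proof.
move=> f1 g1; rewrite !fourierE -mulrBr -cIntB; [|exact: L1_cis|exact: L1_cis].
by congr (_ * cintegral _ _); apply/funext => s; rewrite mulrBl.
Qed.

Lemma sqnorm2_cvg0 (u : nat -> R -> R[i]) : (forall n, L2 setT (u n)) ->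
  (fun n => sqnorm2 setT (u n)) @ \oo --> (0 : \bar R) <->
  (fun n => N2 (u n)) @ \oo --> (0 : R).
Proof.
move=> u2.
have -> : (fun n => sqnorm2 setT (u n)) = (fun n => (N2 (u n))%:E).
  by apply/funext => n; rewrite L2_sqnorm2.
split=> h; first exact: (fine_cvg h).
by apply: cvg_EFin; [exact: nearW|exact: h].
Qed.

(* The graph of the Fourier operator, characterised by duality. *)
Definition weak_fourier x y := [/\ L2 setT x, L2 setT y &
  forall g, L1 setT g -> L2 setT g ->
    cInt (fun t => y t * g t) = cInt (fun t => x t * F g t)].

(** Truncations of [x] approximate it within L1 and L2; by contraction their transforms form a
    Cauchy sequence, and completeness provides the image. *)
Lemma fourier_exists x : L2 setT x -> exists y, fourier x y.
Proof.
move=> x2.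
(* With the constant 1/4 and the factors 2 of [N2D_le], two approximations differ by at most 8^-n,
   the rate asked for by [riesz_fischer]. *)
have /choice[k hk] : forall n : nat, exists k : nat,
    N2 (fun t => trunc k x t - x t) <= 4^-1 * 8^-1 ^+ n.
  move=> n.
  have e0 : 0 < 4^-1 * 8^-1 ^+ n :> R by rewrite mulr_gt0// exprn_gt0.
  have /cvgrPdist_le /(_ _ e0) [N _ /(_ N)] := cvg_N2_truncB x2.
  move=> /(_ (leqnn N)); rewrite sub0r normrN ger0_norm ?N2_ge0//.
  by exists N.
pose u n := trunc (k n) x.
have u1 n : L1 setT (u n) by exact: L1_trunc.
have u2 n : L2 setT (u n) by exact: L2_trunc.
have Fu2 n : L2 setT (F (u n)) by have [] := fourier_contraction (u1 n) (u2 n).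
have uC n m : (n <= m)%N -> N2 (fun t => F (u m) t - F (u n) t) <= 8^-1 ^+ n.
  move=> nm.
  have -> : (fun t => normc (F (u m) t - F (u n) t) ^+ 2) =
      (fun t => normc (F (fun s => u m s - u n s) t) ^+ 2).
    by apply/funext => t; rewrite fourierB.
  have [_] := fourier_contraction (L1B (u1 m) (u1 n)) (L2B (u2 m) (u2 n)).
  move/le_trans; apply.
  have -> : (fun t => normc (u m t - u n t) ^+ 2) =
      (fun t => normc ((u m t - x t) + -1 * (u n t - x t)) ^+ 2).
    by apply/funext => t; congr (normc _ ^+ _); ring.
  have d2 j : L2 setT (fun t => u j t - x t) by exact: L2B.
  apply: le_trans (N2D_le (d2 m) (L2Z (-1) (d2 n))) _.
  rewrite N2Z// normcN normc1 expr1n mul1r.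
  have := hk m; have := hk n; rewrite -/(u m) -/(u n).
  have : 8^-1 ^+ m <= 8^-1 ^+ n :> R by rewrite ler_wiXn2l// invf_le1// ler1n.
  by lra.
have [y [y2 hy]] := riesz_fischer Fu2 uC.
exists y; split => //; exists u; split => //.
- apply/sqnorm2_cvg0 => [n|]; first exact: (L2B (u2 n) x2).
  have e8 : (fun n => 8^-1 ^+ n) @ \oo --> (0 : R).
    by apply: cvg_expr; rewrite ger0_norm ?invr_ge0// invf_lt1// ltr1n.
  apply: (squeeze_cvgr _ (cvg_cst 0) e8); apply: nearW => n.
  rewrite N2_ge0/=; apply: le_trans (hk n) _.
  by have : 0 <= 8^-1 ^+ n :> R; [rewrite exprn_ge0//|lra].
- apply/sqnorm2_cvg0 => [n|]; first exact: (L2B (Fu2 n) y2).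
  have e8 : (fun n => 8^-1 ^+ n) @ \oo --> (0 : R).
    by apply: cvg_expr; rewrite ger0_norm ?invr_ge0// invf_lt1// ltr1n.
  apply: (squeeze_cvgr _ (cvg_cst 0) e8); apply: nearW => n.
  rewrite N2_ge0/=; apply: le_trans (hy n).
  rewrite le_eqVlt; apply/orP; left; apply/eqP; congr Rintegral.
  by apply/funext => t; rewrite -opprB normcN.
Qed.

(** For the approximating functions the identity is the multiplication formula, and by
    Cauchy-Schwarz both sides are continuous in the L2 norm. *)
Lemma fourier_weak x y : fourier x y -> weak_fourier x y.
Proof.
move=> [x2 y2 [u [u12 ux uy]]]; split => // g g1 g2.
have u1 n : L1 setT (u n) by have [] := u12 n.
have u2 n : L2 setT (u n) by have [] := u12 n.
have Fu2 n : L2 setT (F (u n)) by have [] := fourier_contraction (u1 n) (u2 n).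
have [Fg2 _] := fourier_contraction g1 g2.
have d1 n : L2 setT (fun t => u n t - x t) by exact: L2B.
have d2 n : L2 setT (fun t => F (u n) t - y t) by exact: (L2B (Fu2 n) y2).
have c1 := cvg_cIntM0 d1 Fg2 ((sqnorm2_cvg0 d1).1 ux).
have c2 := cvg_cIntM0 d2 g2 ((sqnorm2_cvg0 d2).1 uy).
have c : (fun n => normc (cInt (fun t => (u n t - x t) * F g t)) +
    normc (cInt (fun t => (F (u n) t - y t) * g t))) @ \oo --> (0 : R).
  by rewrite -[X in _ --> X]addr0; exact: cvgD c1 c2.
apply/eqP; rewrite -subr_eq0 -normc_eq0; apply/eqP.
apply/le_anti; rewrite normc_ge0 andbT.
have h n : normc (cInt (fun t => y t * g t) - cInt (fun t => x t * F g t)) <=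
    normc (cInt (fun t => (u n t - x t) * F g t)) +
    normc (cInt (fun t => (F (u n) t - y t) * g t)).
  have -> : cInt (fun t => (u n t - x t) * F g t) =
      cInt (fun t => u n t * F g t) - cInt (fun t => x t * F g t).
    rewrite -(cIntB (L2M (u2 n) Fg2) (L2M x2 Fg2)).
    by congr cintegral; apply/funext => t; rewrite mulrBl.
  have -> : cInt (fun t => (F (u n) t - y t) * g t) =
      cInt (fun t => F (u n) t * g t) - cInt (fun t => y t * g t).
    rewrite -(cIntB (L2M (Fu2 n) g2) (L2M y2 g2)).
    by congr cintegral; apply/funext => t; rewrite mulrBl.
  rewrite fourier_multiplication//.
  rewrite -[X in _ <= _ + X]normcN; apply: le_trans (normc_triangle _ _).
  by rewrite le_eqVlt; apply/orP; left; apply/eqP; congr normc; ring.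
exact: cvg_seq_ge c h.
Qed.

(** The difference of two images annihilates every test function, in particular its own truncated
    conjugates, so all its truncations have norm 0. *)
Lemma weak_fourier_uniq x y y' : weak_fourier x y -> weak_fourier x y' ->
  ae_eq mu setT y y'.
Proof.
move=> [x2 y2 hy] [_ y2' hy'].
pose w t := y t - y' t; have w2 : L2 setT w by exact: L2B.
have w0 g : L1 setT g -> L2 setT g -> cInt (fun t => w t * g t) = 0.
  move=> g1 g2; have := hy _ g1 g2; rewrite -hy'// => /eqP.
  rewrite -subr_eq0 -cIntB; [|exact: L2M|exact: L2M] => /eqP <-.
  by congr cintegral; apply/funext => t; rewrite mulrBl.
have t0 n : N2 (trunc n w) = 0.
  have := w0 _ (L1_trunc n (L2J w2)) (L2_trunc n (L2J w2)).
  under [X in cintegral _ X]eq_fun do rewrite trunc_conjM.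
  by rewrite cIntR => /eqP; rewrite eq_complex => /andP[/eqP].
have N0 : N2 w = 0.
  apply: (cvg_unique _ (cvg_N2_trunc w2)) => //.
  by rewrite (funext t0); exact: cvg_cst.
by apply: aeS (N2_eq0 w2 N0) => t /(_ I) /eqP; rewrite subr_eq0 => /eqP.
Qed.

(** With the truncated conjugate [g] of [y] as test function, [N2 (trunc n y)] is the pairing of [x]
    with [F g], at most the mean of [N2 x] and [N2 (F g)], and [N2 (F g) <= N2 (trunc n y)]. *)
Lemma weak_fourier_contraction x y : weak_fourier x y -> N2 y <= N2 x.
Proof.
move=> [x2 y2 hy].
have h n : N2 (trunc n y) <= N2 x.
  pose g := trunc n (fun t => conjc (y t)).
  have g1 : L1 setT g by apply: L1_trunc; exact: L2J.
  have g2 : L2 setT g by apply: L2_trunc; exact: L2J.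
  have N2g : N2 g = N2 (trunc n y).
    by congr Rintegral; apply/funext => t; rewrite /g truncJ normcJ.
  have := hy _ g1 g2.
  have -> : (fun t => y t * g t) = (fun t => (normc (trunc n y t) ^+ 2)%:C%C).
    by apply/funext => t; rewrite /g trunc_conjM.
  rewrite cIntR => e.
  have [Fg2 Fg] := fourier_contraction g1 g2.
  have := normc_cIntM_le x2 Fg2; rewrite -e normcR ger0_norm ?N2_ge0//.
  by move: Fg; rewrite N2g; lra.
exact: cvg_seq_le (cvg_N2_trunc y2) h.
Qed.

Lemma weak_fourier_ae_eq x y y' : weak_fourier x y -> cmeas y' ->
  ae_eq mu setT y y' -> weak_fourier x y'.
Proof.
move=> [x2 y2 hy] my' yy'; have y2' := L2_ae_eq my' yy' y2.
split => // g g1 g2; rewrite -hy//; apply: cInt_ae_eq.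
- by apply: cmeasM => //; exact: L1_cmeas.
- by apply: cmeasM; [exact: L2_cmeas|exact: L1_cmeas].
- by apply: aeS yy' => t /= + _ => /(_ I) ->.
Qed.

Lemma weak_fourier_exists x : L2 setT x -> exists y, weak_fourier x y.
Proof. by move=> /fourier_exists[y /fourier_weak]; exists y. Qed.

(** By uniqueness a weak image agrees almost everywhere with the one built in [fourier_exists], and
    so shares its approximating sequence. *)
Lemma weak_fourierE x y : weak_fourier x y <-> fourier x y.
Proof.
split=> [W|]; last exact: fourier_weak.
have [x2 y2 _] := W; have [z xz] := fourier_exists x2.
have zy := weak_fourier_uniq (fourier_weak xz) W.
have [_ z2 [u [u12 ux uz]]] := xz.
split => //; exists u; split => //.
have u1 n : L1 setT (u n) by have [] := u12 n.
have u2 n : L2 setT (u n) by have [] := u12 n.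
have Fu2 n : L2 setT (F (u n)) by have [] := fourier_contraction (u1 n) (u2 n).
suff -> : (fun n => sqnorm2 setT (fun t => F (u n) t - y t)) =
  (fun n => sqnorm2 setT (fun t => F (u n) t - z t)) by [].
apply/funext => n; rewrite (L2_sqnorm2 (L2B (Fu2 n) y2)) (L2_sqnorm2 (L2B (Fu2 n) z2)).
congr EFin; apply: N2_ae_eq.
- exact: (L2_cmeas (L2B (Fu2 n) y2)).
- exact: (L2_cmeas (L2B (Fu2 n) z2)).
- by apply: aeS zy => t /= + _ => /(_ I) ->.
Qed.

Lemma weak_fourierZ (c : R[i]) x y : weak_fourier x y ->
  weak_fourier (fun t => c * x t) (fun t => c * y t).
Proof.
move=> [x2 y2 hy]; split; [exact: L2Z|exact: L2Z|] => g g1 g2.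
have [Fg2 _] := fourier_contraction g1 g2.
have e1 : (fun t => c * y t * g t) = (fun t => c * (y t * g t)).
  by apply/funext => t; rewrite mulrA.
have e2 : (fun t => c * x t * F g t) = (fun t => c * (x t * F g t)).
  by apply/funext => t; rewrite mulrA.
by rewrite e1 e2 !cIntZ ?hy//; exact: L2M.
Qed.

End FourierL2.

(** * Totality of the translated Gaussians *)

Section GaussianTotality.
Context {R : realType}.

Section real_case.
Variable w : R -> R.
Hypothesis iw : Itg w.
Hypothesis wg : forall a s, 0 < a -> Int (fun t => w t * gauss a (s - t)) = 0.

Let mw : measurable_fun setT w. Proof. exact: itg_measurable. Qed.

Variable y : R.
Let I (t : R) : R := \1_(`]-oo, y]%classic : set R) t.

Let mI : measurable_fun setT I.
Proof. by apply: measurable_indic; exact: measurable_itv. Qed.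

Let I01 t : I t = 0 \/ I t = 1.
Proof. by rewrite /I indicE; case: (_ \in _); [right|left]. Qed.

Let normI t : `|I t| <= 1.
Proof. by case: (I01 t) => ->; rewrite ?normr0 ?normr1. Qed.

(** Up to the factor n.+1, the half-line indicator convolved with the Gaussian of parameter n.+1^2,
    rescaled by s = v / n.+1 + t so that the fixed function [gauss 1] dominates for all n. *)
Let J (n : nat) (t : R) := Int (fun v => I (n.+1%:R^-1 * v + t) * gauss 1 v).

Let mIn (n : nat) (t : R) : measurable_fun setT (fun v : R => I (n.+1%:R^-1 * v + t)).
Proof. exact: (measurableT_comp mI (measurable_affine _ _)). Qed.

Let norm_Igauss s v : `|I s * gauss 1 v| <= gauss 1 v.
Proof. by rewrite normrM [X in _ * X]ger0_norm ?gauss_ge0// ler_piMl ?gauss_ge0. Qed.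

(** The hypothesis [wg] is integrated over the centres s <= y and the order of integration
    exchanged. *)
Let fubini_J n : Itg (fun t => w t * J n t) /\ Int (fun t => w t * J n t) = 0.
Proof.
pose a : R := n.+1%:R ^+ 2.
have n0 : 0 < n.+1%:R :> R by [].
have a0 : 0 < a by rewrite exprn_gt0.
pose h (p : R * R) := w p.1 * (I p.2 * gauss a (p.2 - p.1)).
have mh : measurable_fun setT h.
  apply: measurable_funM; first exact: (measurableT_comp mw).
  apply: measurable_funM; first exact: (measurableT_comp mI).
  by apply: (measurableT_comp (measurable_gauss a)); apply: measurable_funB.
have ig t : Itg (fun s => gauss a (s - t)).
  have := itg_affine (- t) ltr01 (itg_gauss a0).
  by under eq_fun do rewrite mul1r.
have Intg t : Int (fun s => gauss a (s - t)) = Int (gauss a).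
  rewrite [RHS](@Int_affine _ 1 (- t)) //; last exact: measurable_gauss.
  by congr Rintegral; apply/funext => s; rewrite mul1r mulr1.
have hlty : (\int[@lebesgue_measure R]_t \int[@lebesgue_measure R]_s
    (`|h (t, s)|)%:E < +oo)%E.
  have i2 : Itg (fun t => Int (gauss a) * `|w t|) by apply: itgZ; exact: itg_norm.
  have i1 t : Itg (fun s => `|w t| * gauss a (s - t)) by exact: itgZ.
  apply: (@le_lt_trans _ _ (\int[@lebesgue_measure R]_t (Int (gauss a) * `|w t|)%:E)%E).
    apply: ge0_le_integral => //.
    - by move=> t _; apply: integral_ge0.
    - apply: (@measurable_fun_fubini_tonelli_F _ _ _ _ R (@lebesgue_measure R)
        (fun p : R * R => (`|h p|)%:E)) => //.
      by apply/measurable_EFinP; exact: measurableT_comp.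
    - by apply/measurable_EFinP; exact: itg_measurable.
    - move=> t _.
      have -> : (Int (gauss a) * `|w t|)%:E =
          (\int[@lebesgue_measure R]_s (`|w t| * gauss a (s - t))%:E)%E.
        by have := EFin_int (i1 t); rewrite intZ// Intg mulrC => ->.
      apply: ge0_le_integral => //.
      + apply/measurable_EFinP; apply: measurableT_comp => //.
        exact: (measurable_fun_pair2 t mh).
      + by apply/measurable_EFinP; exact: itg_measurable.
      + move=> s _; rewrite lee_fin /h/= !normrM ler_wpM2l//.
        by rewrite [X in _ * X]ger0_norm ?gauss_ge0// ler_piMl ?gauss_ge0.
  by have := EFin_int i2 => <-; exact: ltry.
have E : (fun t => Int (fun s => h (t, s))) =
    (fun t => n.+1%:R^-1 * (w t * J n t)).
  apply/funext => t; rewrite /h/=.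
  have iI : Itg (fun s => I s * gauss a (s - t)).
    apply: (@itg_bounded _ I _ 1) => //.
  rewrite intZ// mulrCA; congr (_ * _).
  have iJ : Itg (fun v => I (n.+1%:R^-1 * v + t) * gauss 1 v).
    by apply: (@itg_bounded _ _ _ 1) => //; exact: itg_gauss.
  rewrite /J -intZ// (@Int_affine _ n.+1%:R^-1 t)//; last exact: itg_measurable.
  congr Rintegral; apply/funext => v; rewrite addrK [RHS]mulrC; congr (_ * _ * _).
  have : n.+1%:R != 0 :> R by rewrite pnatr_eq0.
  by rewrite /gauss /a; move: (n.+1%:R : R) => k k0; congr expR; field.
have iwJ : Itg (fun t => w t * J n t).
  have iE := itg_int1 mh hlty; rewrite E in iE; have := itgZ n.+1%:R iE.
  have -> : (fun t => n.+1%:R * (n.+1%:R^-1 * (w t * J n t))) = (fun t => w t * J n t).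
    by apply/funext => t; rewrite mulVKf// pnatr_eq0.
  by [].
split => //; have := int_fubini mh hlty; rewrite E.
have -> : (fun s => Int (fun t => h (t, s))) = (fun s => 0).
  apply/funext => s.
  have -> : (fun t => h (t, s)) = (fun t => I s * (w t * gauss a (s - t))).
    by apply/funext => t; rewrite /h/= mulrCA.
  rewrite intZ ?wg ?mulr0//.
  under eq_fun do rewrite mulrC.
  apply: (@itg_bounded _ (fun t => gauss a (s - t)) _ 1) => //.
  - apply: (measurableT_comp (measurable_gauss a)).
    exact: measurable_funB.
  - by move=> t; rewrite ger0_norm ?gauss_ge0// gauss_le1// ltW.
rewrite [Int (fun=> 0)]/Rintegral integral0/=.
rewrite intZ// => /eqP; rewrite mulf_eq0 invr_eq0 pnatr_eq0/= => /eqP.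
by [].
Qed.

(** Away from the jump [y] the indicator is locally constant, so the integrand is eventually
    stationary in n. *)
Let cvg_J t : t != y -> (fun n => J n t) @ \oo --> Num.sqrt (2 * pi) * I t.
Proof.
move=> ty.
have -> : Num.sqrt (2 * pi) * I t = Int (fun v => I t * gauss 1 v).
  by rewrite intZ ?Int_gauss// ?sqrtr1 ?divr1 1?mulrC//; exact: itg_gauss.
apply: (@int_dominated_cvg _ _ _ (gauss 1)).
- by move=> n; apply: measurable_funM => //; exact: measurable_gauss.
- by apply: measurable_funM => //; exact: measurable_gauss.
- exact: itg_gauss.
- apply: aeW => v; apply: cvgM; last exact: cvg_cst.
  have h : (fun n => harmonic n * v + t) @ \oo --> t.
    rewrite -[X in _ --> X](add0r t) -[X in _ --> X + t](mul0r v).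
    by apply: cvgD; [apply: cvgM; [exact: cvg_harmonic|exact: cvg_cst]|exact: cvg_cst].
  apply: cvg_near_cst; move: ty; rewrite neq_lt => /orP[ty|yt].
  + have : \forall n \near \oo, harmonic n * v + t < y by exact: (cvgr_lt t).
    apply: filterS => n hn; rewrite /I !indicE !mem_set//= in_itv/=; exact: ltW.
  + have : \forall n \near \oo, y < harmonic n * v + t by exact: (cvgr_gt t).
    apply: filterS => n hn; rewrite /I !indicE !memNset//= in_itv/= leNgt ?hn ?yt//.
- by move=> n v; exact: norm_Igauss.
Qed.

Let norm_J n t : `|J n t| <= Num.sqrt (2 * pi).
Proof.
have -> : Num.sqrt (2 * pi) = Int (gauss (1 : R)).
  by rewrite Int_gauss// sqrtr1 divr1.
apply: norm_int_le.
- exact: itg_gauss.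
- by apply: measurable_funM => //; exact: measurable_gauss.
- by move=> v; exact: norm_Igauss.
Qed.

Lemma Int_half_line_eq0 : Rintegral lebesgue_measure `]-oo, y] w = 0.
Proof.
rewrite Rintegral_mkcond.
have -> : w \_ `]-oo, y] = (fun t => w t * I t).
  apply/funext => t; rewrite patchE /I indicE; case: (_ \in _); by rewrite ?mulr1 ?mulr0.
have c : (fun n => Int (fun t => w t * J n t)) @ \oo -->
    Int (fun t => w t * (Num.sqrt (2 * pi) * I t)).
  apply: (@int_dominated_cvg _ _ _ (fun t => Num.sqrt (2 * pi) * `|w t|)).
  - by move=> n; have [+ _] := fubini_J n; exact: itg_measurable.
  - by apply: measurable_funM => //; exact: measurable_funM.
  - by apply: itgZ; exact: itg_norm.
  (* Convergence may fail only at the jump, a null set. *)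
  - exists [set y]; split => //; first exact: lebesgue_measure_set1.
    move=> t /= h; apply: contrapT => ty; apply: h.
    by apply: cvgM; [exact: cvg_cst|apply: cvg_J; exact/eqP].
  - by move=> n t; rewrite normrM mulrC ler_wpM2r.
have e : Int (fun t => w t * (Num.sqrt (2 * pi) * I t)) = 0.
  apply: (cvg_unique _ c) => //.
  by rewrite (funext (fun n => (fubini_J n).2)); exact: cvg_cst.
have iwI : Itg (fun t => w t * I t).
  by under eq_fun do rewrite mulrC; apply: (@itg_bounded _ _ _ 1).
move: e; under eq_fun do rewrite mulrCA.
rewrite intZ// => /eqP; rewrite mulf_eq0 gt_eqF ?sqrt2pi_gt0//= => /eqP.
by [].
Qed.

End real_case.

(* Integrating the centre [s] over a half-line turns the narrowing Gaussians into
   approximations of its indicator. *)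
Lemma ae_eq0_of_gauss (w : R -> R) : Itg w ->
  (forall a s, 0 < a -> Int (fun t => w t * gauss a (s - t)) = 0) ->
  ae_eq mu setT w (fun=> 0).
Proof.
move=> iw wg.
have iy y : mu.-integrable [set` `]-oo, y]] (EFin \o w).
  exact: (integrableS measurableT).
have lw : locally_integrable [set: R] w.
  by apply: open_integrable_locally => //; exact: openT.
(* Almost everywhere [w] is the derivative of its indefinite integral, which vanishes
   identically. *)
have := FTC1Ny iy lw.
apply: aeS => x [_ <-] _.
rewrite (_ : (fun y => _) = cst 0); first by rewrite derive1_cst.
by apply/funext => y; rewrite Int_half_line_eq0.
Qed.

End GaussianTotality.

(** * Fourier inversion and the Plancherel identity *)

Section Inversion.
Context {R : realType}.
Notation F := (@fourier_integral R).
Implicit Types f g x y z : R -> R[i].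

(** [w] is merely square-integrable; its product with [gauss 1] is integrable and still orthogonal
    to every translated Gaussian, as a product of two Gaussians is a multiple of a third. *)
Lemma L2_ae_eq0_of_gauss (w : R -> R[i]) : L2 setT w ->
  (forall a s, 0 < a -> cInt (fun t => w t * (gauss a (s - t))%:C%C) = 0) ->
  ae_eq mu setT w (fun=> 0).
Proof.
move=> w2 wg.
have i1 : L1 setT (fun t => w t * (gauss 1 t)%:C%C).
  apply: L2M => //; have := @L2_gauss_cis R 1 0 ltr01.
  by under eq_fun do rewrite mul0r cis0 mulr1.
(* Completion of the square: t^2 + a (s - t)^2 = (1 + a) (t - a s / (1 + a))^2 + a s^2 / (1 + a). *)
have prod (a s t : R) : 0 < a -> gauss 1 t * gauss a (s - t) =
    gauss (a / (1 + a)) s * gauss (1 + a) (a * s / (1 + a) - t).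
  move=> a0; rewrite /gauss -!expRD; congr expR; field.
  by rewrite gt_eqF// addr_gt0.
have wg1 (a s : R) : 0 < a ->
    cInt (fun t => w t * (gauss 1 t)%:C%C * (gauss a (s - t))%:C%C) = 0.
  move=> a0.
  have -> : (fun t => w t * (gauss 1 t)%:C%C * (gauss a (s - t))%:C%C) =
      (fun t => (gauss (a / (1 + a)) s)%:C%C *
         (w t * (gauss (1 + a) (a * s / (1 + a) - t))%:C%C)).
    by apply/funext => t; rewrite -mulrA real_complexM prod// -real_complexM mulrCA.
  have a10 : 0 < 1 + a by rewrite addr_gt0.
  rewrite cIntZ; first by rewrite wg// mulr0.
  apply: L2M => //; apply: (@L2_le _ _ (fun t => gauss (1 + a) (a * s / (1 + a) - t))).
  - apply: cmeasR; apply: (measurableT_comp (measurable_gauss _)).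
    exact: measurable_funB.
  - move=> t; rewrite normcR ger0_norm ?gauss_ge0//.
    by rewrite expr2 ler_piMr ?gauss_ge0// gauss_le1// ltW.
  - have := itg_affine (- (a * s / (1 + a))) ltr01 (itg_gauss a10).
    by under eq_fun do rewrite mul1r -gauss_even opprB.
have /L1P[iR iI] := i1.
have hR : ae_eq mu setT (fun t => Re (w t * (gauss 1 t)%:C%C)) (fun=> 0).
  apply: ae_eq0_of_gauss => // a s a0.
  have := congr1 (@Re R) (wg1 a s a0); rewrite ReInt => e; rewrite -[RHS]e.
  by congr Rintegral; apply/funext => t; rewrite [in RHS]cReM cReC cImC mulr0 subr0.
have hI : ae_eq mu setT (fun t => Im (w t * (gauss 1 t)%:C%C)) (fun=> 0).
  apply: ae_eq0_of_gauss => // a s a0.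
  have := congr1 (@Im R) (wg1 a s a0); rewrite ImInt => e; rewrite -[RHS]e.
  by congr Rintegral; apply/funext => t; rewrite [in RHS]cImM cReC cImC mulr0 add0r.
apply: aeS (aeI hR hI) => t [/(_ I) e1 /(_ I) e2] _.
have : w t * (gauss 1 t)%:C%C = 0 by exact: complexP.
move=> /eqP; rewrite mulf_eq0 => /orP[/eqP//|/eqP/(congr1 (@Re R))/= g0].
by have := expR_gt0 (- (1 / 2) * t ^+ 2); rewrite -/(gauss 1 t) g0 ltxx.
Qed.

Lemma ae_reflect (P : R -> Prop) : (\forall t \ae @mu R, P t) ->
  \forall t \ae @mu R, P (- t).
Proof.
move=> [N [mN N0 hN]]; exists (-%R @^-1` N); split.
- have mNeg : measurable_fun (setT : set R) (-%R) by [].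
  by rewrite -[X in measurable X]setTI; exact: mNeg.
- by have := lebesgue_measureN mN; rewrite /pushforward => ->.
- by move=> t h; apply: hN.
Qed.

Lemma cmeas_translate f (s : R) : cmeas f ->
  cmeas (fun t : R => f (t + s)).
Proof. by move=> mf; apply: cmeas_comp => //; exact: measurable_funD. Qed.

Lemma cInt_translate f (s : R) : cmeas f -> cInt f = cInt (fun t => f (t + s)).
Proof.
move=> [m1 m2]; apply: complexP; rewrite !(ReInt, ImInt).
- rewrite (Int_affine s ltr01 m1); congr Rintegral; apply/funext => t.
  by rewrite mul1r mulr1.
- rewrite (Int_affine s ltr01 m2); congr Rintegral; apply/funext => t.
  by rewrite mul1r mulr1.
Qed.

Lemma L1_translate f (s : R) : L1 setT f -> L1 setT (fun t => f (t + s)).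
Proof.
move=> /L1P[i1 i2]; apply/L1P; split.
- by have := itg_affine s ltr01 i1; under eq_fun do rewrite mul1r.
- by have := itg_affine s ltr01 i2; under eq_fun do rewrite mul1r.
Qed.

Lemma L2_translate f (s : R) : L2 setT f -> L2 setT (fun t => f (t + s)).
Proof.
move=> /L2P[mf fi]; apply/L2P; split; first exact: cmeas_translate.
by have := itg_affine s ltr01 fi; under eq_fun do rewrite mul1r.
Qed.

Lemma fourier_translate f (s xi : R) : L1 setT f ->
  F (fun t => f (t - s)) xi = cis (xi * s) * F f xi.
Proof.
move=> f1; rewrite !fourierE [RHS]mulrCA -(cIntZ _ (L1_cis xi f1)).
congr (_ * _); rewrite [RHS](@cInt_translate _ (- s)); last first.
  by apply: cmeasM; [exact: cmeas_cst|apply: L1_cmeas; exact: L1_cis].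
congr cintegral; apply/funext => t.
rewrite mulrCA; congr (_ * _).
by rewrite -cisD; congr cis; ring.
Qed.

Lemma gaussC (a : R) : (fun t => (gauss a t)%:C%C) =
  (fun t => (gauss a t)%:C%C * cis (0 * t)).
Proof. by apply/funext => t; rewrite mul0r cis0 mulr1. Qed.

Let gauss_shift (a s : R) : (fun t => (gauss a (s - t))%:C%C) =
  (fun t => (gauss a (t - s))%:C%C).
Proof. by apply/funext => t; rewrite -gauss_even opprB. Qed.

Let L1_gauss_shift (a s : R) : 0 < a -> L1 setT (fun t => (gauss a (s - t))%:C%C).
Proof.
move=> a0; rewrite gauss_shift; apply: (@L1_translate (fun t => (gauss a t)%:C%C)).
by rewrite gaussC; exact: L1_gauss_cis.
Qed.

Let L2_gauss_shift (a s : R) : 0 < a -> L2 setT (fun t => (gauss a (s - t))%:C%C).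
Proof.
move=> a0; rewrite gauss_shift; apply: (@L2_translate (fun t => (gauss a t)%:C%C)).
by rewrite gaussC; exact: L2_gauss_cis.
Qed.

Let fourier_gauss_shift (a s xi : R) : 0 < a ->
  F (fun t => (gauss a (s - t))%:C%C) xi =
  ((Num.sqrt a)^-1)%:C%C * ((gauss a^-1 xi)%:C%C * cis (s * xi)).
Proof.
move=> a0; rewrite gauss_shift (@fourier_translate (fun t => (gauss a t)%:C%C)).
  by rewrite gaussC fourier_gauss// add0r -real_complexM [xi * s]mulrC; ring.
by rewrite gaussC; exact: L1_gauss_cis.
Qed.

(** Let [z] be the image of [y]. The transform of a translated Gaussian is a Gaussian times a
    character, and transforming again gives the reflected translate. Two uses of duality therefore
    show that [z] and the reflection of [x] have the same pairings with all translated Gaussians. *)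
Lemma weak_fourier_inversion x y : weak_fourier x y ->
  weak_fourier y (fun t => x (- t)).
Proof.
move=> W; have [x2 y2 hxy] := W.
have [z Wz] := weak_fourier_exists y2; have [_ z2 hyz] := Wz.
apply: (weak_fourier_ae_eq Wz); first by apply: cmeas_reflect; exact: L2_cmeas.
have xr2 := L2_reflect x2.
have d2 : L2 setT (fun t => z t - x (- t)) by exact: L2B.
apply: aeS (L2_ae_eq0_of_gauss d2 _) => [t /(_ I) /eqP|a s a0].
  by rewrite subr_eq0 => /eqP.
have g1 := L1_gauss_shift s a0; have g2 := L2_gauss_shift s a0.
have ai0 : 0 < a^-1 by rewrite invr_gt0.
have h1 := L1_gauss_cis s ai0; have h2 := L2_gauss_cis s ai0.
have e1 : cInt (fun t => z t * (gauss a (s - t))%:C%C) =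
    ((Num.sqrt a)^-1)%:C%C * cInt (fun t => y t * ((gauss a^-1 t)%:C%C * cis (s * t))).
  rewrite hyz// -cIntZ; last exact: L2M.
  congr cintegral; apply/funext => t.
  by rewrite fourier_gauss_shift// mulrCA.
have [Fh2 _] := fourier_contraction h1 h2.
have e2 : cInt (fun t => z t * (gauss a (s - t))%:C%C) =
    cInt (fun t => x t * (gauss a (s + t))%:C%C).
  rewrite e1 hxy// -(cIntZ _ (L2M x2 Fh2)).
  congr cintegral; apply/funext => t.
  rewrite fourier_gauss// mulrCA real_complexM invrK sqrtrV ?ltW// invrK mulKf//.
  by rewrite gt_eqF// sqrtr_gt0.
have e3 : cInt (fun t => x t * (gauss a (s + t))%:C%C) =
    cInt (fun t => x (- t) * (gauss a (s - t))%:C%C).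
  rewrite cInt_reflect; first by [].
  apply: cmeasM; first exact: L2_cmeas.
  apply: cmeasR; apply: (measurableT_comp (measurable_gauss _)).
  exact: measurable_funD.
under eq_fun do rewrite mulrBl.
rewrite cIntB; [|exact: L2M|exact: L2M].
by rewrite e2 e3 subrr.
Qed.

(** Contraction from [x] to [y], and from [y] to the reflection of [x], gives both inequalities. *)
Lemma weak_fourier_N2 x y : weak_fourier x y -> N2 y = N2 x.
Proof.
move=> W; have [x2 _ _] := W; apply/le_anti.
rewrite (weak_fourier_contraction W)/= -(N2_reflect x2).
exact: (weak_fourier_contraction (weak_fourier_inversion W)).
Qed.

Lemma weak_fourier_inj x x' y : weak_fourier x y -> weak_fourier x' y ->
  ae_eq mu setT x x'.
Proof.
move=> W W'.
have := ae_reflect (weak_fourier_uniq (weak_fourier_inversion W) (weak_fourier_inversion W')).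
by apply: aeS => t /= /(_ I); rewrite opprK.
Qed.

(** If [x] is the image of the reflection of [y], inversion makes [y] the image of [x]. *)
Lemma weak_fourier_surj y : L2 setT y -> exists x, weak_fourier x y.
Proof.
move=> /L2_reflect/weak_fourier_exists[x /weak_fourier_inversion W].
exists x; suff <- : (fun t => y (- - t)) = y by [].
by apply/funext => t; rewrite opprK.
Qed.

End Inversion.

(** * The inverse Mellin transform as a Fourier transform *)

Section MellinLift.
Context {R : realType}.
Notation F := (@fourier_integral R).
Implicit Types f g x y X : R -> R[i].

(* The substitution [t = exp (- u)] carries [L2 (0, +oo)] onto [L2 R] and the
   inverse Mellin transform to the Fourier operator. *)
Definition lift (x : R -> R[i]) (u : R) : R[i] :=
  (Num.sqrt (2 * pi) * expR (- u / 2))%:C%C * x (expR (- u)).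

Definition unlift (X : R -> R[i]) (t : R) : R[i] :=
  ((Num.sqrt (2 * pi))^-1 * expR (- ln t / 2))%:C%C * X (- ln t).

Lemma unliftK X u : lift (unlift X) u = X u.
Proof.
rewrite /lift /unlift mulrA real_complexM expRK opprK.
rewrite mulrACA divff ?gt_eqF ?sqrt2pi_gt0// mul1r -expRD.
by rewrite -mulrDl addNr mul0r expR0 mul1r.
Qed.

Lemma liftK x t : 0 < t -> unlift (lift x) t = x t.
Proof.
move=> t0; rewrite /lift /unlift mulrA real_complexM !opprK lnK ?posrE//.
rewrite mulrACA mulVf ?gt_eqF ?sqrt2pi_gt0// mul1r -expRD.
by rewrite -mulrDl addNr mul0r expR0 mul1r.
Qed.

Lemma measurable_unlift X : cmeas X -> cmeasurable (positive_axis R) (unlift X).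
Proof.
move=> mX; have mln : measurable_fun setT (fun t : R => - ln t).
  by apply: measurableT_comp => //; exact: measurable_ln.
have [h1 h2] : cmeas (unlift X).
  apply: cmeasM; last exact: (cmeas_comp mln mX).
  apply: cmeasR; apply: measurable_funM => //.
  apply: (measurableT_comp (@measurable_expR R)).
  exact: measurable_funM.
by split; exact: measurable_funTS.
Qed.

Let mexpN : measurable_fun setT (fun u : R => expR (- u)).
Proof. by apply: (measurableT_comp (@measurable_expR R)). Qed.

Let mcomp (h : R -> R) : measurable_fun (positive_axis R) h ->
  measurable_fun setT (fun u : R => h (expR (- u))).
Proof.
move=> mh; have mD : measurable (positive_axis R) by exact: measurable_itv.
have m : measurable_fun setT (h \_ (positive_axis R)).
  by apply: (measurable_restrictT h mD).1.
rewrite (_ : (fun u => _) = (h \_ (positive_axis R)) \o (fun u => expR (- u))).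
  exact: measurableT_comp.
apply/funext => u /=; rewrite patchE mem_set// /positive_axis/= in_itv/=.
by rewrite expR_gt0.
Qed.

Lemma cmeas_lift x : cmeasurable (positive_axis R) x -> cmeas (lift x).
Proof.
move=> [m1 m2]; apply: cmeasM.
  apply: cmeasR; apply: measurable_funM => //.
  apply: (measurableT_comp (@measurable_expR R)).
  exact: measurable_funM.
by split; [exact: mcomp m1|exact: mcomp m2].
Qed.

Lemma sqr_normc_lift x u :
  normc (lift x u) ^+ 2 = 2 * pi * (normc (x (expR (- u))) ^+ 2 * expR (- u)).
Proof.
rewrite /lift normcM normcR ger0_norm ?mulr_ge0 ?expR_ge0 ?sqrtr_ge0//.
rewrite !exprMn sqr_sqrtr ?mulr_ge0 ?pi_ge0//.
rewrite -[expR (- u / 2) ^+ 2]expRM_natl (_ : 2%:R * (- u / 2) = - u); last by field.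
by ring.
Qed.

Lemma integral_positive_axis (h : R -> R) : measurable_fun (positive_axis R) h ->
  (\int[@lebesgue_measure R]_(t in positive_axis R) (h t)%:E =
   \int[@lebesgue_measure R]_u (h (expR (- u)) * expR (- u))%:E)%E.
Proof.
move=> mh; rewrite integral_expR//.
have mD : measurable (positive_axis R) by exact: measurable_itv.
have m : measurable_fun setT (fun u : R => h (expR (- u)) * expR (- u)).
  by apply: measurable_funM => //; exact: mcomp.
rewrite [RHS]integral_reflect//; apply: eq_integral => u _.
by rewrite opprK.
Qed.

Lemma sqnorm2_lift x : cmeasurable (positive_axis R) x ->
  sqnorm2 (positive_axis R) x = ((2 * pi)^-1%:E * sqnorm2 setT (lift x))%E.
Proof.
move=> mx; rewrite /sqnorm2 -ge0_integralZl_EFin//.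
- rewrite (@integral_positive_axis (fun t => normc (x t) ^+ 2)).
    apply: eq_integral => u _; rewrite -EFinM sqr_normc_lift mulKf//.
    by rewrite mulf_neq0// gt_eqF// pi_gt0.
  have [m1 m2] := mx.
  rewrite (_ : (fun t => _) = (fun t => Re (x t) ^+ 2 + Im (x t) ^+ 2)).
    by apply: measurable_funD; exact: measurable_funX.
  by apply/funext => t; rewrite sqr_normc.
- by move=> u _; rewrite lee_fin sqr_ge0.
- by apply/measurable_EFinP; apply: measurable_normc2; exact: cmeas_lift.
- by rewrite invr_ge0 mulr_ge0// pi_ge0.
Qed.

Lemma L2_lift x : L2 (positive_axis R) x -> L2 setT (lift x).
Proof.
move=> [mx x2]; split; first exact: cmeas_lift.
move: x2; rewrite sqnorm2_lift//.
have p0 : 0 < (2 * pi)^-1 :> R by rewrite invr_gt0 mulr_gt0// pi_gt0.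
have s0 : (0 <= sqnorm2 setT (lift x))%E.
  by apply: integral_ge0 => u _; rewrite lee_fin sqr_ge0.
move: s0; case: (sqnorm2 setT (lift x)) => //.
- by move=> r _ _; exact: ltry.
- by rewrite gt0_muley// lte_fin.
Qed.

Lemma L2_unlift X : L2 setT X -> L2 (positive_axis R) (unlift X).
Proof.
move=> X2; have mX := measurable_unlift (L2_cmeas X2); split => //.
rewrite sqnorm2_lift// (_ : lift (unlift X) = X); last exact/funext/unliftK.
by rewrite L2_sqnorm2// -EFinM ltry.
Qed.

(** For t = exp (- u), the power t^(-(1/2 + i eta)) is exp (u / 2) [cis (u * eta)]; the factor
    [sqrt (2 * pi)] in [lift] absorbs the discrepancy between the normalisations 1 / (2 pi) and 1 /
    sqrt (2 pi). *)
Lemma inverse_mellin_integralE f t : L1 setT f -> 0 < t ->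
  inverse_mellin_integral f t = unlift (F f) t.
Proof.
move=> f1 t0; rewrite /inverse_mellin_integral /unlift fourierE.
have -> : (fun eta => f eta * cpow t (- (2^-1 +i* eta)%C)) =
    (fun eta => (expR (- ln t / 2))%:C%C * (f eta * cis (- ln t * eta))).
  apply/funext => eta; rewrite /cpow cexpM_real /= mulrCA; congr (_ * _).
    by congr (expR _)%:C%C; field.
  by congr (_ * cis _); ring.
rewrite cIntZ; last exact: L1_cis.
rewrite /fourier_factor !mulrA !real_complexM; congr (_ %:C%C * _).
rewrite [in RHS]mulrAC -invfM -expr2 sqr_sqrtr ?mulr_ge0 ?pi_ge0//.
Qed.

Lemma sqnorm2_ext (D : set R) f g : {in D, f =1 g} -> sqnorm2 D f = sqnorm2 D g.
Proof. by move=> fg; apply: eq_integral => t tD; rewrite fg. Qed.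

(** The same approximating sequences serve both operators: by [key] the two squared errors are
    proportional. *)
Lemma inverse_mellinE phi x :
  inverse_mellin phi x <-> L2 (positive_axis R) x /\ weak_fourier phi (lift x).
Proof.
have key u : L1 setT u -> L2 setT u -> L2 (positive_axis R) x ->
    L2 setT (fun t => F u t - lift x t) /\
    sqnorm2 (positive_axis R) (fun t => inverse_mellin_integral u t - x t) =
    ((2 * pi)^-1%:E * sqnorm2 setT (fun t => (F u t - lift x t)%R))%E.
  move=> u1 u2 x2; have [Fu2 _] := fourier_contraction u1 u2.
  have Fl2 : L2 setT (fun t => F u t - lift x t) by exact: (L2B Fu2 (L2_lift x2)).
  split => //.
  rewrite (@sqnorm2_ext _ _ (unlift (fun t => F u t - lift x t))); last first.
    move=> t /set_mem; rewrite /positive_axis /= in_itv/= andbT => t0.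
    by rewrite inverse_mellin_integralE// -[x t]liftK// /unlift -mulrBr.
  rewrite sqnorm2_lift; last exact: measurable_unlift (L2_cmeas Fl2).
  by congr (_ * sqnorm2 _ _)%E; apply/funext => t; rewrite unliftK.
have c0 : 0 < (2 * pi)^-1 :> R by rewrite invr_gt0 mulr_gt0// pi_gt0.
split.
- move=> [phi2 x2 [u [u12 up ux]]]; split => //; apply/weak_fourierE.
  split => //; first exact: L2_lift.
  exists u; split => //.
  have k n := key (u n) (u12 n).1 (u12 n).2 x2.
  apply/(sqnorm2_cvg0 (fun n => (k n).1)).
  have e1 : (fun n => sqnorm2 (positive_axis R)
      (fun t => inverse_mellin_integral (u n) t - x t)) =
      (fun n => ((2 * pi)^-1 * N2 (fun t => F (u n) t - lift x t))%:E).
    by apply/funext => n; rewrite (k n).2 (L2_sqnorm2 (k n).1).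
  rewrite e1 in ux; have h := fine_cvg ux.
  have -> : (fun n => N2 (fun t => F (u n) t - lift x t)) =
      (fun n => 2 * pi * ((2 * pi)^-1 * N2 (fun t => F (u n) t - lift x t))).
    by apply/funext => n; rewrite mulVKf// -invr_eq0 gt_eqF.
  rewrite -[X in _ --> X](mulr0 (2 * pi)).
  by apply: cvgM; [exact: cvg_cst|exact: h].
- move=> [x2 /weak_fourierE[phi2 _ [u [u12 up ux]]]].
  split => //; exists u; split => //.
  have k n := key (u n) (u12 n).1 (u12 n).2 x2.
  have {}ux := (sqnorm2_cvg0 (fun n => (k n).1)).1 ux.
  have -> : (fun n => sqnorm2 (positive_axis R)
      (fun t => inverse_mellin_integral (u n) t - x t)) =
      (fun n => ((2 * pi)^-1 * N2 (fun t => F (u n) t - lift x t))%:E).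
    by apply/funext => n; rewrite (k n).2 (L2_sqnorm2 (k n).1).
  apply: cvg_EFin; first exact: nearW.
  rewrite -[X in _ --> X](mulr0 (2 * pi)^-1).
  by apply: cvgM; [exact: cvg_cst|exact: ux].
Qed.

End MellinLift.

(** * The Gamma function on vertical lines *)

Section GammaNonvanishing.
Context {R : realType}.

Lemma itg_expR_norm (c : R) : 0 < c -> Itg (fun v => expR (- c * `|v|)).
Proof.
move=> c0.
have cf : continuous (fun v : R => expR (- c * `|v|)).
  move=> v; apply: continuous_comp; last exact: continuous_expR.
  by apply: cvgM; [exact: cvg_cst|exact: norm_continuous].
have dF (x : R) : is_derive x (1 : R) (fun x => - c^-1 * expR (- c * x)) (expR (- c * x)).
  have := is_deriveM_real (is_derive_cst (- c^-1) x (1 : R))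
    (is_derive_expR_comp (is_derive_scale (- c) x)).
  by congr is_derive; rewrite /= mulr0 addr0; field; rewrite gt_eqF.
have cF := is_derive_continuous dF.
apply: itgP; first exact: continuous_measurable_fun.
under eq_integral do rewrite ger0_norm ?expR_ge0//.
rewrite ge0_symfun_integralT//.
- rewrite (_ : [set x | _] = `[0, +oo[%classic); last first.
    by apply/seteqP; split => x /=; rewrite in_itv/= andbT.
  rewrite (@ge0_continuous_FTC2y _ _ (fun x => - c^-1 * expR (- c * x)) _ 0).
  + by rewrite -EFinB -EFinM ltry.
  + by move=> x _; exact: expR_ge0.
  + exact: continuous_subspaceT.
  + rewrite -[X in _ --> X](mulr0 (- c^-1)); apply: cvgM; first exact: cvg_cst.
    under eq_fun do rewrite mulNr.
    have h : c * x @[x --> +oo] --> +oo by apply: gt0_cvgMry => //; exact: cvg_id.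
    exact: (cvg_comp _ _ h (@cvgr_expR R)).
  + by move=> x _; have [] := dF x.
  + by apply: cvg_at_right_filter; exact: cF.
  + move=> x; rewrite in_itv/= andbT => x0.
    by rewrite derive1E; have [_ ->] := dF x; rewrite gtr0_norm.
- by move=> x /=; rewrite normrN.
Qed.

(** The integrand of Euler's integral for Gamma (s) after the substitution t = exp v. *)
Definition eg (s v : R) : R := expR (s * v - expR v).

Lemma eg_ge0 s v : 0 <= eg s v. Proof. exact: expR_ge0. Qed.

Lemma is_derive_eg s v : is_derive v (1 : R) (eg s) (s * eg s v - eg (s + 1) v).
Proof.
have d : is_derive v (1 : R) (fun v => s * v - expR v) (s - expR v).
  have := is_deriveB (is_derive_scale s v) (is_derive_expR v); exact.
have := is_derive_expR_comp d.
rewrite -/(eg s v) mulrBr [eg s v * s]mulrC; congr is_derive; congr (_ - _).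
by rewrite /eg -expRD; congr expR; ring.
Qed.

Lemma continuous_eg s : continuous (eg s).
Proof. exact: is_derive_continuous (is_derive_eg s). Qed.

Lemma measurable_eg s : measurable_fun setT (eg s).
Proof. by apply: continuous_measurable_fun; exact: continuous_eg. Qed.

(** For v >= 0, the concave function k v - exp v stays below its maximum k (ln k - 1), reached at ln
    k, and k = 2 s leaves the decay exp (- s v). For v < 0 the bound holds with constant 1. *)
Lemma eg_le s : 0 < s -> exists C, forall v, eg s v <= C * expR (- s * `|v|).
Proof.
move=> s0; pose k := 2 * s; have k0 : 0 < k by rewrite mulr_gt0.
exists (1 + expR (k * (ln k - 1))) => v; rewrite mulrDl mul1r /eg.
have [v0|v0] := leP 0 v.
  apply: ler_wpDl; first exact: expR_ge0.
  rewrite -expRD ler_expR.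
  have := expR_ge1Dx (v - ln k); rewrite expRB lnK ?posrE// ler_pdivlMr//.
  by rewrite (ger0_norm v0) /k; lra.
apply: ler_wpDr; first by rewrite mulr_ge0 ?expR_ge0.
rewrite ler_expR (ltr0_norm v0) mulrNN.
by have := expR_gt0 v; lra.
Qed.

Lemma itg_eg s : 0 < s -> Itg (eg s).
Proof.
move=> s0; have [C hC] := eg_le s0.
apply: (itg_le (@measurable_eg s) _ (itgZ C (itg_expR_norm s0))) => v.
by rewrite ger0_norm ?eg_ge0.
Qed.

(** The weaker decay in the form that [Int_derivative_eq0] takes. *)
Lemma eg_decay s : 0 < s -> exists C, forall v, eg s v <= C / (1 + `|v|).
Proof.
move=> s0; have [C hC] := eg_le s0.
exists (C * (1 + s^-1)) => v; apply: le_trans (hC v) _.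
have C0 : 0 <= C.
  by have := le_trans (eg_ge0 s 0) (hC 0); rewrite normr0 mulr0 expR0 mulr1.
have v1 : 0 < 1 + `|v| by rewrite ltr_pwDl.
rewrite -mulrA ler_wpM2l// ler_pdivlMr// mulNr expRN ler_pdivrMl ?expR_gt0//.
apply: le_trans (_ : (1 + s * `|v|) * (1 + s^-1) <= _); last first.
  by rewrite ler_wpM2r ?expR_ge1Dx// addr_ge0// invr_ge0 ltW.
have -> : (1 + s * `|v|) * (1 + s^-1) = 1 + `|v| + (s^-1 + s * `|v|).
  by field; rewrite gt_eqF.
by rewrite lerDl addr_ge0 ?mulr_ge0 ?invr_ge0// ltW.
Qed.

Definition egc s t := Int (fun v => eg s v * cos (t * v)).
Definition egs s t := Int (fun v => eg s v * sin (t * v)).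

(** Real part of Gamma (z + 1) = z Gamma (z) at z = s + i t, by integrating the derivative of
    [eg s v * cos (t * v)]; [egsS] is the imaginary part. *)
Lemma egcS s t : 0 < s -> egc (s + 1) t = s * egc s t - t * egs s t.
Proof.
move=> s0; have i0 := itg_eg s0; have i1 := itg_eg (addr_gt0 s0 ltr01).
have [C hC] := eg_decay s0.
have d v : is_derive v (1 : R) (fun v => eg s v * cos (t * v))
   (s * (eg s v * cos (t * v)) - eg (s + 1) v * cos (t * v) - t * (eg s v * sin (t * v))).
  have := is_deriveM_real (is_derive_eg s v) (is_derive_cos_comp (is_derive_scale t v)).
  by congr is_derive; ring.
have c0 := itgM_cos t i0; have c1 := itgM_cos t i1; have s0' := itgM_sin t i0.
have sc := itgZ s c0; have ts := itgZ t s0'; have scc := itgB sc c1.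
have := Int_derivative_eq0 d _ _ (C := C).
rewrite !intB// !intZ// -/(egc s t) -/(egc (s + 1) t) -/(egs s t) => e.
suff /eqP : s * egc s t - egc (s + 1) t - t * egs s t = 0.
  by rewrite addrAC subr_eq0 => /eqP <-.
apply: e.
- have cg r : continuous (eg r) := @continuous_eg r.
  have cc := is_derive_continuous (fun x => is_derive_cos_comp (is_derive_scale t x)).
  have cs := is_derive_continuous (fun x => is_derive_sin_comp (is_derive_scale t x)).
  move=> x; apply: cvgB; first apply: cvgB.
  + by apply: cvgM; [exact: cvg_cst|apply: cvgM; [exact: cg|exact: cc]].
  + by apply: cvgM; [exact: cg|exact: cc].
  + by apply: cvgM; [exact: cvg_cst|apply: cvgM; [exact: cg|exact: cs]].
- exact: itgB.
- move=> v; apply: le_trans (hC v).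
  by rewrite normrM ger0_norm ?eg_ge0// ler_piMr ?eg_ge0// ler_norml cos_geN1 cos_le1.
Qed.

Lemma egsS s t : 0 < s -> egs (s + 1) t = s * egs s t + t * egc s t.
Proof.
move=> s0; have i0 := itg_eg s0; have i1 := itg_eg (addr_gt0 s0 ltr01).
have [C hC] := eg_decay s0.
have d v : is_derive v (1 : R) (fun v => eg s v * sin (t * v))
   (s * (eg s v * sin (t * v)) - eg (s + 1) v * sin (t * v) + t * (eg s v * cos (t * v))).
  have := is_deriveM_real (is_derive_eg s v) (is_derive_sin_comp (is_derive_scale t v)).
  by congr is_derive; ring.
have c0 := itgM_sin t i0; have c1 := itgM_sin t i1; have s0' := itgM_cos t i0.
have sc := itgZ s c0; have ts := itgZ t s0'; have scc := itgB sc c1.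
have := Int_derivative_eq0 d _ _ (C := C).
rewrite intD// intB// !intZ// -/(egs s t) -/(egs (s + 1) t) -/(egc s t) => e.
suff /eqP : s * egs s t - egs (s + 1) t + t * egc s t = 0.
  by rewrite addrAC subr_eq0 => /eqP <-.
apply: e.
- have cg r : continuous (eg r) := @continuous_eg r.
  have cc := is_derive_continuous (fun x => is_derive_cos_comp (is_derive_scale t x)).
  have cs := is_derive_continuous (fun x => is_derive_sin_comp (is_derive_scale t x)).
  move=> x; apply: cvgD; first apply: cvgB.
  + by apply: cvgM; [exact: cvg_cst|apply: cvgM; [exact: cg|exact: cs]].
  + by apply: cvgM; [exact: cg|exact: cs].
  + by apply: cvgM; [exact: cvg_cst|apply: cvgM; [exact: cg|exact: cc]].
- exact: itgD.
- move=> v; apply: le_trans (hC v).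
  by rewrite normrM ger0_norm ?eg_ge0// ler_piMr ?eg_ge0// ler_norml sin_geN1 sin_le1.
Qed.

Lemma Int_egS s : 0 < s -> Int (eg (s + 1)) = s * Int (eg s).
Proof.
have e r : Int (eg r) = egc r 0.
  by congr Rintegral; apply/funext => v; rewrite mul0r cos0 mulr1.
by move=> s0; rewrite !e egcS// mul0r subr0.
Qed.

Lemma Int_eg_gt0 s : 0 < s -> 0 < Int (eg s).
Proof.
(* On [0, 1] the exponent s v - exp v is at least - exp 1. *)
move=> s0; pose c := expR (- expR 1 : R).
have mI : measurable_fun setT (\1_(`[0, 1]%classic : set R) : R -> R).
  by apply: measurable_indic; exact: measurable_itv.
have iI : Itg (\1_(`[0, 1]%classic : set R)) by exact: integrable_indic_itv.
apply: (@lt_le_trans _ _ (Int (fun v => c * \1_(`[0, 1]%classic : set R) v))).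
  rewrite intZ// mulr_gt0 ?expR_gt0// /Rintegral.
  have m1 : lebesgue_measure (`[0, 1]%classic : set R) = 1%:E.
    by rewrite lebesgue_measure_itv/= lte_fin ltr01 sube0.
  rewrite integral_indic// setIT.
  by have -> : fine (lebesgue_measure (`[0, 1]%classic : set R)) = 1 by rewrite m1.
apply: int_le; [exact: itgZ|exact: itg_eg|move=> v].
rewrite indicE; case: (boolP (v \in _)); last by rewrite mulr0 eg_ge0.
rewrite inE/= in_itv/= => /andP[v0 v1]; rewrite mulr1 ler_expR.
have : expR v <= expR 1 by rewrite ler_expR.
have : 0 <= s * v by rewrite mulr_ge0// ltW.
by lra.
Qed.

Lemma norm_sin_le (x : R) : `|sin x| <= `|x|.
Proof.
wlog x0 : x / 0 <= x.
  move=> H; have [/H//|/ltW x0] := leP 0 x.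
  by rewrite -normrN -sinN -[`|x|]normrN H// oppr_ge0.
have [c _] : exists2 c, c \in `[0, x] & sin x - sin 0 = cos c * (x - 0).
  apply: MVT_segment => //.
  by apply: continuous_subspaceT => y; exact: continuous_sin.
rewrite sin0 !subr0 => ->; rewrite normrM ler_piMl//.
by rewrite ler_norml cos_geN1 cos_le1.
Qed.

Lemma cos_ge_quad (x : R) : 1 - x ^+ 2 / 2 <= cos x.
Proof.
have e : cos x = 1 - 2 * sin (x / 2) ^+ 2.
  have := cos2Dsin2 (x / 2); have := cos_mulr2n (x / 2).
  rewrite (_ : (x / 2) *+ 2 = x); last by rewrite -mulr_natr divfK.
  by move=> -> h; rewrite mulr2n; lra.
rewrite e; have h := norm_sin_le (x / 2).
have : sin (x / 2) ^+ 2 <= (x / 2) ^+ 2.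
  by rewrite -[leLHS]real_normK ?num_real// -[leRHS]real_normK ?num_real// ler_pXn2r.
by rewrite expr_div_n; lra.
Qed.

(* The right-hand side is a combination of exponentials whose integrals against
   [eg] are explicit. *)
Lemma cos_ge_cosh (t w : R) :
  1 - (t ^+ 2 + 4) * (expR w - 2 + expR (- w)) <= cos (t * w).
Proof.
have H : w ^+ 2 / (1 + `|w|) <= expR w - 2 + expR (- w).
  wlog w0 : w / 0 <= w.
    move=> H; have [/H//|/ltW w0] := leP 0 w.
    have := H (- w); rewrite oppr_ge0 => /(_ w0).
    by rewrite sqrrN normrN opprK; lra.
  rewrite ger0_norm// ler_pdivrMr ?ltr_pwDl// expRN.
  have e1 := expR_ge1Dx w; set E := expR w in e1 *.
  have E0 : 0 < E by lra.
  (* Each factor is bounded below separately: E - 1 >= w and (E - 1) / E >= w / (1 + w). *)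
  have -> : E - 2 + E^-1 = (E - 1) * ((E - 1) / E) by field; rewrite gt_eqF.
  apply: (@le_trans _ _ (w * (w / (1 + w)) * (1 + w))).
    by rewrite -mulrA divfK ?expr2// gt_eqF// ltr_pwDl.
  rewrite ler_wpM2r ?addr_ge0//; apply: ler_pM => //; [by rewrite divr_ge0// addr_ge0|lra|].
  rewrite ler_pdivrMr ?ltr_pwDl// mulrAC ler_pdivlMr//; nra.
set K := expR w - 2 + expR (- w) in H *.
have n0 : 0 < 1 + `|w| by rewrite ltr_pwDl.
rewrite ler_pdivrMr// in H.
have K0 : 0 <= K.
  by rewrite -(pmulr_lge0 _ n0); apply: le_trans H; exact: sqr_ge0.
(* For |w| <= 1, [H] gives w^2 <= 2 K and the quadratic lower bound for the cosine suffices. *)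
have [w1|w1] := leP `|w| 1.
  have w2 : w ^+ 2 <= 2 * K.
    by apply: le_trans H _; rewrite mulrC ler_wpM2r//; lra.
  apply: le_trans (cos_ge_quad (t * w)).
  rewrite exprMn; have t0 := sqr_ge0 t; nra.
(* For |w| > 1, [H] gives K >= 1/2, so the left-hand side is at most -1. *)
have : 2 <= 4 * K.
  move: H; rewrite -[w ^+ 2]real_normK ?num_real// => H.
  have : `|w| ^+ 2 <= K * (2 * `|w|) by apply: le_trans H _; rewrite ler_wpM2l//; lra.
  rewrite expr2 mulrA ler_pM2r; last by lra.
  by lra.
have t0 : 0 <= t ^+ 2 * K by rewrite mulr_ge0 ?sqr_ge0.
by have := cos_geN1 (t * w); lra.
Qed.

(* The integral is [Gamma (s + i t)]. Its functional equation propagates a zero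
   from [s] to [s + n], but for large [n] the weight [eg (s + n)] concentrates at
   its mode, so that the integral of [cos (t (v - mode))] is positive. *)
Lemma eg_nonvanishing s t : 0 < s -> ~ (egc s t = 0 /\ egs s t = 0).
Proof.
move=> s0 [c0 s00].
have step n : egc (s + n%:R) t = 0 /\ egs (s + n%:R) t = 0.
  elim: n => [|n [IH1 IH2]]; first by rewrite addr0.
  have sn : 0 < s + n%:R by rewrite ltr_pwDl.
  by rewrite -natr1 addrA (egcS _ sn) (egsS _ sn) IH1 IH2 !mulr0 subr0 addr0.
pose k := t ^+ 2 + 4.
have k0 : 0 < k by rewrite ltr_wpDl// sqr_ge0.
(* Chosen so that N = s + n - 1 exceeds k, which decides the sign at the end. *)
pose n := (Num.truncn (k + 1)).+1.
have nk : k + 1 < n%:R by exact: truncnS_gt.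
pose N := s + n%:R - 1.
have N0 : 0 < N by rewrite /N; lra.
have Nk : k < N by rewrite /N; lra.
have [hc hs] := step n.
have EN : s + n%:R = N + 1 by rewrite /N; ring.
rewrite EN in hc hs.
have N1 : 0 < N + 1 by rewrite addr_gt0.
have iN := itg_eg N0; have iN1 := itg_eg N1.
have iN2 := itg_eg (addr_gt0 N1 ltr01).
(* The mode of [eg (N + 1)] is ln (N + 1). Centring there multiplies the vanishing integral of
   [eg (N + 1) v * cis (t * v)] by a number of modulus 1. *)
pose w v := v - ln (N + 1).
have z : Int (fun v => eg (N + 1) v * cos (t * w v)) = 0.
  have -> : (fun v => eg (N + 1) v * cos (t * w v)) =
     (fun v => cos (t * ln (N + 1)) * (eg (N + 1) v * cos (t * v)) +
               sin (t * ln (N + 1)) * (eg (N + 1) v * sin (t * v))).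
    by apply/funext => v; rewrite /w mulrBr cosB; ring.
  have c1 := itgM_cos t iN1; have s1 := itgM_sin t iN1.
  rewrite intD; [|exact: itgZ|exact: itgZ].
  by rewrite !intZ// -/(egc _ _) -/(egs _ _) hc hs !mulr0 addr0.
(* The lower bound of [cos_ge_cosh] times [eg (N + 1) v]; multiplying the weight by exp (w v) or exp
   (- w v) shifts its parameter by 1 or -1. *)
pose P v := eg (N + 1) v - k * ((N + 1)^-1 * eg (N + 1 + 1) v -
  2 * eg (N + 1) v + (N + 1) * eg N v).
have iQ : Itg (fun v => (N + 1)^-1 * eg (N + 1 + 1) v -
  2 * eg (N + 1) v + (N + 1) * eg N v).
  by apply: itgD; [apply: itgB|]; exact: itgZ.
have iP : Itg P by apply: itgB => //; exact: itgZ.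
have leP : Int P <= 0.
  rewrite -z; apply: int_le => //.
    have c1 := itgM_cos t iN1; have s1 := itgM_sin t iN1.
    apply: (itg_le _ _ iN1).
    - apply: measurable_funM; first exact: measurable_eg.
      apply: (@measurableT_comp _ _ _ _ _ _ (@cos R)).
        by apply: continuous_measurable_fun; exact: continuous_cos.
      by apply: measurable_funM => //; exact: measurable_funB.
    - move=> v; rewrite normrM ger0_norm ?eg_ge0// ler_piMr ?eg_ge0//.
      by rewrite ler_norml cos_geN1 cos_le1.
  move=> v; have := cos_ge_cosh t (w v) => /(ler_wpM2l (eg_ge0 (N + 1) v)).
  apply: le_trans; rewrite /P -/k le_eqVlt; apply/orP; left; apply/eqP.
  have e1 : expR (w v) = expR v / (N + 1) by rewrite /w expRB lnK ?posrE.
  have e2 : expR (- w v) = (N + 1) / expR v by rewrite /w opprB expRB lnK ?posrE.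
  have e3 : eg (N + 1 + 1) v = eg (N + 1) v * expR v.
    by rewrite /eg -expRD; congr expR; ring.
  have e4 : eg (N + 1) v = eg N v * expR v.
    by rewrite /eg -expRD; congr expR; ring.
  rewrite e1 e2 e3 e4; field.
  by rewrite !gt_eqF ?expR_gt0.
have := Int_eg_gt0 N0; move: leP.
have -> : Int P = Int (eg (N + 1)) - k * ((N + 1)^-1 * Int (eg (N + 1 + 1)) -
    2 * Int (eg (N + 1)) + (N + 1) * Int (eg N)).
  rewrite -(intZ _ iN2) -(intZ 2 iN1) -(intZ (N + 1) iN).
  rewrite -(intB (itgZ _ iN2) (itgZ 2 iN1)) -intD; last first.
  - exact: (itgZ _ iN).
  - by apply: itgB; exact: itgZ.
  by rewrite -(intZ k iQ) -(intB iN1 (itgZ k iQ)).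
(* With M the integral of [eg N], those of the next two weights are N M and (N + 1) N M, so that
   [Int P] collapses to (N - k) M > 0. *)
rewrite (Int_egS N1) (Int_egS N0).
set M := Int (eg N).
have -> : N * M - k * ((N + 1)^-1 * ((N + 1) * (N * M)) - 2 * (N * M) + (N + 1) * M) =
   (N - k) * M by field; rewrite gt_eqF.
by move=> h M0; move: h; rewrite pmulr_lle0// subr_le0 leNgt Nk.
Qed.

End GammaNonvanishing.

(** * The Mellin kernel as a Fourier transform *)

Section MellinKernel.
Context {R : realType}.
Notation F := (@fourier_integral R).

(** Substitution t = exp v in Euler's integral, on real and imaginary parts separately. *)
Lemma cGammaE (s t : R) : cGamma (s +i* t)%C = (egc s t +i* egs s t)%C.
Proof.
have mD : measurable (positive_axis R) by exact: measurable_itv.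
pose f (x : R) : R[i] := ((expR ((s - 1) * ln x - x))%:C%C * cis (t * ln x)).
have mf : cmeas f.
  apply: cmeasM.
    apply: cmeasR; apply: (measurableT_comp (@measurable_expR R)).
    apply: measurable_funB; last exact: measurable_id.
    by apply: measurable_funM.
  by apply: cmeas_cis; apply: measurable_funM.
have fE (x : R) : cpow x (s +i* t - 1)%C * (expR (- x))%:C%C = f x.
  rewrite /cpow cexpM_real /= subr0 mulrAC real_complexM -expRD.
  by rewrite /f.
have e (v : R) : (f (expR v)) * (expR v)%:C%C = (eg s v)%:C%C * cis (t * v).
  rewrite /f expRK mulrAC real_complexM -expRD; congr ((expR _)%:C%C * _).
  by ring.
rewrite /cGamma /cintegral; congr (_ +i* _)%C.
- transitivity (Rintegral lebesgue_measure (positive_axis R) (fun x => Re (f x))).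
    by apply: eq_Rintegral => x _; rewrite fE.
  rewrite /Rintegral integral_expR; last by apply: measurable_funTS; case: mf.
  congr fine; apply: eq_integral => v _; congr EFin.
  have := congr1 (@Re R) (e v); rewrite !cReM !cReC !cImC mulr0 subr0 => ->.
  by rewrite mul0r subr0.
- transitivity (Rintegral lebesgue_measure (positive_axis R) (fun x => Im (f x))).
    by apply: eq_Rintegral => x _; rewrite fE.
  rewrite /Rintegral integral_expR; last by apply: measurable_funTS; case: mf.
  congr fine; apply: eq_integral => v _; congr EFin.
  have := congr1 (@Im R) (e v); rewrite !cImM !cReC !cImC mulr0 add0r => ->.
  by rewrite mul0r addr0.
Qed.

Lemma cGamma_neq0 (s t : R) : 0 < s -> cGamma (s +i* t)%C != 0.
Proof.
move=> s0; apply/eqP; rewrite cGammaE => -[e1 e2].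
exact: (eg_nonvanishing s0 (conj e1 e2)).
Qed.

Implicit Types al b u eta : R.

Definition mker al eta : R[i] :=
  cpow 2 (0 +i* (eta / 2))%C * cGamma (al +i* (eta / 2))%C.

Lemma cpow2_cis (eta : R) : cpow 2 (0 +i* (eta / 2))%C = cis (eta / 2 * ln 2).
Proof. by rewrite /cpow cexpM_real /= mul0r expR0 mul1r. Qed.

Lemma mker_neq0 al eta : 0 < al -> mker al eta != 0.
Proof.
move=> al0; rewrite mulf_neq0 ?cGamma_neq0// cpow2_cis.
by rewrite -normc_eq0 normc_cis oner_eq0.
Qed.

Lemma normc_mker al eta : normc (mker al eta) = normc (cGamma (al +i* (eta / 2))%C).
Proof. by rewrite normcM cpow2_cis normc_cis mul1r. Qed.

Lemma cInt_affine (c t : R) (f : R -> R[i]) : 0 < c -> cmeas f ->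
  cInt f = cInt (fun x => c%:C%C * f (c * x + t)).
Proof.
move=> c0 [m1 m2]; rewrite /cintegral (Int_affine t c0 m1) (Int_affine t c0 m2).
by congr (_ +i* _)%C; congr Rintegral; apply/funext => x;
  rewrite !ReImE mul0r ?subr0 ?addr0 mulrC.
Qed.

(* [h0 al u = exp (- 2 al u) exp (- exp (- 2 u) / 2)]; up to the factor
   [sqrt (2 pi)] it is the lift of [t ^ (2 al - 1/2) exp (- t ^ 2 / 2)]. *)
Definition h0 (al u : R) : R := expR (al * ln 2) * eg al (- 2 * u - ln 2).

Lemma itg_h0 al : 0 < al -> Itg (h0 al).
Proof.
move=> al0; apply: itgZ.
have i1 : Itg (fun x => eg al (2 * x + - ln 2)).
  by apply: (itg_affine (- ln 2) _ (itg_eg al0)).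
have -> : (fun u => eg al (- 2 * u - ln 2)) = (fun u => eg al (2 * (- u) + - ln 2)).
  by apply/funext => u; rewrite mulrN mulNr.
exact: (itg_reflect i1).
Qed.

Lemma h0_bounded al : 0 < al -> exists M, forall u, normc (h0 al u)%:C%C <= M.
Proof.
move=> al0; have [C hC] := eg_decay al0; exists (expR (al * ln 2) * C) => u.
rewrite normcR /h0 ger0_norm ?mulr_ge0 ?expR_ge0//.
rewrite ler_wpM2l ?expR_ge0//; apply: le_trans (hC _) _.
have C0 : 0 <= C.
  by have := le_trans (eg_ge0 al 0) (hC 0); rewrite normr0 addr0 divr1.
by rewrite ler_pdivrMr ?ltr_pwDl// ler_peMr// lerDl.
Qed.

Lemma L1_h0 al : 0 < al -> L1 setT (fun u => (h0 al u)%:C%C).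
Proof. by move=> al0; apply: L1R; exact: itg_h0. Qed.

Lemma bounded_L2 (f : R -> R[i]) (M : R) : L1 setT f -> (forall t, normc (f t) <= M) ->
  L2 setT f.
Proof.
move=> f1 fM; apply: (L2_le (L1_cmeas f1) _ (itgZ M (L1_itg f1))) => t.
by rewrite expr2 ler_wpM2r// normc_ge0.
Qed.

Lemma L2_h0 al : 0 < al -> L2 setT (fun u => (h0 al u)%:C%C).
Proof. by move=> al0; have [M hM] := h0_bounded al0; exact: (bounded_L2 (L1_h0 al0) hM). Qed.

Definition mfactor (al : R) : R[i] := fourier_factor * (expR (al * ln 2) / 2)%:C%C.

Lemma mfactor_neq0 al : mfactor al != 0.
Proof.
rewrite mulf_neq0// -normc_eq0 normcR normr_eq0 ?invr_eq0 ?mulf_neq0 ?gt_eqF ?sqrt2pi_gt0//.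
by rewrite ?expR_gt0// invr_gt0.
Qed.

Lemma cInt_eg_cis (al t : R) : cInt (fun v => (eg al v)%:C%C * cis (t * v)) =
  cGamma (al +i* t)%C.
Proof.
rewrite cGammaE; congr (_ +i* _)%C; congr Rintegral; apply/funext => v.
  by rewrite !ReImE mul0r subr0.
by rewrite !ReImE mul0r addr0.
Qed.

(** In the variable v = - 2 u - ln 2 the function [h0] becomes a multiple of [eg al]; the scale 2
    halves the frequency, and the shift by ln 2 yields the phase 2^(- i eta / 2) of
    [mker al (- eta)]. *)
Lemma fourier_h0 al eta : 0 < al ->
  F (fun u => (h0 al u)%:C%C) eta = mfactor al * mker al (- eta).
Proof.
move=> al0; rewrite fourierE /mfactor -mulrA; congr (_ * _).
have m0 : cmeas (fun v : R => (eg al v)%:C%C * cis (- eta / 2 * v)).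
  apply: cmeasM; first by apply: cmeasR; exact: measurable_eg.
  by apply: cmeas_cis; exact: measurable_scale.
pose K : R[i] := (expR (al * ln 2) / 2)%:C%C * cis (- eta / 2 * ln 2).
pose G (v : R) : R[i] := K * ((eg al v)%:C%C * cis (- eta / 2 * v)).
have mG : cmeas G by apply: cmeasM => //; exact: cmeas_cst.
rewrite cInt_reflect; last first.
  by have := L1_cmeas (L1_cis eta (L1_h0 al0)).
have -> : (fun t => (h0 al (- t))%:C%C * cis (eta * - t)) =
    (fun x => 2%:C%C * G (2 * x + - ln 2)).
  apply/funext => x; rewrite /G /K /h0.
  rewrite mulrACA -cisD mulrA !real_complexM.
  congr (_%:C%C * cis _); last by field.
  rewrite mulrA mulrCA mulfV// mulr1; congr (_ * eg _ _); by ring.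
rewrite -(cInt_affine (- ln 2) _ mG)// /G cIntZ; last first.
  apply: L1_cis; apply: L1R; exact: itg_eg.
by rewrite cInt_eg_cis /K /mker cpow2_cis mulrA.
Qed.

(** Up to a constant and a reflection [mker al] is the transform of [h0 al]; measurability,
    square-integrability and boundedness are all read off from this. *)
Lemma cmeas_mker al : 0 < al -> cmeas (mker al).
Proof.
move=> al0; have h := cmeas_reflect (fourier_cmeas (L1_h0 al0)).
have -> : mker al = (fun eta => (mfactor al)^-1 * F (fun u => (h0 al u)%:C%C) (- eta)).
  by apply/funext => eta; rewrite fourier_h0// opprK mulKf// mfactor_neq0.
by apply: cmeasM => //; exact: cmeas_cst.
Qed.

Lemma L2_mker al : 0 < al -> L2 setT (mker al).
Proof.
move=> al0; have [h _] := fourier_contraction (L1_h0 al0) (L2_h0 al0).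
have -> : mker al = (fun eta => (mfactor al)^-1 * F (fun u => (h0 al u)%:C%C) (- eta)).
  by apply/funext => eta; rewrite fourier_h0// opprK mulKf// mfactor_neq0.
exact: (L2Z _ (L2_reflect h)).
Qed.

Lemma mker_bounded al : 0 < al -> exists M, forall eta, normc (mker al eta) <= M.
Proof.
move=> al0; exists (normc (mfactor al)^-1 *
  (normc (@fourier_factor R) * Int (fun xi => normc (h0 al xi)%:C%C))) => eta.
have -> : mker al eta = (mfactor al)^-1 * F (fun u => (h0 al u)%:C%C) (- eta).
  by rewrite fourier_h0// opprK mulKf// mfactor_neq0.
by rewrite normcM ler_wpM2l ?normc_ge0// fourier_bounded//; exact: L1_h0.
Qed.

(** Dilating t by exp b translates u by b; the prefactor cancels the factor exp (2 al b) so created,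
    so that b enters only through the parameter exp (2 b) of the Gaussian, see [hbE]. *)
Definition hb (al b u : R) : R := expR (- 2 * al * b) * h0 al (u - b).

Lemma hbE al b u : hb al b u = expR (- 2 * al * u - expR (2 * b) * expR (- 2 * u) / 2).
Proof.
rewrite /hb /h0 /eg -!expRD; congr expR.
have -> : expR (- 2 * (u - b) - ln 2) = expR (2 * b) * expR (- 2 * u) / 2.
  by rewrite expRB lnK ?posrE// -expRD; congr (expR _ / _); ring.
by rewrite -expRD; ring.
Qed.

Lemma L1_hb al b : 0 < al -> L1 setT (fun u => (hb al b u)%:C%C).
Proof.
move=> al0; have h := L1Z (expR (- 2 * al * b))%:C%C (L1_translate (- b) (L1_h0 al0)).
have -> : (fun u => (hb al b u)%:C%C) = (fun t : R =>
  (expR (- 2 * al * b))%:C%C * (h0 al (t + - b))%:C%C) => //.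
by apply/funext => u; rewrite real_complexM.
Qed.

Lemma L2_hb al b : 0 < al -> L2 setT (fun u => (hb al b u)%:C%C).
Proof.
move=> al0; have h := L2Z (expR (- 2 * al * b))%:C%C (L2_translate (- b) (L2_h0 al0)).
have -> : (fun u => (hb al b u)%:C%C) = (fun t : R =>
  (expR (- 2 * al * b))%:C%C * (h0 al (t + - b))%:C%C) => //.
by apply/funext => u; rewrite real_complexM.
Qed.

Lemma fourier_hb al b eta : 0 < al -> F (fun u => (hb al b u)%:C%C) eta =
  (expR (- 2 * al * b))%:C%C * mfactor al * (mker al (- eta) * cis (b * eta)).
Proof.
move=> al0; rewrite fourierE.
have -> : (fun u => (hb al b u)%:C%C * cis (eta * u)) = (fun u => (expR (- 2 * al * b))%:C%C *
    ((h0 al (u - b))%:C%C * cis (eta * u))).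
  by apply/funext => u; rewrite mulrA real_complexM.
have h : L1 setT (fun u => (h0 al (u - b))%:C%C) by exact: (L1_translate (- b) (L1_h0 al0)).
rewrite cIntZ; last exact: L1_cis.
rewrite mulrCA -fourierE -[RHS]mulrA; congr (_ * _).
have e := fourier_translate b eta (L1_h0 al0); rewrite /= in e.
by rewrite e (fourier_h0 _ al0) mulrCA (mulrC eta) [cis _ * _]mulrC.
Qed.

End MellinKernel.

(** * Eigenfunctions *)

Section EvenIntegral.
Context {R : realType}.

Lemma ae_neq0 : \forall t \ae @mu R, t != 0.
Proof.
exists [set 0]; split; [exact: measurable_set1|exact: lebesgue_measure_set1|].
by move=> t /= /negP; rewrite negbK => /eqP.
Qed.

Let half (f : R -> R) (t : R) : R := if 0 < t then f t else 0.

Let half_indic (f : R -> R) : half f = (fun t => \1_(positive_axis R) t * f t).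
Proof.
apply/funext => t; rewrite /half indicE; have [t0|t0] := boolP (0 < t).
  by rewrite mem_set ?mul1r// /positive_axis/= in_itv/= t0.
rewrite memNset ?mul0r// /positive_axis/= in_itv/= andbT; exact/negP.
Qed.

Let m1 : measurable_fun setT (\1_(positive_axis R) : R -> R).
Proof. by apply: measurable_indic; exact: measurable_itv. Qed.

Let itg_half f : Itg f -> Itg (half f).
Proof.
move=> fi; rewrite half_indic; apply: (@itg_bounded _ _ _ 1) => // t.
by rewrite indicE; case: (_ \in _); rewrite ?normr1 ?normr0.
Qed.

Let Int_half f : Itg f -> Int (half f) = Int (fun u => expR (- u) * f (expR (- u))).
Proof.
move=> fi; have mf := itg_measurable fi; rewrite /Rintegral; congr fine.
transitivity (\int[@lebesgue_measure R]_(t in positive_axis R) (f t)%:E)%E.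
  rewrite [RHS]integral_mkcond; apply: eq_integral => t _.
  rewrite patchE /half; have [t0|t0] := boolP (0 < t).
    by rewrite mem_set// /positive_axis/= in_itv/= t0.
  rewrite memNset// /positive_axis/= in_itv/= andbT; exact/negP.
rewrite integral_positive_axis; last exact: measurable_funTS.
by apply: eq_integral => u _; rewrite mulrC.
Qed.

(** The negative half of the integral is reflected onto the positive one, the point 0 being a null
    set, and t = exp (- u) is substituted there. *)
Lemma Int_even f : Itg f -> ae_eq (@mu R) setT (fun t => f (- t)) f ->
  Int f = 2 * Int (fun u => expR (- u) * f (expR (- u))).
Proof.
move=> fi fe; have mf := itg_measurable fi.
have hi := itg_half fi; have mh := itg_measurable hi.
have ni := itgB fi hi.
rewrite -(Int_half fi).
have -> : Int f = Int (half f) + Int (fun t => f t - half f t).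
  by rewrite -(intD hi ni); congr Rintegral; apply/funext => t; rewrite addrC subrK.
rewrite mulrDl mul1r; congr (_ + _).
rewrite (Int_reflect (itg_measurable ni)); apply: int_ae_eq.
- exact: (measurable_reflect (itg_measurable ni)).
- exact: mh.
move: (aeI fe ae_neq0); apply: aeS => t [et t0] _; rewrite /half oppr_gt0 et//.
by case: ltgtP t0; rewrite ?eqxx ?subrr ?subr0.
Qed.

Lemma cInt_even (f : R -> R[i]) : L1 setT f -> ae_eq (@mu R) setT (fun t => f (- t)) f ->
  cInt f = 2%:C%C * cInt (fun u => (expR (- u))%:C%C * f (expR (- u))).
Proof.
move=> /L1P[f1 f2] fe.
have e1 : ae_eq (@mu R) setT (fun t => Re (f (- t))) (fun t => Re (f t)).
  by move: fe; apply: aeS => t e It; rewrite e.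
have e2 : ae_eq (@mu R) setT (fun t => Im (f (- t))) (fun t => Im (f t)).
  by move: fe; apply: aeS => t e It; rewrite e.
apply: complexP.
- transitivity (2 * Re (cInt (fun u => (expR (- u))%:C%C * f (expR (- u))))); last first.
    by rewrite [RHS]cReM cReC cImC mul0r subr0.
  rewrite !ReInt (Int_even f1 e1).
  by congr (_ * _); congr Rintegral; apply/funext => u; rewrite !ReImE mul0r subr0.
- transitivity (2 * Im (cInt (fun u => (expR (- u))%:C%C * f (expR (- u))))); last first.
    by rewrite [RHS]cImM cReC cImC mul0r addr0.
  rewrite !ImInt (Int_even f2 e2).
  by congr (_ * _); congr Rintegral; apply/funext => u; rewrite !ReImE mul0r addr0.
Qed.

End EvenIntegral.

(** * The relation between the Mellin transforms of x and of F x *)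

Section EigenRelation.
Context {R : realType}.
Notation F := (@fourier_integral R).
Implicit Types (f x y phi : R -> R[i]) (al b u eta t : R).

Lemma L2_positive_axis x : L2 setT x -> L2 (positive_axis R) x.
Proof.
move=> x2; have [h1 h2] := L2_cmeas x2.
split; first by split; exact: measurable_funTS.
apply: le_lt_trans x2.2; apply: ge0_subset_integral => //.
- exact: measurable_itv.
- by apply/measurable_EFinP; exact: measurable_normc2.
- by move=> t _; rewrite lee_fin sqr_ge0.
Qed.

(** By the multiplication formula such an [f] has weak image 0, which is also the image of 0;
    injectivity concludes. *)
Lemma fourier_eq0 f : L1 setT f -> L2 setT f -> (forall t, F f t = 0) ->
  ae_eq (@mu R) setT f (fun=> 0).
Proof.
move=> f1 f2 f0.
have z2 : L2 setT (fun=> 0 : R[i]).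
  split; first exact: cmeas_cst.
  by rewrite /sqnorm2 integral0_eq// => t _; rewrite normc0 expr0n.
have z h : F h = (fun=> 0) -> L1 setT h -> L2 setT h -> weak_fourier h (fun=> 0).
  move=> h0 h1 h2; split => // k k1 k2.
  by rewrite -(fourier_multiplication h1 k1) h0.
apply: (@weak_fourier_inj _ _ _ (fun=> 0)).
  by apply: z => //; apply/funext.
split=> // k k1 k2.
by congr cintegral; apply/funext => t; rewrite !mul0r.
Qed.

Definition has_parity (s : R[i]) x := ae_eq (@mu R) setT (fun t => x (- t)) (fun t => s * x t).

(* [g b] is the Gaussian [exp (- e^(2b) t^2 / 2)] for [al = 1/4] and
   [t] times it for [al = 3/4]. *)
Definition gaussian_family (al : R) (c s : R[i]) (g : R -> R -> R) :=
  [/\ forall b, L1 setT (fun t => (g b t)%:C%C),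
      forall b, L2 setT (fun t => (g b t)%:C%C),
      forall b t, (g b (- t))%:C%C = s * (g b t)%:C%C,
      forall b u, expR (- u / 2) * g b (expR (- u)) = hb al b u
    & forall b t, F (fun t => (g b t)%:C%C) t =
        c * (expR (- 4 * al * b))%:C%C * (g (- b) t)%:C%C].

Variables (al : R) (c s : R[i]) (g : R -> R -> R).
Hypotheses (al0 : 0 < al) (ss : s * s = 1) (gf : gaussian_family al c s g).

(** [x] and [g b] have the same parity s, and s^2 = 1 makes the product even: hence the factor 2.
    The square root of exp (- u) goes to each factor, which produces [lift x] and [hb]. *)
Lemma cIntM_family x b : L2 setT x -> has_parity s x ->
  cInt (fun t => x t * (g b t)%:C%C) =
  (2 / Num.sqrt (2 * pi))%:C%C * cInt (fun u => lift x u * (hb al b u)%:C%C).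
Proof.
have [g1 g2 gp gh _] := gf.
move=> x2 px; rewrite cInt_even; last 2 first.
- exact: (L2M x2 (g2 b)).
- by apply: aeS px => t e _; rewrite e// gp mulrACA ss mul1r.
have e : (fun u => (expR (- u))%:C%C * (x (expR (- u)) * (g b (expR (- u)))%:C%C)) =
    (fun u => ((Num.sqrt (2 * pi))^-1)%:C%C * (lift x u * (hb al b u)%:C%C)).
  apply/funext => u; rewrite -gh /lift -!real_complexM.
  have -> : expR (- u) = expR (- u / 2) * expR (- u / 2).
    by rewrite -expRD; congr expR; field.
  set p := Num.sqrt _; set q := expR _.
  have p0 : p^-1%:C%C * p%:C%C = 1 :> R[i].
    by rewrite real_complexM mulVf ?gt_eqF ?sqrt2pi_gt0.
  rewrite -!real_complexM -[LHS]mul1r -p0; ring.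
rewrite e cIntZ; last first.
  exact: (L2M (L2_lift (L2_positive_axis x2)) (L2_hb b al0)).
by rewrite mulrA real_complexM.
Qed.


Let core_const : R[i] := (2 / Num.sqrt (2 * pi))%:C%C * (mfactor al / fourier_factor).

Let core_const_neq0 : core_const != 0.
Proof.
have C0 (r : R) : r != 0 -> r%:C%C != 0 by rewrite -normc_eq0 normcR normr_eq0.
have p0 : Num.sqrt (2 * pi) != 0 :> R by rewrite gt_eqF ?sqrt2pi_gt0.
apply: mulf_neq0; first by apply: C0; rewrite mulf_neq0// invr_eq0.
by apply: mulf_neq0; [exact: mfactor_neq0|rewrite invr_eq0 C0// invr_eq0].
Qed.

(** Duality moves F onto [hb], whose transform carries the character [cis (b * eta)]; as b varies
    the pairings are thus the values of one Fourier integral. *)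
Lemma cIntM_family_fourier x phi b : L2 setT x -> has_parity s x ->
  weak_fourier phi (lift x) ->
  cInt (fun t => x t * (g b t)%:C%C) =
  core_const * (expR (- 2 * al * b))%:C%C * F (fun eta => phi eta * mker al (- eta)) b.
Proof.
move=> x2 px [phi2 _ W]; rewrite cIntM_family//.
rewrite (W _ (L1_hb b al0) (L2_hb b al0)) fourierE /core_const.
under [X in cintegral setT X]eq_fun do rewrite fourier_hb//.
have -> : (fun t => phi t * ((expR (-2 * al * b))%:C%C * mfactor al *
      (mker al (- t) * cis (b * t)))) =
    (fun t => (expR (-2 * al * b))%:C%C * mfactor al *
      (phi t * mker al (- t) * cis (b * t))).
  by apply/funext => t; ring.
rewrite cIntZ; last by apply: L1_cis; exact: (L2M phi2 (L2_reflect (L2_mker al0))).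
set I := cInt _; have f0 : (@fourier_factor R)^-1 * fourier_factor = 1.
  by rewrite mulVf// -normc_eq0 normcR normr_eq0 invr_eq0 gt_eqF ?sqrt2pi_gt0.
by rewrite -[LHS]mulr1 -f0; ring.
Qed.

(* Both sides are compared through their Fourier transforms, which are the
   pairings of [y] and [x] with the functions [g b]. *)
Lemma mellin_relation x y phi phi' : has_parity s x -> has_parity s y ->
  weak_fourier phi (lift x) -> weak_fourier phi' (lift y) -> weak_fourier x y ->
  ae_eq (@mu R) setT (fun eta => phi' eta * mker al (- eta))
    (fun eta => c * (phi (- eta) * mker al eta)).
Proof.
have [g1 g2 gp gh gF] := gf.
move=> px py Wx Wy [x2 y2 Wxy].
have [phi2 _ _] := Wx; have [phi'2 _ _] := Wy.
pose A eta := phi eta * mker al (- eta).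
pose B eta := phi' eta * mker al (- eta).
have mm2 : L2 setT (fun eta => mker al (- eta)) := L2_reflect (L2_mker al0).
have [M hM] := mker_bounded al0.
have A1 : L1 setT A := L2M phi2 mm2.
have B1 : L1 setT B := L2M phi'2 mm2.
have mmm := L2_cmeas mm2.
have A2 : L2 setT A.
  have := L2M_bounded mmm (fun t => hM (- t)) phi2.
  by congr (L2 _ _); apply/funext => t; rewrite mulrC.
have B2 : L2 setT B.
  have := L2M_bounded mmm (fun t => hM (- t)) phi'2.
  by congr (L2 _ _); apply/funext => t; rewrite mulrC.
(* [y] paired with [g b] is [x] paired with [F (g b)], a multiple of [g (- b)]; this reverses the
   sign of b. *)
have key b : F B b = c * F A (- b).
  have := Wxy _ (g1 b) (g2 b).
  rewrite (cIntM_family_fourier b y2 py Wy).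
  have -> : (fun t => x t * F (fun t0 => (g b t0)%:C%C) t) =
      (fun t => c * (expR (- 4 * al * b))%:C%C * (x t * (g (- b) t)%:C%C)).
    by apply/funext => t; rewrite gF; ring.
  rewrite cIntZ; last exact: (L2M x2 (g2 (- b))).
  rewrite (cIntM_family_fourier (- b) x2 px Wx) -/A -/B.
  (* The factor in the transform of [g b] is what makes all exponentials in b cancel. *)
  have e : (expR (- 4 * al * b))%:C%C * (expR (- 2 * al * - b))%:C%C =
      (expR (- 2 * al * b))%:C%C :> R[i].
    by rewrite real_complexM -expRD; congr (expR _)%:C%C; ring.
  set E := (expR (- 2 * al * b))%:C%C in e *.
  have E0 : E != 0 by rewrite -normc_eq0 normcR normr_eq0 gt_eqF ?expR_gt0.
  rewrite -e => h; have : core_const * E * F B b = core_const * E * (c * F A (- b)).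
    by rewrite -{1}e h -e; ring.
  by apply: mulfI; rewrite mulf_neq0.
pose D eta := B eta - c * A (- eta).
have cA1 := L1Z c (L1_reflect A1); have cA2 := L2Z c (L2_reflect A2).
have D0 : ae_eq (@mu R) setT D (fun=> 0).
  apply: fourier_eq0; [exact: L1B|exact: (L2B B2 cA2)|move=> b].
  rewrite /D (fourierB b B1 cA1) key.
  have -> : F (fun s => c * A (- s)) b = c * F A (- b).
    rewrite -(fourier_reflect b A1) !fourierE mulrCA; congr (_ * _).
    rewrite -cIntZ; last by apply: L1_cis; exact: L1_reflect.
    by congr cintegral; apply/funext => t; rewrite mulrA.
  by rewrite subrr.
apply: aeS D0 => eta /(_ I) /eqP; rewrite subr_eq0 => /eqP e _.
by rewrite -/(B eta) e /A opprK.
Qed.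

End EigenRelation.

(** * Functions of given parity and their restriction to the positive axis *)

Section ParityLift.
Context {R : realType}.
Notation F := (@fourier_integral R).
Implicit Types (f x y phi psi : R -> R[i]) (al b u eta t : R) (s c tau : R[i]).

Lemma sign_normc s : s * s = 1 -> normc s = 1.
Proof.
move=> ss; have := congr1 (@normc R) ss; rewrite normcM normc1 -expr2 => e.
by apply/eqP; rewrite -sqrp_eq1 ?normc_ge0// e.
Qed.

Lemma N2_lift s x : s * s = 1 -> L2 setT x -> has_parity s x ->
  N2 x = pi^-1 * N2 (lift x).
Proof.
move=> ss x2 px; have xi := L2_itg x2.
have e : ae_eq (@mu R) setT (fun t => normc (x (- t)) ^+ 2) (fun t => normc (x t) ^+ 2).
  by apply: aeS px => t e It; rewrite (e It) normcM sign_normc// mul1r.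
rewrite (Int_even xi e).
have l2 := L2_itg (L2_lift (L2_positive_axis x2)).
rewrite -(intZ _ l2) -intZ.
  congr Rintegral; apply/funext => u; rewrite sqr_normc_lift.
  by move: (pi) (@pi_gt0 R) => p p0; field; rewrite gt_eqF.
have := itgZ ((2 * pi)^-1) l2; congr (integrable _ _ (_ \o _)); apply/funext => u.
by rewrite sqr_normc_lift; move: (pi) (@pi_gt0 R) => p p0; field; rewrite gt_eqF.
Qed.

(** [lift] sees the positive axis only; the common parity determines the rest, here through the norm
    identity [N2_lift] for the difference. *)
Lemma lift_inj s x y : s * s = 1 -> L2 setT x -> L2 setT y ->
  has_parity s x -> has_parity s y -> ae_eq (@mu R) setT (lift x) (lift y) ->
  ae_eq (@mu R) setT x y.
Proof.
move=> ss x2 y2 px py xy.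
have d2 := L2B x2 y2.
have pd : has_parity s (fun t => x t - y t).
  by move: (aeI px py); apply: aeS => t [ex ey] It; rewrite ex// ey// mulrBr.
have l0 : N2 (lift (fun t => x t - y t)) = 0.
  have z2 : cmeas (fun _ : R => 0 : R[i]) := @cmeas_cst R _ _ 0.
  rewrite (N2_ae_eq (L2_cmeas (L2_lift (L2_positive_axis d2))) z2).
    by rewrite normc0 expr0n /Rintegral integral0.
  by apply: aeS xy => u e It; rewrite /lift mulrBr -/(lift x u) (e It) subrr.
have := N2_eq0 d2; rewrite (N2_lift ss d2 pd) l0 mulr0 => /(_ erefl).
by apply: aeS => t e It; apply/eqP; rewrite -subr_eq0 (e It).
Qed.

Lemma lift_eq x y : (forall t, 0 < t -> x t = y t) -> lift x = lift y.
Proof. by move=> xy; apply/funext => u; rewrite /lift xy// expR_gt0. Qed.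

(** The value at 0 is left free, which covers both [even_extension] and [odd_extension]. *)
Definition parity_extension s x e := (forall t, 0 < t -> e t = x t) /\
  (forall t, 0 < t -> e (- t) = s * x t).

(** [x] is controlled on the positive axis only, so it is cut off to [xp]; away from 0 the extension
    is the sum of [xp] and of s times its reflection. *)
Lemma parity_extension_L2 s x e : parity_extension s x e ->
  L2 (positive_axis R) x -> L2 setT e.
Proof.
move=> [ep en] [[m1 m2] x2]; pose D := positive_axis R.
have mD : measurable D by exact: measurable_itv.
pose xp t : R[i] := if 0 < t then x t else 0.
have xpE (h : R[i] -> R) : h 0 = 0 -> (fun t => h (xp t)) = (fun t => h (x t)) \_ D.
  move=> h0; apply/funext => t; rewrite patchE /xp.
  have [t0|t0] := boolP (0 < t); first by rewrite mem_set// /D /positive_axis/= in_itv/= t0.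
  rewrite h0 memNset//.
  by rewrite /D /positive_axis/= in_itv/= andbT; exact/negP.
have xpL : L2 setT xp.
  split.
    split; first by rewrite (xpE (@complex.Re R))//; apply: (measurable_restrictT _ mD).1.
    by rewrite (xpE (@complex.Im R))//; apply: (measurable_restrictT _ mD).1.
  rewrite /sqnorm2; move: x2; rewrite /sqnorm2 [X in (X < _)%E -> _]integral_mkcond.
  congr (_ < _)%E; apply: eq_integral => t _.
  rewrite patchE /xp; have [t0|t0] := boolP (0 < t).
    by rewrite mem_set// /D /positive_axis/= in_itv/= t0.
  rewrite memNset//; first by rewrite normc0 expr0n.
  by rewrite /D /positive_axis/= in_itv/= andbT; exact/negP.
pose r t := xp t + s * xp (- t).
have rL : L2 setT r by exact: (L2D xpL (L2Z s (L2_reflect xpL))).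
have er t : t != 0 -> e t = r t.
  rewrite /r /xp oppr_gt0; case: (ltgtP t 0) => // t0 _.
    by rewrite add0r -en ?opprK// oppr_gt0.
  by rewrite mulr0 addr0 ep.
apply: (L2_ae_eq _ _ rL); last by apply: aeS ae_neq0 => t t0 _; rewrite er.
(* Equality almost everywhere does not transfer Borel measurability, so the discrepancy at 0 is
   written as an explicit indicator term. *)
have -> : e = (fun t => r t + (\1_[set 0] t)%:C%C * (e 0 - r 0)).
  apply/funext => t; rewrite indicE; have [->|t0] := eqVneq t 0.
    by rewrite mem_set// mul1r addrC subrK.
  by rewrite memNset ?mul0r ?addr0 ?er//; exact/eqP.
apply: cmeasD; first exact: L2_cmeas rL.
apply: cmeasM; last exact: cmeas_cst.
by apply: cmeasR; apply: measurable_indic; exact: measurable_set1.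
Qed.

Lemma parity_extension_parity s x e : s * s = 1 -> parity_extension s x e ->
  has_parity s e.
Proof.
move=> ss [ep en].
apply: aeS ae_neq0 => t; case: (ltgtP t 0) => // t0 _ _; last by rewrite en// ep.
have h : 0 < - t by rewrite oppr_gt0.
by rewrite (ep _ h) -{2}[t]opprK (en _ h) mulrA ss mul1r.
Qed.

Lemma weak_fourier_reflect x y : weak_fourier x y ->
  weak_fourier (fun t => x (- t)) (fun t => y (- t)).
Proof.
move=> W; have W1 := weak_fourier_inversion W.
exact: weak_fourier_inversion W1.
Qed.

(** Inversion makes the input an output up to reflection, where a change on a null set is already
    allowed, and further inversions lead back. *)
Lemma weak_fourier_ae_eql x x' y : weak_fourier x y -> cmeas x' ->
  ae_eq (@mu R) setT x x' -> weak_fourier x' y.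
Proof.
move=> W mx' xx'; have W1 := weak_fourier_inversion W.
have W2 := weak_fourier_ae_eq W1 (cmeas_reflect mx').
have e : ae_eq (@mu R) setT (fun t => x (- t)) (fun t => x' (- t)).
  exact: (ae_reflect xx').
have := weak_fourier_inversion (weak_fourier_reflect (W2 e)).
by congr weak_fourier; apply/funext => t; rewrite opprK.
Qed.

End ParityLift.

(** * Eigenspaces and their representations, for all four eigenvalues at once *)

Section Eigenspaces.
Context {R : realType}.
Notation F := (@fourier_integral R).
Implicit Types (f x y phi psi : R -> R[i]) (b u eta t : R).

Lemma representedE (al : R) psi x : represented al psi x <->
  L2 (positive_axis R) x /\ weak_fourier (fun eta => psi eta * mker al eta) (lift x).
Proof.
rewrite /represented -inverse_mellinE.
have -> // : (fun eta => psi eta * cpow 2 (0 +i* (eta / 2))%C * cGamma (al +i* (eta / 2))%C) =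
  (fun eta => psi eta * mker al eta).
by apply/funext => eta; rewrite /mker mulrA.
Qed.

Lemma weighted_sqnorm2E (al : R) psi :
  weighted_sqnorm2 al psi = sqnorm2 setT (fun eta => psi eta * mker al eta).
Proof.
by apply: eq_integral => eta _; rewrite normcM normc_mker exprMn.
Qed.

Lemma weighted_L2E (al : R) psi : 0 < al -> weighted_L2 al psi <->
  cmeas psi /\ L2 setT (fun eta => psi eta * mker al eta).
Proof.
move=> al0; rewrite /weighted_L2/= weighted_sqnorm2E; split.
- move=> [m h]; split=> //; split=> //.
  by apply: cmeasM => //; exact: cmeas_mker.
- by move=> [m [_ h]]; split.
Qed.

(** Plancherel for psi times the kernel; the factor 2^(i eta / 2) has modulus 1, and 1 / (2 pi) is
    the ratio of norms in [sqnorm2_lift]. *)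
Lemma parseval (al : R) psi x : 0 < al -> weighted_L2 al psi -> represented al psi x ->
  sqnorm2 (positive_axis R) x = (((2 * pi)^-1)%:E * weighted_sqnorm2 al psi)%E.
Proof.
move=> al0 /(weighted_L2E _ al0)[_ p2] /representedE[x2 W].
rewrite weighted_sqnorm2E sqnorm2_lift; last by case: x2.
by rewrite (L2_sqnorm2 (L2_lift x2)) (L2_sqnorm2 p2) (weak_fourier_N2 W).
Qed.

(** The inverse of the kernel m is its conjugate over |m|^2, and 1 / |m|^2 is written exp (- ln
    |m|^2), a composition of measurable functions. *)
Lemma cmeas_div_mker (al : R) phi : 0 < al -> cmeas phi ->
  cmeas (fun eta => phi eta / mker al eta).
Proof.
move=> al0 mphi; have mm := cmeas_mker al0.
have -> : (fun eta => phi eta / mker al eta) = (fun eta => phi eta *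
    ((expR (- ln (normc (mker al eta) ^+ 2)))%:C%C * conjc (mker al eta))).
  apply/funext => eta; congr (_ * _); have m0 := mker_neq0 eta al0.
  apply: (mulfI m0); rewrite divff// mulrCA mul_conjc real_complexM expRN lnK ?mulVf//.
    by rewrite sqrf_eq0 normc_eq0.
  by rewrite posrE exprn_gt0// lt_neqAle normc_ge0 eq_sym normc_eq0 m0.
apply: cmeasM => //; apply: cmeasM; last exact: cmeasJ.
apply: cmeasR; apply: (measurableT_comp (@measurable_expR R)).
apply: measurableT_comp => //; apply: (measurableT_comp (@measurable_ln R)).
exact: measurable_normc2.
Qed.

(** The eigenvalue is c tau: c = 1 gives 1 and -1, c = i gives i and -i. Its square s = c^2 is the
    parity of [x], and tau is that of [psi]. *)
Variables (al : R) (c s tau : R[i]) (g : R -> R -> R).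
Hypotheses (al0 : 0 < al) (ss : s * s = 1) (cc : c * c = s) (tt : tau * tau = 1).
Hypothesis gf : gaussian_family al c s g.

Let c0 : c != 0.
Proof.
by apply: contraTneq (oner_neq0 R[i]) => c0; rewrite -ss -cc c0 !mul0r eqxx.
Qed.

Let ll : (c * tau) * (c * tau) = s.
Proof. by rewrite mulrACA cc tt mulr1. Qed.

Lemma eigenspace_L2 x : fourier_eigenspace (c * tau) x -> L2 setT x.
Proof. by case. Qed.

(** The operator applied twice is the reflection on one side and multiplication by (c tau)^2 = s on
    the other. *)
Lemma eigenspace_parity x : fourier_eigenspace (c * tau) x -> has_parity s x.
Proof.
move=> /weak_fourierE W; have W1 := weak_fourier_inversion W.
have W2 := weak_fourierZ (c * tau) W.
have := weak_fourier_uniq W1 W2; apply: aeS => t e It.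
by rewrite (e It) mulrA ll.
Qed.

(** Both sides contain the nonzero factor c m(eta) m(-eta), m being the kernel; what remains is tau
    psi(eta) = psi(-eta). *)
Lemma relation_parity psi phi : (forall eta, phi eta = psi eta * mker al eta) ->
  (ae_eq (@mu R) setT (fun eta => c * tau * phi eta * mker al (- eta))
    (fun eta => c * (phi (- eta) * mker al eta))) <-> has_parity tau psi.
Proof.
move=> phiE; split; apply: aeS => eta e It; move: (e It); rewrite !phiE => h.
- have m0 : c * (mker al eta * mker al (- eta)) != 0.
    by rewrite mulf_neq0// mulf_neq0// mker_neq0.
  apply: (mulfI m0); transitivity (c * (psi (- eta) * mker al (- eta) * mker al eta)).
    by ring.
  by rewrite -h; ring.
- by rewrite h; ring.
Qed.

Lemma eigenspace_represented x : fourier_eigenspace (c * tau) x ->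
  exists psi, [/\ has_parity tau psi, weighted_L2 al psi & represented al psi x].
Proof.
move=> Ex; have x2 := eigenspace_L2 Ex; have px := eigenspace_parity Ex.
have xp2 := L2_positive_axis x2.
have [phi W] := weak_fourier_surj (L2_lift xp2).
have [phi2 _ _] := W; have mphi := L2_cmeas phi2.
have phiE : (fun eta => phi eta / mker al eta * mker al eta) = phi.
  by apply/funext => eta; rewrite divfK// mker_neq0.
exists (fun eta => phi eta / mker al eta); split.
- apply/(@relation_parity _ phi) => [eta|]; first by rewrite divfK// mker_neq0.
  have W' : weak_fourier (fun eta => c * tau * phi eta) (lift (fun t => c * tau * x t)).
    have := weak_fourierZ (c * tau) W; congr weak_fourier.
    by apply/funext => u; rewrite /lift mulrCA.
  have pcx : has_parity s (fun t => c * tau * x t).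
    by apply: aeS px => t e It; rewrite (e It) mulrCA.
  exact: (mellin_relation al0 ss gf px pcx W W' ((weak_fourierE _ _).2 Ex)).
- by apply/weighted_L2E => //; rewrite phiE; split => //; exact: cmeas_div_mker.
- by apply/representedE; rewrite phiE.
Qed.

(** The image [z] of [x] has parity s and some Mellin transform [phi']. The relation for the pair
    [x], [z] and the parity of [psi] prescribe the same product of [phi'] with the reflected kernel,
    so [phi'] is c tau times the transform of [x], and [z] is c tau times [x]. *)
Lemma represented_eigenspace psi x : has_parity tau psi -> weighted_L2 al psi ->
  represented al psi x -> L2 setT x -> has_parity s x ->
  fourier_eigenspace (c * tau) x.
Proof.
move=> ppsi wpsi /representedE[xp2 W] x2 px; apply/weak_fourierE.
have rel := (relation_parity (fun eta => erefl (psi eta * mker al eta))).2 ppsi.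
have [z Wz] := weak_fourier_exists x2; have [_ z2 _] := Wz.
have pz : has_parity s z.
  have Ws := weak_fourierZ s Wz.
  have := weak_fourier_ae_eql (weak_fourier_reflect Wz) (L2_cmeas (L2Z s x2)) px.
  by move=> /weak_fourier_uniq; exact.
have zp2 := L2_positive_axis z2.
have [phi' W'] := weak_fourier_surj (L2_lift zp2).
have rel' := mellin_relation al0 ss gf px pz W W' Wz.
have y2 := L2Z (c * tau) x2.
have py : has_parity s (fun t => c * tau * x t).
  by apply: aeS px => t e It; rewrite (e It) mulrCA.
have Wy : weak_fourier (fun eta => c * tau * (psi eta * mker al eta))
    (lift (fun t => c * tau * x t)).
  have := weak_fourierZ (c * tau) W; congr weak_fourier.
  by apply/funext => u; rewrite /lift mulrCA.
have e : ae_eq (@mu R) setT phi' (fun eta => c * tau * (psi eta * mker al eta)).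
  move: (aeI rel rel'); apply: aeS => eta [e1 e2] It.
  apply: (mulIf (mker_neq0 (- eta) al0)).
  by rewrite (e2 It) -(e1 It).
have [m1 _ _] := Wy.
have W'' := weak_fourier_ae_eql W' (L2_cmeas m1) e.
have zy := lift_inj ss z2 y2 pz py (weak_fourier_uniq W'' Wy).
exact: (weak_fourier_ae_eq Wz (L2_cmeas y2) zy).
Qed.

Lemma extension_eigenspace psi x e : has_parity tau psi -> weighted_L2 al psi ->
  represented al psi x -> parity_extension s x e -> fourier_eigenspace (c * tau) e.
Proof.
move=> ppsi wpsi /representedE[xp2 W] ex.
have e2 := parity_extension_L2 ex xp2.
apply: (represented_eigenspace ppsi wpsi) => //; last exact: parity_extension_parity ex.
apply/representedE; split; first exact: L2_positive_axis.
by rewrite (lift_eq ex.1).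
Qed.

(** [psi] is determined because the kernel does not vanish, and [x] because its parity extends
    uniqueness from the positive axis to the line. [Psi] is abstract so as to accept [even_fun] and
    [odd_fun]. *)
Lemma eigenspace_one_to_one (Psi : set (R -> R[i])) : Psi = has_parity tau ->
  one_to_one (fourier_eigenspace (c * tau)) (Psi `&` weighted_L2 al) (represented al).
Proof.
move=> ->; split.
- move=> x /eigenspace_represented[psi [p1 p2 p3]]; by exists psi.
- move=> psi [p1 p2]; have [_ phi2] := (weighted_L2E psi al0).1 p2.
  have [X W] := weak_fourier_exists phi2; have [_ X2 _] := W.
  pose x := unlift X; have x2 : L2 (positive_axis R) x := L2_unlift X2.
  have rx : represented al psi x.
    apply/representedE; split=> //.
    by rewrite (_ : lift x = X)//; apply/funext => u; exact: unliftK.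
  pose e t : R[i] := if 0 < t then x t else s * x (- t).
  have ex : parity_extension s x e.
    by split=> t t0; rewrite /e ?t0// oppr_gt0 ltNge (ltW t0)/= opprK.
  exists e; first exact: (extension_eigenspace p1 p2 rx ex).
  apply/representedE; split; first exact: (L2_positive_axis (parity_extension_L2 ex x2)).
  by rewrite (lift_eq ex.1); have /representedE[] := rx.
- move=> x psi1 psi2 _ _ _ /representedE[_ W1] /representedE[_ W2].
  have := weak_fourier_inj W1 W2; apply: aeS => eta e It.
  exact: (mulIf (mker_neq0 eta al0) (e It)).
- move=> psi x1 x2 _ X1 X2 /representedE[_ W1] /representedE[_ W2].
  apply: (lift_inj ss (eigenspace_L2 X1) (eigenspace_L2 X2) (eigenspace_parity X1)
    (eigenspace_parity X2)).
  exact: weak_fourier_uniq W1 W2.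
Qed.

End Eigenspaces.

(** * The two Gaussian families and the parity predicates *)

Section GaussianFamilies.
Context {R : realType}.
Notation F := (@fourier_integral R).

Let sqrt_expR2 (b : R) : Num.sqrt (expR (2 * b)) = expR b.
Proof.
by rewrite (_ : expR (2 * b) = expR b ^+ 2) ?sqrtr_sqr ?gtr0_norm ?expR_gt0// -expRM_natl.
Qed.

Let gauss_expR (b u : R) : gauss (expR (2 * b)) (expR (- u)) =
  expR (- (expR (2 * b) * expR (- 2 * u) / 2)).
Proof.
have e : expR (- u) ^+ 2 = expR (- 2 * u) by rewrite -expRM_natl; congr expR; ring.
by rewrite /gauss e; congr expR; field.
Qed.

(** The Gaussian of parameter exp (2 b) is sent to exp (- b) times that of parameter exp (- 2 b),
    and 4 al = 1. *)
Lemma gaussian_family_even :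
  gaussian_family (1 / 4) 1 1 (fun b => gauss (expR (2 * b)) : R -> R).
Proof.
split=> [b|b|b t|b u|b t].
- by rewrite gaussC; apply: L1_gauss_cis; exact: expR_gt0.
- by rewrite gaussC; apply: L2_gauss_cis; exact: expR_gt0.
- by rewrite gauss_even mul1r.
- by rewrite gauss_expR hbE -expRD; congr expR; field.
- rewrite gaussC fourier_gauss ?expR_gt0// sqrt_expR2 add0r mul1r real_complexM.
  by rewrite -!expRN mulrN; congr (expR _ * _)%:C%C; field.
Qed.

(** The extra factor t turns the scalar into i exp (- 3 b), and 4 al = 3; it also changes exp (- u /
    2) into exp (- 3 u / 2), whence al = 3/4. *)
Lemma gaussian_family_odd :
  gaussian_family (3 / 4) 'i%C (- 1) (fun b t => t * gauss (expR (2 * b)) t : R).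
Proof.
have L1g b : L1 setT (fun t : R => (t * gauss (expR (2 * b)) t)%:C%C).
  by apply: L1R; apply: itg_xgauss; exact: expR_gt0.
split=> [//|b|b t|b u|b t].
- apply: (bounded_L2 (L1g b)) => t; rewrite normcR normrM (ger0_norm (gauss_ge0 _ _)).
  apply: le_trans (gauss_decay t (expR_gt0 (2 * b))).
  by rewrite ler_wpM2r ?gauss_ge0// norm_le_1Dsqr.
- by rewrite gauss_even mulNr mulN1r; apply: complexP; rewrite !ReImE ?oppr0.
- by rewrite gauss_expR hbE -!expRD; congr expR; field.
- rewrite fourier_xgauss ?expR_gt0// sqrt_expR2 -[RHS]mulrA real_complexM -!expRN mulrN.
  congr (_ * _%:C%C).
  have -> : expR (- 4 * (3 / 4) * b) = expR (- (2 * b)) * expR (- b).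
    by rewrite -expRD; congr expR; field.
  by ring.
Qed.

Lemma even_funE : even_fun R = has_parity 1.
Proof.
by apply/seteqP; split=> psi; apply: aeS => t e It; move: (e It); rewrite mul1r.
Qed.

Lemma odd_funE : odd_fun R = has_parity (- 1).
Proof.
by apply/seteqP; split=> psi; apply: aeS => t e It; move: (e It); rewrite mulN1r.
Qed.

Lemma even_extensionP (x : R -> R[i]) : parity_extension 1 x (even_extension x).
Proof.
by split=> t t0; rewrite /even_extension ?normrN gtr0_norm ?mul1r.
Qed.

Lemma odd_extensionP (x : R -> R[i]) : parity_extension (- 1) x (odd_extension x).
Proof.
split=> t t0; rewrite /odd_extension ?normrN ?sgrN gtr0_norm// gtr0_sg// ?mul1r//.
by congr (_ * _); apply: complexP; rewrite /= ?oppr0.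
Qed.

End GaussianFamilies.

Theorem theorem3p3 (R : realType) :
  ((forall x : R -> R[i], fourier_eigenspace 1 x ->
      exists psi : R -> R[i],
        [/\ even_fun R psi, weighted_L2 (1 / 4) psi & represented (1 / 4) psi x])
   /\
   (forall psi x : R -> R[i],
      even_fun R psi -> weighted_L2 (1 / 4) psi -> represented (1 / 4) psi x ->
      fourier_eigenspace 1 (even_extension x)))
  /\
  ((forall x : R -> R[i], fourier_eigenspace (- 1) x ->
      exists psi : R -> R[i],
        [/\ odd_fun R psi, weighted_L2 (1 / 4) psi & represented (1 / 4) psi x])
   /\
   (forall psi x : R -> R[i],
      odd_fun R psi -> weighted_L2 (1 / 4) psi -> represented (1 / 4) psi x ->
      fourier_eigenspace (- 1) (even_extension x)))
  /\
  ((forall x : R -> R[i], fourier_eigenspace 'i%C x ->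
      exists psi : R -> R[i],
        [/\ even_fun R psi, weighted_L2 (3 / 4) psi & represented (3 / 4) psi x])
   /\
   (forall psi x : R -> R[i],
      even_fun R psi -> weighted_L2 (3 / 4) psi -> represented (3 / 4) psi x ->
      fourier_eigenspace 'i%C (odd_extension x)))
  /\
  ((forall x : R -> R[i], fourier_eigenspace (- 'i%C) x ->
      exists psi : R -> R[i],
        [/\ odd_fun R psi, weighted_L2 (3 / 4) psi & represented (3 / 4) psi x])
   /\
   (forall psi x : R -> R[i],
      odd_fun R psi -> weighted_L2 (3 / 4) psi -> represented (3 / 4) psi x ->
      fourier_eigenspace (- 'i%C) (odd_extension x)))
  /\
  one_to_one (fourier_eigenspace 1) (even_fun R `&` weighted_L2 (1 / 4))
    (represented (1 / 4))
  /\
  one_to_one (fourier_eigenspace (- 1)) (odd_fun R `&` weighted_L2 (1 / 4))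
    (represented (1 / 4))
  /\
  one_to_one (fourier_eigenspace 'i%C) (even_fun R `&` weighted_L2 (3 / 4))
    (represented (3 / 4))
  /\
  one_to_one (fourier_eigenspace (- 'i%C)) (odd_fun R `&` weighted_L2 (3 / 4))
    (represented (3 / 4))
  /\
  (forall psi x : R -> R[i], (even_fun R psi \/ odd_fun R psi) ->
     weighted_L2 (1 / 4) psi -> represented (1 / 4) psi x ->
     sqnorm2 (positive_axis R) x
     = (((2 * pi)^-1)%:E * weighted_sqnorm2 (1 / 4) psi)%E)
  /\
  (forall psi x : R -> R[i], (even_fun R psi \/ odd_fun R psi) ->
     weighted_L2 (3 / 4) psi -> represented (3 / 4) psi x ->
     sqnorm2 (positive_axis R) x
     = (((2 * pi)^-1)%:E * weighted_sqnorm2 (3 / 4) psi)%E).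
Proof.
have q0 : 0 < 1 / 4 :> R by lra.
have t0 : 0 < 3 / 4 :> R by lra.
have e11 : 1 * 1 = 1 :> R[i] by rewrite mulr1.
have eNN : - 1 * - 1 = 1 :> R[i] by rewrite mulrNN mulr1.
have eii : 'i%C * 'i%C = - 1 :> R[i] by rewrite -expr2 sqr_i.
have ge := @gaussian_family_even R; have go := @gaussian_family_odd R.
(* The three sign equations, in order, fix s, c and tau: s = 1 and c = 1 for al = 1/4, s = -1 and c
   = i for al = 3/4, and tau = 1 or -1 for even or odd [psi]. *)
have E1 x := @eigenspace_represented R _ _ _ _ _ q0 e11 e11 e11 ge x.
have E2 x := @eigenspace_represented R _ _ _ _ _ q0 e11 e11 eNN ge x.
have E3 x := @eigenspace_represented R _ _ _ _ _ t0 eNN eii e11 go x.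
have E4 x := @eigenspace_represented R _ _ _ _ _ t0 eNN eii eNN go x.
have X1 := @extension_eigenspace R _ _ _ 1 _ q0 e11 e11 ge.
have X2 := @extension_eigenspace R _ _ _ (- 1) _ q0 e11 e11 ge.
have X3 := @extension_eigenspace R _ _ _ 1 _ t0 eNN eii go.
have X4 := @extension_eigenspace R _ _ _ (- 1) _ t0 eNN eii go.
have O1 := @eigenspace_one_to_one R _ _ _ _ _ q0 e11 e11 e11 ge _ even_funE.
have O2 := @eigenspace_one_to_one R _ _ _ _ _ q0 e11 e11 eNN ge _ odd_funE.
have O3 := @eigenspace_one_to_one R _ _ _ _ _ t0 eNN eii e11 go _ even_funE.
have O4 := @eigenspace_one_to_one R _ _ _ _ _ t0 eNN eii eNN go _ odd_funE.
rewrite mulr1 in E1 X1 O1; rewrite mul1r in E2 X2 O2.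
rewrite mulr1 in E3 X3 O3; rewrite mulrN1 in E4 X4 O4.
rewrite even_funE odd_funE; rewrite even_funE in O1 O3; rewrite odd_funE in O2 O4.
split; first by split; [exact: E1|move=> psi x p w r; exact: (X1 _ _ _ p w r (even_extensionP x))].
split; first by split; [exact: E2|move=> psi x p w r; exact: (X2 _ _ _ p w r (even_extensionP x))].
split; first by split; [exact: E3|move=> psi x p w r; exact: (X3 _ _ _ p w r (odd_extensionP x))].
split; first by split; [exact: E4|move=> psi x p w r; exact: (X4 _ _ _ p w r (odd_extensionP x))].
split; first exact: O1.
split; first exact: O2.
split; first exact: O3.
split; first exact: O4.
by split=> psi x _; [exact: (parseval q0)|exact: (parseval t0)].
Qed.
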